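(* Let $\rho(r)$ be an arbitrary proximate order, $\rho=\rho(\infty)$, let $\mu$ be a Radon measure on $(0,\infty)$ of class $\mathfrak M(\rho(r))$, and let $K$ be a Borel function on $(0,\infty)$ such that $t^{\rho-1}\gamma(t)K(t)\in L_1(0,\infty)$. Suppose that the function $\lambda\mapsto\int_0^\infty K(t)t^{\rho-1-i\lambda}dt$ does not vanish on the real line, and let $$\Psi(r)=\int_0^\infty K\left(\frac tr\right)d\mu(t).$$ Then, if the measure $s$, $ds(t)=\Psi(t)\,dt$, is a regular measure with respect to the proximate order $\rho(r)+1$, then the measure $\mu$ is a regular measure with respect to the proximate order $\rho(r)$; moreover, if $Fr[\rho(r)+1,s]$ consists of the measure with density $c\,t^\rho$, then $Fr[\mu]$ consists of the measure with density $\frac c{c_1}t^{\rho-1}$, where $c_1=\int_0^\infty K(t)t^{\rho-1}dt$.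
   Context: Proximate orders: a zero proximate order is a real function $\hat\rho(r)$ on $(0,\infty)$ (possibly undefined at $r=1$) such that $\lim_{r\to\infty}\hat\rho(r)=0$; $\hat\rho(1/r)=-\hat\rho(r)$; $\hat\rho$ is continuously differentiable on $(0,\infty)\setminus\{1\}$; $\lim_{r\to\infty}r\ln r\,\hat\rho'(r)=0$; and $r^{\hat\rho(r)}$ extends continuously to $r=1$ with value $1$. A proximate order is $\rho(r)=\rho+\hat\rho(r)$ with $\rho\in\mathbb R$ and $\hat\rho$ a zero proximate order; $\rho=\rho(\infty)=\lim_{r\to\infty}\rho(r)$. Put $V(r)=r^{\rho(r)}$ and $\gamma(t)=\sup_{r>0}\frac{V(rt)}{t^\rho V(r)}$. Radon measures: a real Radon measure on $(0,\infty)$ is $\mu=\mu_1-\mu_2$ with $\mu_1,\mu_2$ mutually singular positive Borel measures, finite on compact subsets of $(0,\infty)$; a complex Radon measure is $\mu_1+i\mu_2$ with $\mu_1,\mu_2$ real Radon measures; $|\mu|$ is the total variation. Wide convergence $\mu_n\to\mu$ means $\int\varphi\,d\mu_n\to\int\varphi\,d\mu$ for every continuous $\varphi$ with compact support in $(0,\infty)$. $\mathfrak M(\rho(r))$ is the set of Radon measures on $(0,\infty)$ with $\sup_{r>0}|\mu|([r,er])/V(r)<\infty$. With $\mu_t(E)=\mu(tE)/V(t)$, the Azarin limit set $Fr[\mu]=Fr[\rho(r),\mu]$ is the set of all wide limits $\nu=\lim_{n\to\infty}\mu_{t_n}$ with $t_n\to+\infty$. $Fr[\rho(r)+1,s]$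 is defined in the same way with $V(r)$ replaced by $rV(r)$. A measure is regular with respect to a proximate order if its limit set with respect to that proximate order consists of a single measure (the measure being assumed to satisfy $\sup_{r\ge1}|\mu|([r,er])/V(r)<\infty$ for the corresponding $V$). The function $\Psi$ is understood up to equality almost everywhere. *)

(* Defs.v *)
From HB Require Import structures.
From mathcomp Require Import all_boot all_order all_algebra complex.
From mathcomp Require Import all_classical all_reals all_analysis.
From mathcomp Require Import measurable_realfun.
Set Implicit Arguments.
Unset Strict Implicit.
Unset Printing Implicit Defensive.
Import Order.TTheory GRing.Theory Num.Theory.
Import numFieldNormedType.Exports.

Local Open Scope classical_set_scope.
Local Open Scope ring_scope.
Local Open Scope complex_scope.

Section proximate_orders.
Context {R : realType}.
Implicit Types (rho : R -> R) (r t : R).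

(* The value of a (zero) proximate order at 1 is never constrained: the paper
   allows it to be undefined there. *)
Definition zero_proximate_order rho :=
  [/\ rho r @[r --> +oo] --> (0 : R),
      forall r, 0 < r -> r != 1 -> rho r^-1 = - rho r,
      forall r, 0 < r -> r != 1 ->
        derivable rho r 1 /\ {for r, continuous (derive1 rho)},
      r * ln r * derive1 rho r @[r --> +oo] --> (0 : R) &
      r `^ rho r @[r --> (1 : R)^'] --> (1 : R)].

(* rho is a proximate order with rho(oo) = rho0. *)
Definition proximate_order rho (rho0 : R) :=
  zero_proximate_order (fun r => rho r - rho0).

(* V 1 = 1 whatever rho 1 is; this is the continuous extension of V to 1. *)
Definition prox_V rho r : R := r `^ rho r.

(* For a proximate order the set is nonempty and bounded above for every t > 0,
   so that this is a genuine supremum. *)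
Definition prox_gamma rho (rho0 t : R) : R :=
  sup [set prox_V rho (r * t) / (t `^ rho0 * prox_V rho r) | r in `]0, +oo[].

End proximate_orders.

Section complex_integrals.
Context {R : realType}.
Local Notation T := (measurableTypeR R).
Implicit Types (m : {measure set T -> \bar R}) (D : set T) (f : T -> R[i]).

Definition cmeasurable_fun D f :=
  measurable_fun D (fun x => complex.Re (f x)) /\
  measurable_fun D (fun x => complex.Im (f x)).

Definition cintegrable m D f :=
  m.-integrable D (fun x => (complex.Re (f x))%:E) /\
  m.-integrable D (fun x => (complex.Im (f x))%:E).

Definition cintegral m D f : R[i] :=
  (\int[m]_(x in D) complex.Re (f x)) +i* (\int[m]_(x in D) complex.Im (f x)).

(* t ^ z for t > 0 and complex z *)
Definition cpow (t : R) (z : R[i]) : R[i] :=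
  (t `^ complex.Re z)%:C *
  (cos (complex.Im z * ln t) +i* sin (complex.Im z * ln t)).

End complex_integrals.

(* Measures on (0, +oo) are represented by Borel measures on R that vanish on
   ]-oo, 0]. A complex Radon measure may have no value on unbounded sets, hence
   it is given by the Jordan decompositions of its real and imaginary parts,
   and its value is used on relatively compact sets only. *)
Record cmeasure (R : realType) := CMeasure {
  re_pos : {measure set (measurableTypeR R) -> \bar R};
  re_neg : {measure set (measurableTypeR R) -> \bar R};
  im_pos : {measure set (measurableTypeR R) -> \bar R};
  im_neg : {measure set (measurableTypeR R) -> \bar R} }.

Section radon_measures.
Context {R : realType}.
Local Notation T := (measurableTypeR R).
Implicit Types (m : {measure set T -> \bar R}) (mu nu : cmeasure R).
Implicit Types (E : set T) (f : T -> R[i]).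

(* relatively compact in (0, +oo) *)
Definition rel_compact E := exists a b : R, 0 < a /\ E `<=` `[a, b].

Definition positive_radon m :=
  m `]-oo, 0]%classic = 0%E /\
  (forall a b : R, 0 < a -> (m (`[a, b]%classic) < +oo)%E).

Definition mutually_singular m1 m2 :=
  exists2 P : set T, measurable P & (m1 P = 0)%E /\ (m2 (~` P) = 0)%E.

Definition radon mu :=
  [/\ positive_radon (re_pos mu), positive_radon (re_neg mu),
      positive_radon (im_pos mu) & positive_radon (im_neg mu)] /\
  mutually_singular (re_pos mu) (re_neg mu) /\
  mutually_singular (im_pos mu) (im_neg mu).

Definition cmeasure_val mu E : R[i] :=
  (fine (re_pos mu E) - fine (re_neg mu E)) +i*
  (fine (im_pos mu E) - fine (im_neg mu E)).

Definition eq_cmeasure mu nu :=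
  forall E, measurable E -> rel_compact E ->
    cmeasure_val mu E = cmeasure_val nu E.

Definition cmeasure_variation mu E : \bar R :=
  ereal_sup [set x | exists n (A : nat -> set T),
    [/\ forall i, measurable (A i), forall i, rel_compact (A i),
        forall i, A i `<=` E, trivIset setT A &
        x = (\sum_(i < n) ComplexField.Normc.normc (cmeasure_val mu (A i)))%:E]].

Definition cmeasure_integral mu f : R[i] :=
  cintegral (re_pos mu) `]0, +oo[ f - cintegral (re_neg mu) `]0, +oo[ f +
  'i%C * (cintegral (im_pos mu) `]0, +oo[ f - cintegral (im_neg mu) `]0, +oo[ f).

(* d nu(t) = f(t) dt *)
Definition has_density nu f :=
  radon nu /\
  forall a b : R, 0 < a ->
    cintegrable lebesgue_measure `[a, b] f /\
    forall E, measurable E -> E `<=` `[a, b] ->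
      cmeasure_val nu E = cintegral lebesgue_measure E f.

(* A continuous function with compact support in (0, +oo) is identified with
   its extension by 0, which is continuous on R. *)
Definition test_function (phi : R -> R) :=
  continuous phi /\
  exists a b : R, 0 < a /\ forall x, ~ `[a, b]%classic x -> phi x = 0.

Definition wide_cvg (mu_ : nat -> cmeasure R) nu :=
  forall phi : R -> R, test_function phi ->
    (cmeasure_integral (mu_ n) (fun x => (phi x)%:C) : R[i]^o) @[n --> \oo]
      --> (cmeasure_integral nu (fun x => (phi x)%:C) : R[i]^o).

End radon_measures.

Section dilation.
Context {R : realType}.
Local Notation T := (measurableTypeR R).
Variables (t : R) (m : {measure set T -> \bar R}).

(* For t > 0 this is E |-> m (t E). *)
Definition dilate : set T -> \bar R := pushforward m (fun x : T => (x / t : T)).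

Let mdiv : measurable_fun [set: T] (fun x : T => (x / t : T)).
Proof. exact: mulrr_measurable. Qed.

Let dilate0 : (dilate set0 = 0)%E.
Proof. by rewrite /dilate /pushforward preimage_set0 measure0. Qed.

Let dilate_ge0 A : (0 <= dilate A)%E.
Proof. exact: measure_ge0. Qed.

Let dilate_sigma_additive : semi_sigma_additive dilate.
Proof. exact: (@measure_semi_sigma_additive _ _ _
  (measure_function_pushforward__canonical__measure_function_Measure m mdiv)). Qed.

HB.instance Definition _ := isMeasure.Build _ _ _ dilate
  dilate0 dilate_ge0 dilate_sigma_additive.

End dilation.

Section azarin.
Context {R : realType}.
Implicit Types (rho : R -> R) (mu nu : cmeasure R).

Lemma prox_V_inv_ge0 rho (t : R) : 0 <= (prox_V rho t)^-1.
Proof. by rewrite invr_ge0 powR_ge0. Qed.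

(* mu_t : E |-> mu (t E) / V t *)
Definition azarin_scale rho mu (t : R) : cmeasure R :=
  let sc (m : {measure set (measurableTypeR R) -> \bar R}) :
      {measure set (measurableTypeR R) -> \bar R} :=
    mscale (NngNum (prox_V_inv_ge0 rho t)) (dilate t m) in
  CMeasure (sc (re_pos mu)) (sc (re_neg mu)) (sc (im_pos mu)) (sc (im_neg mu)).

(* nu belongs to Fr[rho(r), mu] *)
Definition Fr rho mu nu :=
  radon nu /\
  exists t_ : nat -> R, t_ n @[n --> \oo] --> +oo /\
    wide_cvg (fun n => azarin_scale rho mu (t_ n)) nu.

Definition Fr_is_singleton rho mu nu :=
  Fr rho mu nu /\ forall nu', Fr rho mu nu' -> eq_cmeasure nu' nu.

Definition Fr_is_density rho mu (f : R -> R[i]) :=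
  exists2 nu, has_density nu f & Fr_is_singleton rho mu nu.

Definition class_M rho mu :=
  radon mu /\
  exists C : R, forall r : R, 0 < r ->
    (cmeasure_variation mu (`[r, (expR 1 * r)%R]%classic) <= (C * prox_V rho r)%:E)%E.

Definition regular_measure rho mu :=
  [/\ radon mu,
      exists C : R, forall r : R, 1 <= r ->
        (cmeasure_variation mu (`[r, (expR 1 * r)%R]%classic) <= (C * prox_V rho r)%:E)%E &
      exists nu, Fr_is_singleton rho mu nu].

(* Psi(r) = \int_0^oo K(t/r) d mu(t), with an irrelevant value on the null set
   of those r for which the integral does not converge absolutely. *)
Definition convolution_Psi (K : R -> R[i]) mu (r : R) : R[i] :=
  cmeasure_integral mu (fun t => K (t / r)).

End azarin.

(* Main.v *)
Require Import Defs.
From HB Require Import structures.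
From mathcomp Require Import all_boot all_order all_algebra complex.
From mathcomp Require Import all_classical all_reals all_analysis.
From mathcomp Require Import measurable_realfun ring lra.
Import Order.TTheory GRing.Theory Num.Theory.
Import numFieldNormedType.Exports.
Local Open Scope classical_set_scope.
Local Open Scope ring_scope.
Local Open Scope complex_scope.
Set Implicit Arguments.
Unset Strict Implicit.
Unset Printing Implicit Defensive.

(** The theorem is a Tauberian theorem of Wiener's type, and the proof reduces
    it to Wiener's theorem for bounded functions on the line.

    Let nu be a limit of the dilations mu_t of mu along some sequence. By
    Fubini's theorem a test integral of the dilated measure s_t is an average
    of test integrals of dilations of mu_t, with weight K
    (pairing_scaled_density). The hypothesis on K, which carries the factor
    gamma, allows dominated convergence (cvg_kernel_pairing), so s_t converges
    to the measure whose density is the convolution of K with nu. This measure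
    lies in the limit set of s, hence it is the unique member sigma of that set
    (subsequence_limit). The existence of limits nu is Helly's selection
    theorem (helly).

    As sigma is the limit along every sequence, it is homogeneous
    (limit_homogeneous): it has the density c r^rho, by the uniqueness of Haar
    measure (homogeneous_pairing). In the variable x = ln r the relation
    between nu and sigma becomes an equation on the line: the correlation of
    the integrable function k (x) = K (e^x) e^(rho x) with a bounded continuous
    function H, made of test integrals of nu, is a constant. Since the Fourier
    transform of k has no zero, Wiener's theorem (wiener_Linfty) says that H
    itself is constant (limit_pairing). So all limits nu coincide with the
    measure of density (c / c1) r^(rho - 1) (azarin_limit_power).

    Wiener's theorem is proved without Banach algebras. Suppose that the
    correlation of k with H is 0. Split H into packets, its components in
    frequency bands, by Fejer kernels. A packet of narrow band around m is
    nearly an exponential, so its correlation with k is nearly khat (m) times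
    the packet; as the correlation is 0 and khat (m) is not, narrow packets
    near m vanish (packet_eq0). By bisection in frequency every packet
    vanishes, and H is a limit of packets. *)

(** * Complex-valued functions and their integrals *)

Section complex_arith.
Context {R : realType}.
Implicit Types x y z : R[i].

(** The l1 norm of the plane: integrability of both parts is integrability
    of this norm, and no square root enters the estimates. *)
Definition nrm1 z : R := `|complex.Re z| + `|complex.Im z|.

Lemma cReM x y : complex.Re (x * y) = complex.Re x * complex.Re y - complex.Im x * complex.Im y.
Proof. by case: x; case: y. Qed.
Lemma cImM x y : complex.Im (x * y) = complex.Re x * complex.Im y + complex.Im x * complex.Re y.
Proof. by case: x; case: y. Qed.
Lemma cReD x y : complex.Re (x + y) = complex.Re x + complex.Re y.
Proof. by case: x; case: y. Qed.
Lemma cImD x y : complex.Im (x + y) = complex.Im x + complex.Im y.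
Proof. by case: x; case: y. Qed.
Lemma cReN x : complex.Re (- x) = - complex.Re x.
Proof. by case: x. Qed.
Lemma cImN x : complex.Im (- x) = - complex.Im x.
Proof. by case: x. Qed.
Definition cplxE := (cReM, cImM, cReD, cImD, cReN, cImN).

Lemma cplxP x y : complex.Re x = complex.Re y -> complex.Im x = complex.Im y -> x = y.
Proof. by case: x => ? ?; case: y => ? ? /= -> ->. Qed.

Lemma nrm1_ge0 z : 0 <= nrm1 z.
Proof. by rewrite addr_ge0. Qed.
Lemma nrm1_eq0 z : nrm1 z = 0 -> z = 0.
Proof.
case: z => a b; rewrite /nrm1/= => h.
have := normr_ge0 a; have := normr_ge0 b => hb ha.
have /eqP : `|a| = 0 by lra.
have /eqP : `|b| = 0 by lra.
by rewrite !normr_eq0 => /eqP -> /eqP ->.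
Qed.
Lemma nrm1D x y : nrm1 (x + y) <= nrm1 x + nrm1 y.
Proof.
rewrite /nrm1 cReD cImD.
have := ler_normD (complex.Re x) (complex.Re y).
have := ler_normD (complex.Im x) (complex.Im y); lra.
Qed.
Lemma nrm1N x : nrm1 (- x) = nrm1 x.
Proof. by rewrite /nrm1 cReN cImN !normrN. Qed.
Lemma nrm1M x y : nrm1 (x * y) <= nrm1 x * nrm1 y.
Proof.
rewrite /nrm1 cReM cImM mulrDl !mulrDr -!normrM.
have := ler_normB (complex.Re x * complex.Re y) (complex.Im x * complex.Im y).
have := ler_normD (complex.Re x * complex.Im y) (complex.Im x * complex.Re y).
lra.
Qed.
Lemma nrm1R (a : R) : nrm1 a%:C = `|a|.
Proof. by rewrite /nrm1 /= normr0 addr0. Qed.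
Lemma nrm1_RM (a : R) x : nrm1 (a%:C * x) = `|a| * nrm1 x.
Proof. by rewrite /nrm1 cReM cImM /= !mul0r subr0 addr0 !normrM mulrDr. Qed.
Lemma nrm1_Re x : `|complex.Re x| <= nrm1 x.
Proof. by rewrite lerDl. Qed.
Lemma nrm1_Im x : `|complex.Im x| <= nrm1 x.
Proof. by rewrite lerDr. Qed.

Definition cexp (t : R) : R[i] := cos t +i* sin t.
Lemma cexpD s t : cexp (s + t) = cexp s * cexp t.
Proof. by apply: cplxP; rewrite ?cReM ?cImM /= ?cosD ?sinD; ring. Qed.
Lemma cexp0 : cexp 0 = 1.
Proof. by rewrite /cexp cos0 sin0. Qed.
Lemma nrm1_cexp t : nrm1 (cexp t) <= 2.
Proof.
rewrite /nrm1 /=.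
have := cos_max t; have := sin_max t; lra.
Qed.
Lemma cexpNK t : cexp (- t) * cexp t = 1.
Proof. by rewrite -cexpD addNr cexp0. Qed.

End complex_arith.

Section complex_measurable.
Context {R : realType}.

(** Measurability on a whole space, for an arbitrary source: products of
    spaces occur in Fubini's theorem. *)
Definition cmeas d (X : measurableType d) (f : X -> R[i]) :=
  measurable_fun setT (fun x => complex.Re (f x)) /\
  measurable_fun setT (fun x => complex.Im (f x)).

Context d (X : measurableType d).
Implicit Types f g : X -> R[i].

Lemma cmeasD f g : cmeas f -> cmeas g -> cmeas (fun x => f x + g x).
Proof.
move=> [a b] [c e]; split.
  by under eq_fun do rewrite cReD; exact: measurable_funD.
by under eq_fun do rewrite cImD; exact: measurable_funD.
Qed.
Lemma cmeasM f g : cmeas f -> cmeas g -> cmeas (fun x => f x * g x).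
Proof.
move=> [a b] [c e]; split.
  by under eq_fun do rewrite cReM; apply: measurable_funB; exact: measurable_funM.
by under eq_fun do rewrite cImM; apply: measurable_funD; exact: measurable_funM.
Qed.
Lemma cmeasR (f : X -> R) : measurable_fun setT f -> cmeas (fun x => (f x)%:C).
Proof. by move=> mf; split => //=; exact: measurable_cst. Qed.
Lemma cmeas_cexp (f : X -> R) : measurable_fun setT f -> cmeas (fun x => cexp (f x)).
Proof.
move=> mf; split => /=.
  have h : measurable_fun [set: measurableTypeR R] (@cos R).
    by apply: continuous_measurable_fun; exact: continuous_cos.
  exact: (measurableT_comp h mf).
have h : measurable_fun [set: measurableTypeR R] (@sin R).
  by apply: continuous_measurable_fun; exact: continuous_sin.
exact: (measurableT_comp h mf).
Qed.
Lemma cmeas_comp d' (Y : measurableType d') (phi : Y -> X) f :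
  measurable_fun setT phi -> cmeas f -> cmeas (fun y => f (phi y)).
Proof.
by move=> mp [a b]; split; [exact: (measurableT_comp a mp)|exact: (measurableT_comp b mp)].
Qed.
Lemma cmeas_nrm1 f : cmeas f -> measurable_fun setT (fun x => nrm1 (f x)).
Proof. by move=> [a b]; apply: measurable_funD; apply: measurableT_comp. Qed.
End complex_measurable.

Section complex_integral.
Context {R : realType}.
Local Notation T := (measurableTypeR R).
Variable m : {measure set T -> \bar R}.
Implicit Types (D : set T) (f g : T -> R[i]).

Lemma cintegrable_dom D f (g : T -> R) : measurable D -> cmeasurable_fun D f ->
  m.-integrable D (EFin \o g) -> (forall x, D x -> nrm1 (f x) <= g x) ->
  cintegrable m D f.
Proof.
move=> mD [mr mi] ig fg; split; apply: (le_integrable mD _ _ ig).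
- exact/measurable_EFinP.
- move=> x Dx /=; rewrite lee_fin (le_trans (nrm1_Re _))//.
  by rewrite (le_trans (fg _ Dx))// ler_norm.
- exact/measurable_EFinP.
- move=> x Dx /=; rewrite lee_fin (le_trans (nrm1_Im _))//.
  by rewrite (le_trans (fg _ Dx))// ler_norm.
Qed.

Lemma cintegrable_measurable D f : cintegrable m D f -> cmeasurable_fun D f.
Proof.
by move=> [a b]; split; apply/measurable_EFinP;
  [exact: measurable_int a|exact: measurable_int b].
Qed.

Lemma integrable_nrm1 D f : measurable D -> cintegrable m D f ->
  m.-integrable D (EFin \o (fun x => nrm1 (f x))).
Proof.
move=> mD [a b]; rewrite (_ : _ \o _ =
  (fun x => (`|complex.Re (f x)|)%:E + (`|complex.Im (f x)|)%:E)%E)//.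
by apply: integrableD => //; exact: integrable_norm.
Qed.

Lemma cintegralD D f g : measurable D -> cintegrable m D f -> cintegrable m D g ->
  cintegral m D (fun x => f x + g x) = cintegral m D f + cintegral m D g.
Proof.
move=> mD [a b] [c d]; apply: cplxP; rewrite ?cReD ?cImD /=.
  by rewrite -RintegralD//; apply: eq_Rintegral => x _; rewrite cReD.
by rewrite -RintegralD//; apply: eq_Rintegral => x _; rewrite cImD.
Qed.

Lemma cintegrableD D f g : measurable D -> cintegrable m D f -> cintegrable m D g ->
  cintegrable m D (fun x => f x + g x).
Proof.
move=> mD [a b] [c d]; split.
  by under eq_fun do rewrite cReD EFinD; exact: integrableD.
by under eq_fun do rewrite cImD EFinD; exact: integrableD.
Qed.

Lemma cintegrableZ D (c : R[i]) f : measurable D -> cintegrable m D f ->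
  cintegrable m D (fun x => c * f x).
Proof.
move=> mD [a b]; split.
  under eq_fun do rewrite cReM EFinB !EFinM.
  by apply: integrableB => //; exact: integrableZl.
under eq_fun do rewrite cImM EFinD !EFinM.
by apply: integrableD => //; exact: integrableZl.
Qed.

Lemma cintegralZ D (c : R[i]) f : measurable D -> cintegrable m D f ->
  cintegral m D (fun x => c * f x) = c * cintegral m D f.
Proof.
have zl (r : R) h : m.-integrable D (fun x => (h x)%:E) -> measurable D ->
   m.-integrable D (EFin \o (fun x => r * h x)).
  move=> ih mD; rewrite (_ : _ \o _ = fun x => (r%:E * (h x)%:E)%E)//.
  exact: integrableZl.
move=> mD [a b]; apply: cplxP; rewrite ?cReM ?cImM /=.
  rewrite -!RintegralZl// -RintegralB//; try exact: zl.
  by apply: eq_Rintegral => x _; rewrite cReM.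
rewrite -!RintegralZl// -RintegralD//; try exact: zl.
by apply: eq_Rintegral => x _; rewrite cImM.
Qed.

Lemma eq_cintegral D f g : (forall x, D x -> f x = g x) ->
  cintegral m D f = cintegral m D g.
Proof.
move=> fg; apply: cplxP; apply: eq_Rintegral => x /set_mem Dx; by rewrite fg.
Qed.

Lemma cintegral0 D : cintegral m D (fun=> 0) = 0.
Proof.
by apply: cplxP => /=; rewrite /Rintegral integral0_eq.
Qed.

Lemma nrm1_cintegral D f (g : T -> R) : measurable D -> cmeasurable_fun D f ->
  m.-integrable D (EFin \o g) -> (forall x, D x -> nrm1 (f x) <= g x) ->
  nrm1 (cintegral m D f) <= \int[m]_(x in D) g x.
Proof.
move=> mD mf ig fg.
have [a b] := cintegrable_dom mD mf ig fg.
rewrite /nrm1 /=.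
have h1 := le_normr_Rintegral mD a; have h2 := le_normr_Rintegral mD b.
apply: le_trans (lerD h1 h2) _; rewrite -RintegralD//; try exact: integrable_norm.
apply: le_Rintegral => //.
exact: (integrable_nrm1 mD (conj a b)).
Qed.

End complex_integral.

Section real_integrable.
Context d (T : measurableType d) (R : realType).
Variable m : {measure set T -> \bar R}.

Lemma integrableZR (D : set T) (c : R) (f : T -> R) : measurable D ->
  m.-integrable D (EFin \o f) -> m.-integrable D (EFin \o (fun x => c * f x)).
Proof.
by move=> mD i; rewrite (_ : _ \o _ = fun x => (c%:E * (f x)%:E)%E)//; exact: integrableZl.
Qed.

Lemma integrableDR (D : set T) (f g : T -> R) : measurable D ->
  m.-integrable D (EFin \o f) -> m.-integrable D (EFin \o g) ->
  m.-integrable D (EFin \o (fun x => f x + g x)).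
Proof.
by move=> mD i j; rewrite (_ : _ \o _ = (EFin \o f) \+ (EFin \o g))%E//; exact: integrableD.
Qed.

Lemma integrableBR (D : set T) (f g : T -> R) : measurable D ->
  m.-integrable D (EFin \o f) -> m.-integrable D (EFin \o g) ->
  m.-integrable D (EFin \o (fun x => f x - g x)).
Proof.
by move=> mD i j; rewrite (_ : _ \o _ = (EFin \o f) \- (EFin \o g))%E//; exact: integrableB.
Qed.

Lemma integrable_domR (D : set T) (f g : T -> R) : measurable D ->
  measurable_fun D f -> m.-integrable D (EFin \o g) ->
  (forall x, D x -> `|f x| <= g x) -> m.-integrable D (EFin \o f).
Proof.
move=> mD mf ig fg; apply: (le_integrable mD _ _ ig); first exact/measurable_EFinP.
by move=> x Dx; rewrite /= lee_fin (le_trans (fg _ Dx))// ler_norm.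
Qed.

Lemma dct_R (f_ : nat -> T -> R) (f g : T -> R) :
  (forall n, measurable_fun setT (f_ n)) -> measurable_fun setT f ->
  {ae m, forall x, f_ ^~ x @ \oo --> f x} ->
  m.-integrable setT (EFin \o g) -> (forall n x, `|f_ n x| <= g x) ->
  (fun n => \int[m]_x f_ n x) @ \oo --> \int[m]_x f x.
Proof.
move=> mf_ mf cvf ig fg.
have [] := @dominated_convergence _ _ _ m setT measurableT (fun n => EFin \o f_ n)
  (EFin \o f) (EFin \o g).
- by move=> n; exact/measurable_EFinP.
- exact/measurable_EFinP.
- apply: filterS cvf => x h _; apply: cvg_EFin; last exact: h.
  exact: nearW.
- exact: ig.
- by apply: nearW => x n _ /=; rewrite lee_fin.
move=> ifn _ h.
have fi : (\int[m]_x (f x)%:E)%E \is a fin_num by exact: (integrable_fin_num measurableT ifn).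
by apply: fine_cvg; rewrite fineK.
Qed.
End real_integrable.

(** * Fubini's theorem and affine substitutions *)

Section fubini_real.
Context d1 d2 (T1 : measurableType d1) (T2 : measurableType d2) (R : realType).
Variable m1 : {sigma_finite_measure set T1 -> \bar R}.
Variable m2 : {sigma_finite_measure set T2 -> \bar R}.

Lemma integral_fine d (T : measurableType d) (m : {measure set T -> \bar R})
    (F : T -> \bar R) : m.-integrable setT F ->
  m.-integrable setT (EFin \o (fine \o F)) /\
  (\int[m]_x (fine (F x))%:E = \int[m]_x F x)%E.
Proof.
move=> iF; have mF := measurable_int _ iF.
have mfF : measurable_fun setT (EFin \o (fine \o F)).
  by apply/measurable_EFinP; apply: measurableT_comp.
have aeF : ae_eq m setT (EFin \o (fine \o F)) F.
  have := integrable_ae measurableT iF.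
  by apply: filterS => x /(_ I) xf _ /=; rewrite fineK.
split; last exact: ae_eq_integral.
apply: (le_integrable _ _ _ iF) => // x _ /=.
by case: (F x) => [r||] //=; rewrite normr0 leey.
Qed.

Lemma fubini_R (f : T1 -> T2 -> R) :
  measurable_fun setT (fun xy => f xy.1 xy.2) ->
  (\int[m1]_x \int[m2]_y `|f x y|%:E < +oo)%E ->
  [/\ m1.-integrable setT (EFin \o (fun x => \int[m2]_y f x y)),
      m2.-integrable setT (EFin \o (fun y => \int[m1]_x f x y)),
      {ae m1, forall x, m2.-integrable setT (EFin \o f x)},
      {ae m2, forall y, m1.-integrable setT (EFin \o f^~ y)} &
      \int[m1]_x \int[m2]_y f x y = \int[m2]_y \int[m1]_x f x y].
Proof.
move=> mf fin; pose g (xy : T1 * T2) := (f xy.1 xy.2)%:E.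
have mg : measurable_fun setT g by apply/measurable_EFinP.
have ig : (m1 \x m2)%E.-integrable setT g.
  exact: ((integrable12ltyP m1 m2 mg).2 fin).
have [i1 e1] := integral_fine (integrable_fubini_F ig).
have [i2 e2] : m2.-integrable setT (EFin \o (fine \o fubini_G m1 g)) /\
  (\int[m2]_x (fine (fubini_G m1 g x))%:E = \int[m2]_x fubini_G m1 g x)%E.
  apply: integral_fine; have := ig.
  move=> ig'; apply/integrableP; split; first exact: (measurable_fubini_G ig).
  apply: le_lt_trans ((integrable21ltyP m1 m2 mg).1 ig).
  apply: ge0_le_integral => //.
  - by apply: measurableT_comp => //; exact: (measurable_fubini_G ig).
  - apply: (@measurable_fun_fubini_tonelli_G _ _ _ _ _ m1 (abse \o g)) => //.
    + exact: measurableT_comp.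
    + by move=> xy; rewrite /comp abse_ge0.
  - move=> y _; apply: le_abse_integral => //.
    exact: measurableT_comp (measurable_pair2 _).
split.
- exact: i1.
- exact: i2.
- exact: ae_integrable1 ig.
- exact: ae_integrable2 ig.
- by have := Fubini ig; rewrite /Rintegral /= => E; congr fine;
    rewrite [LHS]e1 [RHS]e2.
Qed.
End fubini_real.

Section fubini_complex.
Context (R : realType).
Local Notation T := (measurableTypeR R).
Variable m1 m2 : {sigma_finite_measure set T -> \bar R}.

(** In a convolution B x is the translate by x of one function, and C is its
    integral. *)
Lemma fubini_C (F : T -> T -> R[i]) (a : T -> R) (B : T -> T -> R) (C : R) :
  cmeas (fun xy : T * T => F xy.1 xy.2) ->
  m1.-integrable setT (EFin \o a) -> (forall x, m2.-integrable setT (EFin \o B x)) ->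
  (forall x, (\int[m2]_y `|(B x y)%:E| <= C%:E)%E) ->
  (forall x y, nrm1 (F x y) <= a x * B x y) ->
  [/\ cintegrable m1 setT (fun x => cintegral m2 setT (F x)),
      cintegrable m2 setT (fun y => cintegral m1 setT (F^~ y)) &
      cintegral m1 setT (fun x => cintegral m2 setT (F x)) =
      cintegral m2 setT (fun y => cintegral m1 setT (F^~ y))].
Proof.
move=> [mr mi] ia iB BC ab.
have fin (f : T -> T -> R) : measurable_fun setT (fun xy => f xy.1 xy.2) ->
    (forall x y, `|f x y| <= a x * B x y) ->
   (\int[m1]_x \int[m2]_y `|f x y|%:E < +oo)%E.
  move=> mf fab.
  have mA : measurable_fun setT (fun xy : T * T => `|f xy.1 xy.2|%:E).
    by apply/measurable_EFinP; apply: measurableT_comp.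
  have ma := measurable_int _ ia; have mB x := measurable_int _ (iB x).
  have /integrableP[_ ia'] := ia.
  have C0 : (0 <= C%:E)%E by apply: le_trans (BC 0); apply: integral_ge0.
  apply: (@le_lt_trans _ _ (\int[m1]_x (`|(a x)%:E| * C%:E)))%E.
    apply: ge0_le_integral => //.
    - by move=> x _; apply: integral_ge0.
    - exact: (@measurable_fun_fubini_tonelli_F _ _ _ _ _ m2 (fun xy : T * T => `|f xy.1 xy.2|%:E)).
    - by apply: emeasurable_funM => //; apply: measurableT_comp.
    - move=> x _; apply: (@le_trans _ _ (`|(a x)%:E| * \int[m2]_y `|(B x y)%:E|)%E).
        rewrite -ge0_integralZl//; last exact: (measurableT_comp _ (mB x)).
        apply: ge0_le_integral => //.
        + exact: (measurableT_comp mA (measurable_pair1 x)).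
        + by apply: emeasurable_funM => //; exact: (measurableT_comp _ (mB x)).
        + move=> y _; rewrite /= lee_fin (le_trans (fab _ _))// -normrM ler_norm//.
      by apply: lee_wpmul2l => //.
  rewrite ge0_integralZr//; last exact: measurableT_comp.
  by apply: lte_mul_pinfty => //; [apply: integral_ge0|rewrite ge0_fin_numE//; apply: integral_ge0|rewrite ltry].
have h1 := fubini_R mr (fin _ mr (fun x y => le_trans (nrm1_Re _) (ab x y))).
have h2 := fubini_R mi (fin _ mi (fun x y => le_trans (nrm1_Im _) (ab x y))).
case: h1 => a1 a2 _ _ a3; case: h2 => b1 b2 _ _ b3.
by split => //; apply: cplxP.
Qed.

Lemma fubini_C_prod (F : T -> T -> R[i]) (a b : T -> R) :
  cmeas (fun xy : T * T => F xy.1 xy.2) ->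
  m1.-integrable setT (EFin \o a) -> m2.-integrable setT (EFin \o b) ->
  (forall x y, nrm1 (F x y) <= a x * b y) ->
  [/\ cintegrable m1 setT (fun x => cintegral m2 setT (F x)),
      cintegrable m2 setT (fun y => cintegral m1 setT (F^~ y)) &
      cintegral m1 setT (fun x => cintegral m2 setT (F x)) =
      cintegral m2 setT (fun y => cintegral m1 setT (F^~ y))].
Proof.
move=> mF ia ib ab.
apply: (@fubini_C F a (fun=> b) (fine (\int[m2]_y `|(b y)%:E|))) => // _.
have /integrableP[_ ib'] := ib.
by rewrite fineK// ge0_fin_numE//; apply: integral_ge0.
Qed.
End fubini_complex.

Section lebesgue_invariance.
Context {R : realType}.
Local Notation T := (measurableTypeR R).
Local Notation leb := (@lebesgue_measure R).

Lemma lebesgue_affine (a b : R) (A : set T) : 0 < a -> measurable A ->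
  (pushforward leb (fun x : T => (a * x + b : T)%R) A = (a^-1)%:E * leb A)%E.
Proof.
move=> a0 mA.
have mphi : measurable_fun setT (fun x : T => (a * x + b : T)).
  by apply: measurable_funD => //; exact: mulrl_measurable.
pose m1 : {measure set T -> \bar R} :=
  measure_function_pushforward__canonical__measure_function_Measure leb mphi.
have a0' : 0 <= a by exact: ltW.
pose m2 : {measure set T -> \bar R} := mscale (NngNum a0') m1.
have : leb A = m2 A.
  apply: lebesgue_measure_unique => //= _ [[u v]] _ <-.
  rewrite /mscale /= /pushforward.
  have -> : (fun x : T => a * x + b) @^-1` `]u, v]%classic = `](u - b) / a, (v - b) / a]%classic.
    apply/seteqP; split => x /=; rewrite !in_itv /= ltr_pdivrMr// ler_pdivlMr// => /andP[h1 h2]; apply/andP; split; lra.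
  rewrite !lebesgue_measure_itv /= !lte_fin.
  rewrite ltr_pM2r ?invr_gt0// ltrD2r; case: ifPn => _; last by rewrite mule0.
  rewrite -!EFinB -EFinM; congr EFin; field; lra.
move=> ->; rewrite /m2 /mscale /= muleA -EFinM mulVf ?gt_eqF// mul1e//.
Qed.

Lemma ge0_integral_affine (a b : R) (f : T -> \bar R) : 0 < a ->
  measurable_fun setT f -> (forall x, 0 <= f x)%E ->
  (\int[leb]_x f (a * x + b)%R = (a^-1)%:E * \int[leb]_x f x)%E.
Proof.
move=> a0 mf f0.
have mphi : measurable_fun setT (fun x : T => (a * x + b : T)).
  by apply: measurable_funD => //; exact: mulrl_measurable.
have ia0 : 0 <= a^-1 by rewrite invr_ge0 ltW.
rewrite -(@ge0_integral_mscale _ _ _ leb _ measurableT (NngNum ia0) f)//.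
rewrite -[LHS](@ge0_integral_pushforward _ _ _ _ _ _ mphi leb setT f)//.
apply: eq_measure_integral => A mA _; exact: lebesgue_affine.
Qed.

Lemma ge0_integral_reflect (f : T -> \bar R) :
  measurable_fun setT f -> (forall x, 0 <= f x)%E ->
  (\int[leb]_x f (- x)%R = \int[leb]_x f x)%E.
Proof.
move=> mf f0.
have mphi : measurable_fun setT (fun x : T => (- x : T)) by exact: oppr_measurable.
rewrite -[LHS](@ge0_integral_pushforward _ _ _ _ _ _ mphi leb setT f)//.
apply: eq_measure_integral => A mA _; exact: lebesgue_measureN.
Qed.

Lemma integrable_comp_ge0 (phi : T -> T) (c : R) (f : T -> R) :
  measurable_fun setT phi ->
  (forall g : T -> \bar R, measurable_fun setT g -> (forall x, 0 <= g x)%E ->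
     (\int[leb]_x g (phi x) = c%:E * \int[leb]_x g x)%E) ->
  leb.-integrable setT (EFin \o f) ->
  leb.-integrable setT (EFin \o (f \o phi)) /\
  \int[leb]_x f (phi x) = c * \int[leb]_x f x.
Proof.
move=> mphi H iF.
have mf := measurable_int _ iF.
split.
  apply/integrableP; split; first exact: (measurableT_comp mf mphi).
  rewrite (H (fun y => `|(f y)%:E|)%E) //; last exact: measurableT_comp.
  case/integrableP : iF => _ fin.
  have {}fin : (\int[leb]_x `|(f x)%:E|)%E \is a fin_num.
    by rewrite ge0_fin_numE// integral_ge0.
  by rewrite ltey_eq fin_numM.
have mfp : measurable_fun setT (fun x => (EFin \o f)^\+ x)%E by exact: measurable_funepos.
have mfn : measurable_fun setT (fun x => (EFin \o f)^\- x)%E by exact: measurable_funeneg.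
have fp : (\int[leb]_x (EFin \o f)^\+ x)%E \is a fin_num.
  by apply: integrable_pos_fin_num.
have fn : (\int[leb]_x (EFin \o f)^\- x)%E \is a fin_num.
  by apply: integrable_neg_fin_num.
have Hp := H _ mfp (fun x => funepos_ge0 _ _).
have Hn := H _ mfn (fun x => funeneg_ge0 _ _).
have -> : c = fine c%:E by [].
have fI : (\int[leb]_x (f x)%:E)%E \is a fin_num by apply: (integrable_fin_num measurableT iF).
rewrite /Rintegral -fineM//.
congr fine; rewrite [in LHS]integralE [in RHS]integralE.
rewrite muleBr//; last by rewrite fin_num_adde_defr.
rewrite -Hp -Hn.
congr (_ - _)%E; apply: eq_integral => x _.
  by rewrite !funeposE.
by rewrite !funenegE.
Qed.

Lemma integral_affine (a b : R) (f : T -> R) : 0 < a ->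
  leb.-integrable setT (EFin \o f) ->
  leb.-integrable setT (EFin \o (fun x => f (a * x + b))) /\
  \int[leb]_x f (a * x + b) = a^-1 * \int[leb]_x f x.
Proof.
move=> a0; apply: (@integrable_comp_ge0 (fun x => a * x + b)).
  by apply: measurable_funD => //; exact: mulrl_measurable.
by move=> g mg g0; exact: ge0_integral_affine.
Qed.

Lemma integral_reflect (f : T -> R) :
  leb.-integrable setT (EFin \o f) ->
  leb.-integrable setT (EFin \o (fun x => f (- x))) /\
  \int[leb]_x f (- x) = \int[leb]_x f x.
Proof.
rewrite -[X in _ = X]mul1r; apply: (@integrable_comp_ge0 (fun x => - x)).
  exact: oppr_measurable.
by move=> g mg g0; rewrite mul1e; exact: ge0_integral_reflect.
Qed.

Lemma integral_shift (b : R) (f : T -> R) :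
  leb.-integrable setT (EFin \o f) ->
  leb.-integrable setT (EFin \o (fun x => f (x + b))) /\
  \int[leb]_x f (x + b) = \int[leb]_x f x.
Proof.
move=> /(integral_affine b (@ltr01 R)).
rewrite invr1 mul1r.
have -> // : (fun x => f (1 * x + b)) = (fun x => f (x + b)).
by apply/funext => x; rewrite mul1r.
Qed.

Lemma cintegral_shift (b : R) (f : T -> R[i]) :
  cintegrable leb setT f ->
  cintegrable leb setT (fun x => f (x + b)) /\
  cintegral leb setT (fun x => f (x + b)) = cintegral leb setT f.
Proof.
move=> [/(integral_shift b)[i1 e1] /(integral_shift b)[i2 e2]].
by split => //; apply: cplxP.
Qed.

Lemma cintegral_affine (a b : R) (f : T -> R[i]) : 0 < a ->
  cintegrable leb setT f ->
  cintegrable leb setT (fun x => f (a * x + b)) /\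
  cintegral leb setT (fun x => f (a * x + b)) = (a^-1)%:C * cintegral leb setT f.
Proof.
move=> a0 [/(integral_affine b a0)[i1 e1] /(integral_affine b a0)[i2 e2]].
by split => //; apply: cplxP; rewrite ?cReM ?cImM /= ?mul0r ?subr0 ?addr0.
Qed.

Lemma fubini_C_shift (F : T -> T -> R[i]) (a b : T -> R) :
  cmeas (fun xy : T * T => F xy.1 xy.2) ->
  leb.-integrable setT (EFin \o a) -> leb.-integrable setT (EFin \o b) ->
  (forall x y, nrm1 (F x y) <= a x * b (y - x)) ->
  [/\ cintegrable leb setT (fun x => cintegral leb setT (F x)),
      cintegrable leb setT (fun y => cintegral leb setT (F^~ y)) &
      cintegral leb setT (fun x => cintegral leb setT (F x)) =
      cintegral leb setT (fun y => cintegral leb setT (F^~ y))].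
Proof.
move=> mF ia ib ab.
apply: (@fubini_C R leb leb F a (fun x y => b (y - x)) (fine (\int[leb]_y `|(b y)%:E|))) => //.
  by move=> x; have [] := integral_shift (- x) ib.
move=> x; have ib2 := integrable_norm ib.
have [i e] := integral_shift (- x) ib2.
have f1 := integrable_fin_num measurableT i.
by rewrite -(fineK f1) lee_fin; move: e; rewrite /Rintegral => ->.
Qed.
End lebesgue_invariance.

(** * The Fejer kernel *)

Section fejer.
Context {R : realType}.
Local Notation T := (measurableTypeR R).
Local Notation leb := (@lebesgue_measure R).

(** The value at 0 is the continuous extension. Up to a constant factor this
    is Fejer's kernel, whose Fourier transform is a triangle on [-1, 1]. *)
Definition fejer (x : R) : R := if x == 0 then 2^-1 else (1 - cos x) / x ^+ 2.

Lemma measurable_fejer : measurable_fun setT (fejer : T -> T).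
Proof.
have -> : fejer = (fun x => (1 - cos x) * ((x ^+ 2) `^ (-1)) + 2^-1 * \1_[set (0:R)] x).
  apply/funext => x; rewrite /fejer powR_inv1 ?sqr_ge0// indicE.
  have [->|x0] := eqVneq x 0.
    by rewrite mem_set//= cos0 subrr mul0r add0r mulr1.
  by rewrite memNset/= ?mulr0 ?addr0//; exact/eqP.
apply: measurable_funD.
  apply: measurable_funM.
    apply: measurable_funB => //; apply: continuous_measurable_fun; exact: continuous_cos.
  have h1 : measurable_fun setT (fun x : T => x ^+ 2 : T) by exact: exprn_measurable.
  have h2 : measurable_fun setT (fun x : T => x `^ (-1) : T) by exact: measurable_powR.
  exact: (measurableT_comp h2 h1).
by apply: measurable_funM => //.
Qed.

Lemma fejerN x : fejer (- x) = fejer x.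
Proof. by rewrite /fejer oppr_eq0 cosN sqrrN. Qed.

Lemma fejer_ge0 x : 0 <= fejer x.
Proof.
rewrite /fejer; case: ifPn => // _; rewrite divr_ge0 ?sqr_ge0// subr_ge0.
Qed.

Lemma sqr_fejer x : x ^+ 2 * fejer x = 1 - cos x.
Proof.
rewrite /fejer; case: eqVneq => [->|x0]; first by rewrite cos0 expr0n mul0r subrr.
by rewrite mulrCA divff ?mulr1// sqrf_eq0.
Qed.

(** Doubling the argument amounts to multiplication by a trigonometric
    polynomial: this is what splits a frequency band into narrower ones. *)
Lemma fejer2 x : fejer (2 * x) = fejer x * ((1 + cos x) / 2).
Proof.
have [->|x0] := eqVneq x 0; first by rewrite mulr0 cos0 divff// mulr1.
have h : (2 * x) ^+ 2 * fejer (2 * x) = (2 * x) ^+ 2 * (fejer x * ((1 + cos x) / 2)).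
  rewrite sqr_fejer exprMn -[RHS]mulrA [x ^+ 2 * _]mulrA sqr_fejer.
  have -> : cos (2 * x) = 2 * cos x ^+ 2 - 1.
    by rewrite mulr_natl cos_mulr2n mulr_natl.
  by field.
by apply: mulfI h; rewrite sqrf_eq0 mulf_neq0.
Qed.

(** A modulated kernel is a combination of three dilated kernels, so that
    its integral follows from that of the kernel by scaling. *)
Lemma fejer_cos x a : fejer x * cos (a * x) =
  2^-1 * ((a + 1) ^+ 2 * fejer ((a + 1) * x)) +
  2^-1 * ((a - 1) ^+ 2 * fejer ((a - 1) * x)) - a ^+ 2 * fejer (a * x).
Proof.
have [->|x0] := eqVneq x 0.
  by rewrite !mulr0 cos0 mulr1 /fejer eqxx; field.
have x20 : x ^+ 2 != 0 by rewrite sqrf_eq0.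
apply: (mulfI x20).
have e b : x ^+ 2 * (b ^+ 2 * fejer (b * x)) = 1 - cos (b * x).
  by rewrite -sqr_fejer exprMn; ring.
rewrite mulrA sqr_fejer mulrBr mulrDr 2!(mulrCA _ 2^-1) !e.
rewrite !mulrDl mulN1r mul1r cosB cosD; by field.
Qed.

Lemma FTC_all (f F : R -> R) (a b : R) : a < b -> continuous f ->
  (forall x, is_derive x (1:R) F (f x)) ->
  \int[leb]_(x in `[a, b]) f x = F b - F a.
Proof.
move=> ab cf dF; rewrite /Rintegral (@continuous_FTC2 _ f F)//.
- exact: continuous_subspaceT.
- have cF x : F z @[z --> x] --> F x.
    apply: differentiable_continuous; apply/derivable1_diffP.
    by have [] := dF x.
  split.
  + by move=> x _; have [] := dF x.
  + exact: cvg_at_right_filter.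
  + exact: cvg_at_left_filter.
- by move=> x _; rewrite derive1E; have [_ ->] := dF x.
Qed.

(** The kernel is a superposition of cosines with frequencies at most 1. *)
Lemma fejerE x : fejer x = \int[leb]_(s in `[0, 1]) ((1 - s) * cos (s * x)).
Proof.
have cc (g : R -> R) : (forall s, derivable g s 1) -> continuous g.
  by move=> dg s; apply: differentiable_continuous; apply/derivable1_diffP.
rewrite /fejer; case: eqVneq => [->|x0].
  have -> : (fun s => (1 - s) * cos (s * 0)) = (fun s : R => 1 - s).
    by apply/funext => s; rewrite mulr0 cos0 mulr1.
  have cf : continuous (fun s : R => 1 - s).
    by move=> s; apply: cvgB; [exact: cvg_cst|exact: cvg_id].
  have dF (s : R) : is_derive s 1 (fun s : R => s - s * s / 2) (1 - s).
    by apply: is_derive_eq; rewrite /GRing.scale/=; field.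
  by rewrite (FTC_all (@ltr01 R) cf dF); field.
have cf : continuous (fun s : R => (1 - s) * cos (s * x)).
  move=> s; apply: cvgM; first by apply: cvgB; [exact: cvg_cst|exact: cvg_id].
  apply: continuous_comp; last exact: continuous_cos.
  by apply: cvgM; [exact: cvg_id|exact: cvg_cst].
have dF (s : R) : is_derive s 1
    (fun s => (1 - s) * (sin (s * x) / x) - cos (s * x) / x ^+ 2)
    ((1 - s) * cos (s * x)).
  apply: is_derive_eq; rewrite /GRing.scale/=; by field.
rewrite (FTC_all (@ltr01 R) cf dF).
by rewrite !mul1r !mul0r subrr mul0r sin0 cos0; field.
Qed.

Lemma integrable_oneDsqrV : leb.-integrable setT (EFin \o (fun x : T => (oneDsqr x)^-1)).
Proof.
have cq : continuous (fun x : R => (oneDsqr x)^-1) by exact: continuous_oneDsqrV.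
apply/integrableP; split.
  by apply/measurable_EFinP; exact: continuous_measurable_fun cq.
under eq_integral do rewrite gee0_abs ?lee_fin ?invr_ge0//.
rewrite ge0_symfun_integralT//.
- rewrite -set_itvcy integral0y_oneDsqr -EFinM ltry//.
- by move=> x; rewrite /= /oneDsqr sqrrN.
Qed.

Lemma fejer_le_half x : fejer x <= 2^-1.
Proof.
have -> : (2^-1 : R) = fejer 0 by rewrite /fejer eqxx.
rewrite !fejerE; have ii y : leb.-integrable `[0, 1] (EFin \o (fun s : R => (1 - s) * cos (s * y))).
  apply: continuous_compact_integrable; first exact: segment_compact.
  apply: continuous_subspaceT => s.
  apply: cvgM; first by apply: cvgB; [exact: cvg_cst|exact: cvg_id].
  apply: continuous_comp; last exact: continuous_cos.
  by apply: cvgM; [exact: cvg_id|exact: cvg_cst].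
apply: le_Rintegral => // s; rewrite /= in_itv/= => /andP[s0 s1].
by rewrite mulr0 cos0 ler_wpM2l ?cos_le1// subr_ge0.
Qed.

Lemma fejer_bound x : fejer x <= 4 * (oneDsqr x)^-1.
Proof.
have q0 : 0 < oneDsqr x by exact: lt_le_trans (oneDsqr_ge1 x).
rewrite ler_pdivlMr//.
have := sqr_fejer x; have := cos_geN1 x; have := fejer_le_half x.
rewrite /oneDsqr; move: (cos x) (fejer x) => c f; nra.
Qed.

Lemma integrable_fejer : leb.-integrable setT (EFin \o (fejer : T -> R)).
Proof.
have i4 : leb.-integrable setT (EFin \o (fun x : T => 4 * (oneDsqr x)^-1)).
  by apply: integrableZR => //; exact: integrable_oneDsqrV.
apply: (le_integrable _ _ _ i4) => //.
  by apply/measurable_EFinP; exact: measurable_fejer.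
move=> x _; rewrite /= lee_fin ger0_norm ?fejer_ge0//.
by rewrite (le_trans (fejer_bound x))// ler_norm.
Qed.

Definition fejer_mass : R := \int[leb]_x fejer x.

Lemma fejer_mass_gt0 : 0 < fejer_mass.
Proof.
have p0 := @pi_gt0 R.
pose A : set T := `[pi / 2, pi : R]%classic.
have mA : measurable A by exact: measurable_itv.
have lA : leb A = (pi / 2)%:E.
  rewrite /A lebesgue_measure_itv /= lte_fin ifT; last by rewrite ltr_pdivrMr//; lra.
  by rewrite -EFinB; congr EFin; field.
have e0 : 0 < (pi ^+ 2)^-1 * (pi / 2) :> R by rewrite mulr_gt0 ?invr_gt0 ?exprn_gt0 ?divr_gt0.
apply: (lt_le_trans e0).
have -> : (pi ^+ 2)^-1 * (pi / 2) = \int[leb]_(x in A) (pi ^+ 2)^-1.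
  by rewrite Rintegral_cst//; congr (_ * _); exact: (esym (congr1 fine lA)).
have iA : leb.-integrable A (EFin \o (fejer : T -> R)).
  by apply: integrableS integrable_fejer.
apply: (@le_trans _ _ (\int[leb]_(x in A) fejer x)).
  apply: le_Rintegral => //.
    apply: continuous_compact_integrable; first exact: segment_compact.
    by apply: continuous_subspaceT => ?; exact: cvg_cst.
  move=> x; rewrite /A/= in_itv/= => /andP[x1 x2].
  have x0 : 0 < x by apply: lt_le_trans x1; rewrite divr_gt0.
  have c0 : cos x <= 0.
    rewrite -(subrK (pi / 2) x) cosDpihalf oppr_le0 sin_ge0_pi//; apply/andP; split; lra.
  rewrite /fejer gt_eqF//.
  rewrite -[leLHS]mul1r ler_pM//; first by rewrite invr_ge0 sqr_ge0.
    by rewrite lerBrDl; lra.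
  by rewrite lef_pV2 ?posrE ?exprn_gt0//; nra.
rewrite /fejer_mass /Rintegral; apply: fine_le.
- exact: (integrable_fin_num mA iA).
- exact: (integrable_fin_num measurableT integrable_fejer).
apply: ge0_subset_integral => //.
  by apply/measurable_EFinP; exact: measurable_fejer.
by move=> x _; rewrite lee_fin fejer_ge0.
Qed.

Lemma integral_sqr_fejer b :
  leb.-integrable setT (EFin \o (fun x : T => b ^+ 2 * fejer (b * x))) /\
  \int[leb]_x (b ^+ 2 * fejer (b * x)) = `|b| * fejer_mass.
Proof.
wlog b0 : b / 0 <= b.
  move=> H; have [/H//|b0] := leP 0 b.
  have [|i e] := H (- b); first by rewrite oppr_ge0 ltW.
  have E : (fun x => (- b) ^+ 2 * fejer (- b * x)) = (fun x => b ^+ 2 * fejer (b * x)).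
    by apply/funext => x; rewrite sqrrN mulNr fejerN.
  by move: i e; rewrite E normrN.
have [->|bn0] := eqVneq b 0.
  have -> : (fun x : T => 0 ^+ 2 * fejer (0 * x)) = cst 0.
    by apply/funext => x; rewrite expr0n mul0r.
  split; first exact: integrable0.
  by rewrite normr0 mul0r /Rintegral integral0_eq.
have bp : 0 < b by rewrite lt_neqAle eq_sym bn0.
have [i e] := integral_affine 0 bp integrable_fejer.
have E : (fun x => fejer (b * x + 0)) = (fun x => fejer (b * x)).
  by apply/funext => x; rewrite addr0.
rewrite E in i e; split.
  exact: integrableZR.
by rewrite RintegralZl// e ger0_norm// mulrA expr2 mulfK.
Qed.

Lemma integrable_fejerM (g : T -> R) : measurable_fun setT g ->
  (forall x, `|g x| <= 1) ->
  leb.-integrable setT (EFin \o (fun x : T => fejer x * g x)).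
Proof.
move=> mg g1; apply: (le_integrable _ _ _ integrable_fejer) => //.
  by apply/measurable_EFinP; apply: measurable_funM => //; exact: measurable_fejer.
by move=> x _; rewrite /= lee_fin normrM ler_piMr.
Qed.

Lemma fourier_fejer a : `|a| <= 1 ->
  \int[leb]_x (fejer x * cos (a * x)) = (1 - `|a|) * fejer_mass.
Proof.
move=> a1; under eq_Rintegral do rewrite fejer_cos.
have [i1 e1] := integral_sqr_fejer (a + 1).
have [i2 e2] := integral_sqr_fejer (a - 1).
have [i3 e3] := integral_sqr_fejer a.
have Z f : leb.-integrable setT (EFin \o f) -> leb.-integrable setT (EFin \o (fun x : T => 2^-1 * f x)).
  exact: integrableZR.
rewrite RintegralB//; last first.
  by apply: integrableDR => //; exact: Z.
rewrite RintegralD//; try exact: Z.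
rewrite (RintegralZl 2^-1 measurableT i1) (RintegralZl 2^-1 measurableT i2).
rewrite e1 e2 e3.
rewrite ger0_norm; last by move: a1; rewrite ler_norml => /andP[]; lra.
rewrite ler0_norm; last by move: a1; rewrite ler_norml => /andP[]; lra.
by field.
Qed.

Lemma fourier_fejer_sin a : \int[leb]_x (fejer x * sin (a * x)) = 0.
Proof.
have ms : measurable_fun setT (fun x : T => sin (a * x) : T).
  have h1 : measurable_fun setT (fun x : T => a * x : T) by exact: mulrl_measurable.
  have h2 : measurable_fun setT (fun x : T => sin x : T).
    by apply: continuous_measurable_fun; exact: continuous_sin.
  exact: (measurableT_comp h2 h1).
have i := integrable_fejerM ms (fun x => sin_max _).
have [_] := integral_reflect i.
have -> : (fun x : R => fejer (- x) * sin (a * - x)) = (fun x => -1 * (fejer x * sin (a * x))).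
  by apply/funext => x; rewrite fejerN mulrN sinN mulN1r mulrN.
by rewrite RintegralZl// ; lra.
Qed.

End fejer.

(** * The de la Vallee-Poussin kernel and modulated Fejer kernels *)

Section vallee_poussin.
Context {R : realType}.
Local Notation T := (measurableTypeR R).
Local Notation leb := (@lebesgue_measure R).

(** The difference of two triangles is a trapezium: the Fourier transform of
    this kernel equals 1 on [-1, 1]. *)
Definition vallee_poussin (x : R) : R := (4 * fejer (2 * x) - fejer x) / fejer_mass.
Local Notation vp := vallee_poussin.

Lemma measurable_comp_scale (f : T -> T) (a b : R) : measurable_fun setT f ->
  measurable_fun setT (fun x : T => f (a * x + b) : T).
Proof.
move=> mf; have h1 : measurable_fun setT (fun x : T => a * x + b : T).
  by apply: measurable_funD => //; exact: mulrl_measurable.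
exact: (measurableT_comp mf h1).
Qed.

Lemma measurable_vp : measurable_fun setT (vp : T -> T).
Proof.
apply: measurable_funM => //; apply: measurable_funB; last exact: measurable_fejer.
apply: measurable_funM => //.
have := @measurable_comp_scale _ 2 0 measurable_fejer.
by under eq_fun do rewrite addr0.
Qed.

Lemma vp_bound : exists C : R, 0 <= C /\ forall x, `|vp x| <= C * (oneDsqr x)^-1.
Proof.
have c0 := @fejer_mass_gt0 R.
exists (20 / fejer_mass); split; first by rewrite divr_ge0// ltW.
move=> x; rewrite /vp normrM [`|_^-1|]gtr0_norm ?invr_gt0// [leRHS]mulrAC ler_wpM2r ?invr_ge0 ?(ltW c0)//.
have q0 : 0 < oneDsqr x by exact: lt_le_trans (oneDsqr_ge1 x).
have h1 := fejer_bound x; have h2 := fejer_bound (2 * x).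
have h3 := fejer_ge0 x; have h4 := fejer_ge0 (2 * x).
have h5 : (oneDsqr (2 * x))^-1 <= (oneDsqr x)^-1.
  rewrite lef_pV2 ?posrE// ?(lt_le_trans _ (oneDsqr_ge1 _))//.
  by rewrite /oneDsqr; nra.
by rewrite ler_norml; apply/andP; split; lra.
Qed.

Lemma integrable_vp : leb.-integrable setT (EFin \o (vp : T -> R)).
Proof.
have [C [C0 vC]] := vp_bound.
apply: (@integrable_domR _ T _ _ _ _ (fun x : T => C * (oneDsqr x)^-1)) => //.
  exact: measurable_vp.
by apply: integrableZR => //; exact: integrable_oneDsqrV.
Qed.

Lemma cintegrable_vp_cexp (a : R) :
  cintegrable leb setT (fun z : T => (vp z)%:C * cexp (a * z)).
Proof.
have i2 : leb.-integrable setT (EFin \o (fun x : T => 2 * `|vp x|)).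
  by apply: integrableZR => //; apply: integrable_norm; exact: integrable_vp.
apply: (cintegrable_dom measurableT _ i2).
  apply: cmeasM; first by apply: cmeasR; exact: measurable_vp.
  by apply: cmeas_cexp; exact: mulrl_measurable.
by move=> x _; rewrite nrm1_RM mulrC ler_wpM2r// nrm1_cexp.
Qed.

Lemma fourier_vp a : `|a| <= 1 ->
  cintegral leb setT (fun z : T => (vp z)%:C * cexp (a * z)) = 1.
Proof.
move=> a1; have c0 : fejer_mass != 0 :> R by rewrite gt_eqF// fejer_mass_gt0.
have mcos (b : R) : measurable_fun setT (fun x : T => cos (b * x) : T).
  have := @measurable_comp_scale _ b 0 (continuous_measurable_fun (@continuous_cos R)).
  by under eq_fun do rewrite addr0.
have msin (b : R) : measurable_fun setT (fun x : T => sin (b * x) : T).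
  have := @measurable_comp_scale _ b 0 (continuous_measurable_fun (@continuous_sin R)).
  by under eq_fun do rewrite addr0.
have ic b := integrable_fejerM (mcos b) (fun x => cos_max _).
have is_ b := integrable_fejerM (msin b) (fun x => sin_max _).
have key (g : R -> R -> R) (v : R -> R) :
    (forall b, leb.-integrable setT (EFin \o (fun x : T => fejer x * g b x))) ->
    (forall b x, g b x = g (b / 2) (2 * x)) ->
    (forall b, `|b| <= 1 -> \int[leb]_x (fejer x * g b x) = v b) ->
    \int[leb]_x (vp x * g a x) = (2 * v (a / 2) - v a) / fejer_mass.
  move=> ig gh gv.
  have [i e] := integral_affine 0 (ltr0Sn R 1) (ig (a / 2)).
  have E : (fun x => fejer (2 * x + 0) * g (a / 2) (2 * x + 0)) = (fun x => fejer (2 * x) * g a x).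
    by apply/funext => x; rewrite addr0 -gh.
  rewrite E gv in i e; last by rewrite normrM [`|2^-1|]gtr0_norm ?invr_gt0// ler_pdivrMr//; lra.
  have -> : (fun x => vp x * g a x) =
      (fun x => fejer_mass^-1 * (4 * (fejer (2 * x) * g a x) - fejer x * g a x)).
    by apply/funext => x; rewrite /vp; field.
  rewrite RintegralZl//; last by apply: integrableBR => //; exact: integrableZR.
  rewrite RintegralB//; last exact: integrableZR.
  by rewrite RintegralZl// e gv//; field.
apply: cplxP => /=.
  transitivity (\int[leb]_x (vp x * cos (a * x))).
    by apply: eq_Rintegral => x _; rewrite mul0r subr0.
  rewrite (key (fun b x => cos (b * x)) (fun b => (1 - `|b|) * fejer_mass))//.
  - rewrite normrM [`|2^-1|]gtr0_norm ?invr_gt0//; field; exact: c0.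
  - by move=> b x; congr cos; field.
  - by move=> b b1; exact: fourier_fejer.
transitivity (\int[leb]_x (vp x * sin (a * x))).
  by apply: eq_Rintegral => x _; rewrite mul0r addr0.
rewrite (key (fun b x => sin (b * x)) (fun=> 0))//.
- by rewrite mulr0 subrr mul0r.
- by move=> b x; congr sin; field.
- by move=> b b1; exact: fourier_fejer_sin.
Qed.

Lemma fourier_vp_scale (d a : R) : 0 < d -> `|a| <= d ->
  cintegrable leb setT (fun z : T => (d * vp (d * z))%:C * cexp (a * z)) /\
  cintegral leb setT (fun z : T => (d * vp (d * z))%:C * cexp (a * z)) = 1.
Proof.
move=> d0 ad.
have [i e] := cintegral_affine 0 d0 (cintegrable_vp_cexp (a / d)).
have E : (fun z => (d * vp (d * z))%:C * cexp (a * z)) =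
   (fun x => d%:C * ((vp (d * x + 0))%:C * cexp (a / d * (d * x + 0)))).
  apply/funext => x; rewrite addr0 rmorphM/= mulrA; congr (_ * cexp _).
  by field; rewrite gt_eqF.
rewrite E; split; first exact: cintegrableZ.
rewrite cintegralZ// e fourier_vp; last by rewrite normrM normfV (gtr0_norm d0) ler_pdivrMr// mul1r.
by rewrite mulr1 -rmorphM/= divff ?gt_eqF.
Qed.

(** A function whose frequencies fill the band [l - e, l + e]. *)
Definition wave (e l x : R) : R[i] := (fejer (e * x))%:C * cexp (l * x).

(** The triangle of half-width 2e is a combination of three triangles of
    half-width e. *)
Lemma wave_halve e l x : wave (2 * e) l x =
  2^-1%:C * (wave e l x + 2^-1%:C * (wave e (l + e) x + wave e (l - e) x)).
Proof.
rewrite /wave -(mulrA 2) fejer2.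
have -> : (l + e) * x = l * x + e * x by ring.
have -> : (l - e) * x = l * x + - (e * x) by ring.
rewrite !cexpD /cexp cosN sinN.
by apply: cplxP; rewrite !cplxE /=; field.
Qed.

Let U (s : R) : R := 2^-1 * ((1 - s) * \1_`[0, 1]%classic s).

Let mU : measurable_fun setT (U : T -> T).
Proof.
apply: measurable_funM => //; apply: measurable_funM => //.
by apply: measurable_funB.
Qed.

Let iU : leb.-integrable setT (EFin \o (U : T -> R)).
Proof.
have iI : leb.-integrable setT (EFin \o (\1_`[0, 1]%classic : T -> R)).
  by apply: integrable_indic_itv.
apply: (integrable_domR measurableT mU iI) => x _.
rewrite /U !normrM !indicE; case: (boolP (x \in _)) => [|_]; last by rewrite !normr0 !mulr0.
rewrite inE /= in_itv /= => /andP[x0 x1].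
rewrite gtr0_norm ?invr_gt0// ger0_norm ?subr_ge0// normr1; lra.
Qed.

Let wave_mix e l u : wave e l u = cintegral leb setT
  (fun s : T => (U s)%:C * (cexp ((l + s * e) * u) + cexp ((l - s * e) * u))).
Proof.
have E s : (U s)%:C * (cexp ((l + s * e) * u) + cexp ((l - s * e) * u)) =
   cexp (l * u) * (((fun s => (1 - s) * cos (s * (e * u))) \_ `[0, 1]) s)%:C.
  have -> : (l + s * e) * u = l * u + s * (e * u) by ring.
  have -> : (l - s * e) * u = l * u + - (s * (e * u)) by ring.
  rewrite !cexpD -mulrDr mulrCA; congr (_ * _).
  rewrite /cexp cosN sinN patchE /U indicE; case: (boolP (s \in _)) => _.
    by apply: cplxP; rewrite !cplxE /= mulr1; field.
  by rewrite !mulr0 mul0r.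
under eq_cintegral do rewrite E.
have ic : leb.-integrable `[0, 1] (EFin \o (fun s : R => (1 - s) * cos (s * (e * u)))).
  apply: continuous_compact_integrable; first exact: segment_compact.
  apply: continuous_subspaceT => s.
  apply: cvgM; first by apply: cvgB; [exact: cvg_cst|exact: cvg_id].
  apply: continuous_comp; last exact: continuous_cos.
  by apply: cvgM; [exact: cvg_id|exact: cvg_cst].
have ip : leb.-integrable setT
   (EFin \o ((fun s : R => (1 - s) * cos (s * (e * u))) \_ `[0, 1])).
  by rewrite -restrict_EFin; apply/integrable_restrict => //; rewrite setTI.
rewrite cintegralZ//; last by split => //=; exact: integrable0.
rewrite /wave mulrC fejerE Rintegral_mkcond; congr (_ * _).
by apply: cplxP => //=; rewrite /Rintegral integral0_eq.
Qed.

Let wave_mix_reproduce (d e l m w s : R) : 0 < e -> `|l - m| + e <= d ->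
  cintegral leb setT (fun z : T => (d * vp (d * z))%:C * cexp (m * z) *
    ((U s)%:C * (cexp ((l + s * e) * (w - z)) + cexp ((l - s * e) * (w - z))))) =
  (U s)%:C * (cexp ((l + s * e) * w) + cexp ((l - s * e) * w)).
Proof.
move=> e0 led; have d0 : 0 < d by apply: lt_le_trans led; rewrite ltr_wpDl.
have [s01|s01] := boolP (s \in (`[0, 1]%classic : set R)); last first.
  have U0 : U s = 0 by rewrite /U indicE (negbTE s01) !mulr0.
  rewrite U0 mul0r -[RHS](cintegral0 leb setT); apply: eq_cintegral => z _.
  by rewrite mul0r mulr0.
have /andP[s0 s1] : 0 <= s <= 1 by move: s01; rewrite inE.
have ha a : `|l - m| + `|a - l| <= d ->
   cintegrable leb setT (fun z => (d * vp (d * z))%:C * cexp ((m - a) * z)) /\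
   cintegral leb setT (fun z => (d * vp (d * z))%:C * cexp ((m - a) * z)) = 1.
  move=> h; apply: fourier_vp_scale => //; apply: le_trans h.
  rewrite -normrN opprB (_ : a - m = (l - m) + (a - l)); last by ring.
  exact: ler_normD.
have se : s * e <= e by rewrite ler_piMl// ltW.
have se0 : 0 <= s * e by rewrite mulr_ge0// ltW.
have [|i1 e1] := ha (l + s * e).
  rewrite (_ : l + s * e - l = s * e); last by ring.
  by rewrite (ger0_norm se0); lra.
have [|i2 e2] := ha (l - s * e).
  rewrite (_ : l - s * e - l = - (s * e)); last by ring.
  by rewrite normrN (ger0_norm se0); lra.
transitivity (cintegral leb setT (fun z => (U s)%:C * (
   cexp ((l + s * e) * w) * ((d * vp (d * z))%:C * cexp ((m - (l + s * e)) * z)) +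
   cexp ((l - s * e) * w) * ((d * vp (d * z))%:C * cexp ((m - (l - s * e)) * z))))).
  apply: eq_cintegral => z _.
  have hc a : cexp (m * z) * cexp (a * (w - z)) = cexp (a * w) * cexp ((m - a) * z).
    by rewrite -!cexpD; congr cexp; ring.
  rewrite [LHS]mulrCA; congr (_ * _).
  by rewrite mulrDr -!mulrA !hc; congr (_ + _); rewrite mulrCA.
have j1 := cintegrableZ (cexp ((l + s * e) * w)) measurableT i1.
have j2 := cintegrableZ (cexp ((l - s * e) * w)) measurableT i2.
rewrite (cintegralZ _ measurableT (cintegrableD measurableT j1 j2)).
rewrite (cintegralD measurableT j1 j2).
by rewrite (cintegralZ _ measurableT i1) (cintegralZ _ measurableT i2) e1 e2 !mulr1.
Qed.

(** The rescaled kernel, centred at m, has transform 1 on [m - d, m + d];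
    convolution with it fixes every superposition of exponentials with
    frequencies in that band. *)
Lemma wave_reproduce (d e l m w : R) : 0 < e -> `|l - m| + e <= d ->
  cintegral leb setT (fun z : T => (d * vp (d * z))%:C * cexp (m * z) * wave e l (w - z))
  = wave e l w.
Proof.
move=> e0 led; have d0 : 0 < d by apply: lt_le_trans led; rewrite ltr_wpDl.
pose A (z : T) := (d * vp (d * z))%:C * cexp (m * z).
have mvd : measurable_fun setT (fun z : T => d * vp (d * z) : T).
  apply: measurable_funM => //; have := @measurable_comp_scale _ d 0 measurable_vp.
  by under eq_fun do rewrite addr0.
have ivd : leb.-integrable setT (EFin \o (fun z : T => 2 * `|d * vp (d * z)|)).
  apply: integrableZR => //; apply: integrable_norm; apply: integrableZR => //.
  have [+ _] := integral_affine 0 d0 integrable_vp.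
  by under eq_fun do rewrite /= addr0.
pose F (z s : T) := A z * ((U s)%:C * (cexp ((l + s * e) * (w - z)) + cexp ((l - s * e) * (w - z)))).
have m1 : measurable_fun setT (fst : T * T -> T) by exact: measurable_fst.
have m2 : measurable_fun setT (snd : T * T -> T) by exact: measurable_snd.
have mw : measurable_fun setT (fun xy : T * T => w - xy.1 : T) by apply: measurable_funB.
have mse : measurable_fun setT (fun xy : T * T => xy.2 * e : T) by apply: measurable_funM.
have mF : cmeas (fun xy : T * T => F xy.1 xy.2).
  apply: cmeasM.
    apply: (cmeas_comp (phi := fst) (f := A)) => //.
    apply: cmeasM; first exact: cmeasR.
    by apply: cmeas_cexp; exact: mulrl_measurable.
  apply: cmeasM.
    exact: (cmeas_comp (phi := snd) (f := fun s : T => (U s)%:C) m2 (cmeasR mU)).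
  apply: cmeasD; apply: cmeas_cexp; apply: measurable_funM => //.
    by apply: measurable_funD.
  by apply: measurable_funB.
have i4 : leb.-integrable setT (EFin \o (fun s : T => 4 * `|U s|)).
  by apply: integrableZR => //; exact: integrable_norm.
have c4 (a b : R) : nrm1 (cexp a + cexp b) <= 4.
  apply: le_trans (nrm1D _ _) _.
  have := nrm1_cexp a; have := nrm1_cexp b; lra.
have dom z s : nrm1 (F z s) <= 2 * `|d * vp (d * z)| * (4 * `|U s|).
  rewrite /F (le_trans (nrm1M _ _))// ler_pM ?nrm1_ge0//.
    by rewrite /A (le_trans (nrm1M _ _))// nrm1R mulrC ler_wpM2r// nrm1_cexp.
  by rewrite nrm1_RM mulrC ler_wpM2r.
have [_ _ eq] := fubini_C_prod mF ivd i4 dom.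
transitivity (cintegral leb setT (fun x => cintegral leb setT (F x))).
  apply: eq_cintegral => z _.
  rewrite wave_mix.
  symmetry.
  apply: (cintegralZ (A z) measurableT).
  apply: (cintegrable_dom measurableT _ i4).
    apply: cmeasM; first exact: cmeasR.
    have ms : measurable_fun setT (fun s : T => s * e : T) by exact: mulrr_measurable.
    have mc (c : R) : measurable_fun setT (fun s : T => c : T) by exact: measurable_cst.
    apply: cmeasD; apply: cmeas_cexp; apply: measurable_funM (mc _).
      exact: measurable_funD (mc l) ms.
    exact: measurable_funB (mc l) ms.
  by move=> s _; rewrite nrm1_RM /= [leRHS]mulrC ler_wpM2l.
rewrite eq wave_mix; apply: eq_cintegral => s _.
exact: wave_mix_reproduce.
Qed.

End vallee_poussin.

(** * Continuity of translations of the de la Vallee-Poussin kernel in L1 *)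

Section vp_modulus.
Context {R : realType}.
Local Notation T := (measurableTypeR R).
Local Notation leb := (@lebesgue_measure R).
Local Notation vp := (@vallee_poussin R).

Definition vp_modulus (h : R) : R := \int[leb]_z `|vp (z - h) - vp z|.

Lemma integrable_vp_shift h :
  leb.-integrable setT (EFin \o (fun z : T => `|vp (z - h) - vp z|)).
Proof.
have [i _] := integral_shift (- h) (@integrable_vp R).
by apply: (@integrable_norm _ _ _ leb); apply: integrableBR => //; exact: integrable_vp.
Qed.

Lemma vp_modulus_ge0 h : 0 <= vp_modulus h.
Proof. exact: Rintegral_ge0. Qed.

Lemma vp_modulus_bound : exists V, forall h, vp_modulus h <= V.
Proof.
exists (2 * \int[leb]_z `|vp z|) => h.
have iv := @integrable_vp R; have iv' := integrable_norm iv.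
have [i e] := integral_shift (- h) iv'.
have -> : 2 * \int[leb]_z `|vp z| = \int[leb]_z (`|vp (z - h)| + `|vp z|).
  by rewrite (RintegralD measurableT i iv') e; ring.
apply: le_Rintegral => //; first exact: integrable_vp_shift.
  exact: (integrableDR measurableT i iv').
by move=> z _; exact: ler_normB.
Qed.

Lemma measurable_vp_modulus : measurable_fun setT (vp_modulus : T -> T).
Proof.
pose F (hz : T * T) : \bar R := (`|vp (hz.2 - hz.1) - vp hz.2|)%:E.
have mF : measurable_fun setT F.
  apply/measurable_EFinP; apply: measurableT_comp => //; apply: measurable_funB.
    have h : measurable_fun setT (fun hz : T * T => hz.2 - hz.1 : T) by apply: measurable_funB.
    exact: (measurableT_comp (@measurable_vp R) h).
  exact: (measurableT_comp (@measurable_vp R) (@measurable_snd _ _ _ _)).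
have F0 x : (0 <= F x)%E by rewrite /F lee_fin.
have := @measurable_fun_fubini_tonelli_F _ _ _ _ _ leb F mF F0.
by move=> h; exact: (measurableT_comp (fine_measurable measurableT) h).
Qed.

Lemma fejer_cvg (u : nat -> R) (x : R) : x != 0 -> u @ \oo --> x ->
  fejer (u n) @[n --> \oo] --> fejer x.
Proof.
move=> x0 ux.
have : (1 - cos (u n)) / (u n) ^+ 2 @[n --> \oo] --> (1 - cos x) / x ^+ 2.
  apply: cvgM.
    apply: cvgB; first exact: cvg_cst.
    by apply: (cvg_comp _ _ ux); exact: continuous_cos.
  apply: cvgV; first by rewrite sqrf_eq0.
  by apply: cvgM.
rewrite {2}/fejer (negbTE x0); apply: cvg_trans; apply: near_eq_cvg.
have : \forall n \near \oo, u n != 0.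
  exact: cvgr_neq0 ux x0.
by apply: filterS => n n0; rewrite /fejer (negbTE n0).
Qed.

(** Dominated convergence: the kernel is continuous off 0 and O(1 / (1 +
    z^2)). *)
Lemma vp_modulus_cvg (h : nat -> R) : h @ \oo --> (0 : R) ->
  vp_modulus (h n) @[n --> \oo] --> (0 : R).
Proof.
move=> h0; have [C [C0 vC]] := @vp_bound R.
have hb : \forall n \near \oo, `|h n| <= 1.
  have := (cvgr0Pnorm_le _).1 h0 1 ltr01; exact.
have [N _ hN] := hb.
rewrite -(cvg_shiftn N).
have Z : \int[leb]_z (cst 0 z) = 0 :> R by rewrite /Rintegral integral0_eq.
suff D : (fun n => \int[leb]_z `|vp (z - h (n + N)%N) - vp z|) @ \oo -->
    \int[leb]_z (cst 0 z : R) by rewrite Z in D.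
apply: (@dct_R _ T R leb (fun n z => `|vp (z - h (n + N)%N) - vp z|) (cst 0)
   (fun z : T => 4 * C * (oneDsqr z)^-1)).
- move=> n; apply/measurable_EFinP; exact: measurable_int (integrable_vp_shift _).
- exact: measurable_cst.
- exists [set (0:R)]; split; [exact: measurable_set1|exact: lebesgue_measure_set1|].
  move=> z /=; apply: contra_notP => /eqP z0.
  have hn : z - h (n + N)%N @[n --> \oo] --> z.
    rewrite -{2}[z]subr0; apply: cvgB; first exact: cvg_cst.
    by rewrite cvg_shiftn.
  have vz : vp (z - h (n + N)%N) @[n --> \oo] --> vp z.
    apply: cvgM; last exact: cvg_cst.
    apply: cvgB; last exact: fejer_cvg.
    apply: cvgM; first exact: cvg_cst.
    apply: fejer_cvg; first by rewrite mulf_neq0.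
    by apply: cvgM => //; exact: cvg_cst.
  rewrite -(normr0 R) -(subrr (vp z)); apply: cvg_norm; apply: cvgB => //; exact: cvg_cst.
- by apply: integrableZR => //; exact: integrable_oneDsqrV.
- move=> n z; rewrite normr_id (le_trans (ler_normB _ _))//.
  have h1 := vC (z - h (n + N)%N); have h2 := vC z.
  have : `|h (n + N)%N| <= 1 by apply: hN => /=; rewrite leq_addl.
  move: (h _) h1 => w h1 w1.
  have q0 : 0 < oneDsqr z by exact: lt_le_trans (oneDsqr_ge1 z).
  have q1 : 0 < oneDsqr (z - w) by exact: lt_le_trans (oneDsqr_ge1 _).
  (* The shifts are at most 1 from the index N on, so one majorant serves all of them. *)
  have h3 : (oneDsqr (z - w))^-1 <= 3 * (oneDsqr z)^-1.
    rewrite ler_pdivlMr// ler_pdivrMl//; move: w1; rewrite ler_norml => /andP[w1 w2].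
    have ww : w ^+ 2 <= 1 by nra.
    have := sqr_ge0 (2 * z - 3 * w); rewrite /oneDsqr; lra.
  have := ler_wpM2l C0 h3; lra.
Qed.

End vp_modulus.

(** * Wave packets of a bounded function *)

Section wave_facts.
Context {R : realType}.
Local Notation T := (measurableTypeR R).
Local Notation leb := (@lebesgue_measure R).
Local Notation vp := (@vallee_poussin R).

Lemma cmeas_wave (e l : R) : cmeas (wave e l : T -> R[i]).
Proof.
apply: cmeasM.
  apply: cmeasR; have := @measurable_comp_scale R _ e 0 measurable_fejer.
  by under eq_fun do rewrite addr0.
by apply: cmeas_cexp; exact: mulrl_measurable.
Qed.

Lemma nrm1_wave (e l x : R) : nrm1 (wave e l x) <= 2 * fejer (e * x).
Proof.
rewrite /wave nrm1_RM ger0_norm ?fejer_ge0// mulrC ler_wpM2r ?fejer_ge0//.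
exact: nrm1_cexp.
Qed.

Lemma integrable_wave_bound (e : R) : 0 < e ->
  leb.-integrable setT (EFin \o (fun x : T => 2 * fejer (e * x))).
Proof.
move=> e0; apply: integrableZR => //.
have [+ _] := integral_affine 0 e0 (@integrable_fejer R).
by under eq_fun do rewrite /= addr0.
Qed.

Lemma integrable_vp_bound (d : R) : 0 < d ->
  leb.-integrable setT (EFin \o (fun z : T => d * vp (d * z))) /\
  leb.-integrable setT (EFin \o (fun z : T => 2 * `|d * vp (d * z)|)).
Proof.
move=> d0.
have i : leb.-integrable setT (EFin \o (fun z : T => d * vp (d * z))).
  apply: integrableZR => //.
  have [+ _] := integral_affine 0 d0 (@integrable_vp R).
  by under eq_fun do rewrite /= addr0.
by split => //; apply: integrableZR => //; exact: (@integrable_norm _ _ _ leb).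
Qed.

Lemma nrm1_vp_cexp (d m z : R) :
  nrm1 ((d * vp (d * z))%:C * cexp (m * z)) <= 2 * `|d * vp (d * z)|.
Proof. by rewrite nrm1_RM mulrC ler_wpM2r// nrm1_cexp. Qed.

Lemma cmeas_vp_cexp (d m : R) : cmeas (fun z : T => (d * vp (d * z))%:C * cexp (m * z)).
Proof.
apply: cmeasM; last by apply: cmeas_cexp; exact: mulrl_measurable.
apply: cmeasR; apply: measurable_funM => //.
have := @measurable_comp_scale R _ d 0 (@measurable_vp R).
by under eq_fun do rewrite addr0.
Qed.

Lemma measurable_add2 (a : R) : measurable_fun setT (fun xy : T * T => xy.1 + xy.2 + a : T).
Proof. by apply: measurable_funD => //; apply: measurable_funD. Qed.

Lemma measurable_sub2 : measurable_fun setT (fun xy : T * T => xy.2 - xy.1 : T).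
Proof. by apply: measurable_funB. Qed.

Lemma cmeas_fst (f : T -> R[i]) : cmeas f -> cmeas (fun xy : T * T => f xy.1).
Proof. by move=> mf; apply: (cmeas_comp (phi := fst)) => //; exact: measurable_fst. Qed.
Lemma cmeas_snd (f : T -> R[i]) : cmeas f -> cmeas (fun xy : T * T => f xy.2).
Proof. by move=> mf; apply: (cmeas_comp (phi := snd)) => //; exact: measurable_snd. Qed.
Lemma cmeas_shift (f : T -> R[i]) (a : R) : cmeas f -> cmeas (fun x : T => f (x + a)).
Proof.
move=> mf; apply: (cmeas_comp (phi := fun x : T => x + a : T)) => //.
by apply: measurable_funD.
Qed.

End wave_facts.

Section packets.
Context {R : realType}.
Local Notation T := (measurableTypeR R).
Local Notation leb := (@lebesgue_measure R).
Local Notation vp := (@vallee_poussin R).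
Variables (H : T -> R[i]) (M : R).
Hypotheses (mH : cmeas H) (HM : forall x, nrm1 (H x) <= M).

(** The component of H in the frequency band [l - e, l + e], up to the sign
    of frequencies since this is a correlation and not a convolution. *)
Definition packet (e l y : R) : R[i] :=
  cintegral leb setT (fun x : T => wave e l x * H (x + y)).

Let M0 : 0 <= M. Proof. exact: le_trans (nrm1_ge0 _) (HM 0). Qed.

Let waveH_bound e l x y : nrm1 (wave e l x * H y) <= M * (2 * fejer (e * x)).
Proof.
apply: le_trans (nrm1M _ _) _; rewrite mulrC ler_pM ?nrm1_ge0//; exact: nrm1_wave.
Qed.

Lemma cintegrable_packet e l y : 0 < e ->
  cintegrable leb setT (fun x : T => wave e l x * H (x + y)).
Proof.
move=> e0.
apply: (cintegrable_dom measurableT _ (integrableZR M measurableT (integrable_wave_bound e0))).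
  by apply: cmeasM; [exact: cmeas_wave|exact: cmeas_shift].
by move=> x _; exact: waveH_bound.
Qed.

Lemma packet_bounded e l : 0 < e -> exists N, forall y, nrm1 (packet e l y) <= N.
Proof.
move=> e0; exists (\int[leb]_x (M * (2 * fejer (e * x)))) => y.
have i := integrableZR M measurableT (integrable_wave_bound e0).
apply: (nrm1_cintegral measurableT _ i); last by move=> x _; exact: waveH_bound.
by apply: cmeasM; [exact: cmeas_wave|exact: cmeas_shift].
Qed.

Lemma packet_halve e l y : 0 < e -> packet (2 * e) l y =
  2^-1%:C * (packet e l y + 2^-1%:C * (packet e (l + e) y + packet e (l - e) y)).
Proof.
move=> e0; have i m := cintegrable_packet m y e0.
rewrite -(cintegralD measurableT (i _) (i _)).
rewrite -(cintegralZ _ measurableT (cintegrableD measurableT (i _) (i _))).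
rewrite -(cintegralD measurableT (i _) (cintegrableZ _ measurableT (cintegrableD measurableT (i _) (i _)))).
rewrite -(cintegralZ _ measurableT (cintegrableD measurableT (i _) (cintegrableZ _ measurableT (cintegrableD measurableT (i _) (i _))))).
apply: eq_cintegral => x _; rewrite wave_halve; ring.
Qed.

(** The reproducing property of waves passes to packets by Fubini's theorem. *)
Lemma packet_reproduce (d e l m y : R) : 0 < e -> `|l - m| + e <= d ->
  cintegrable leb setT (fun z : T => (d * vp (d * z))%:C * cexp (m * z) * packet e l (z + y)) /\
  cintegral leb setT (fun z : T => (d * vp (d * z))%:C * cexp (m * z) * packet e l (z + y))
  = packet e l y.
Proof.
move=> e0 led; have d0 : 0 < d by apply: lt_le_trans led; rewrite ltr_wpDl.
pose A (z : T) := (d * vp (d * z))%:C * cexp (m * z).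
pose F (z w : T) := A z * (wave e l (w - z) * H (w + y)).
have [_ iA] := integrable_vp_bound d0.
have iW := integrableZR M measurableT (integrable_wave_bound e0).
have mF : cmeas (fun xy : T * T => F xy.1 xy.2).
  apply: cmeasM; first exact: (cmeas_fst (cmeas_vp_cexp d m)).
  apply: cmeasM; last exact: (cmeas_snd (cmeas_shift y mH)).
  exact: (cmeas_comp measurable_sub2 (cmeas_wave e l)).
have dom z w : nrm1 (F z w) <= 2 * `|d * vp (d * z)| * (M * (2 * fejer (e * (w - z)))).
  apply: le_trans (nrm1M _ _) _.
  apply: ler_pM; [exact: nrm1_ge0|exact: nrm1_ge0|exact: nrm1_vp_cexp|exact: waveH_bound].
have [i1 _ eq] := fubini_C_shift mF iA iW dom.
have E : (fun z : T => cintegral leb setT (F z)) = (fun z => A z * packet e l (z + y)).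
  apply/funext => z.
  have [j1 j2] := cintegral_shift (- z) (cintegrable_packet l (z + y) e0).
  have Ez : (fun x => wave e l (x - z) * H (x - z + (z + y))) =
            (fun w => wave e l (w - z) * H (w + y)).
    by apply/funext => x; congr (_ * H _); ring.
  rewrite Ez in j1 j2.
  by rewrite /F (cintegralZ (A z) measurableT j1) j2.
rewrite -/A -E; split; first exact: i1.
rewrite eq; apply: eq_cintegral => w _.
have mw : measurable_fun setT (fun z : T => w - z : T) by apply: measurable_funB.
have iAw : cintegrable leb setT (fun z : T => A z * wave e l (w - z)).
  have iA1 : leb.-integrable setT (EFin \o (fun z : T => 1 * (2 * `|d * vp (d * z)|))).
    exact: integrableZR.
  apply: (cintegrable_dom measurableT _ iA1).
    by apply: cmeasM; [exact: cmeas_vp_cexp|exact: (cmeas_comp mw (cmeas_wave e l))].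
  move=> z _; apply: le_trans (nrm1M _ _) _; rewrite mulrC.
  apply: ler_pM; [exact: nrm1_ge0|exact: nrm1_ge0| |exact: nrm1_vp_cexp].
  apply: le_trans (nrm1_wave _ _ _) _; have := fejer_le_half (e * (w - z)); lra.
rewrite -[in RHS](wave_reproduce w e0 led) [RHS]mulrC.
rewrite -(cintegralZ (H (w + y)) measurableT iAw).
by apply: eq_cintegral => z _; rewrite /F mulrA mulrC.
Qed.

(** A packet of narrow band is nearly a multiple of the exponential of
    frequency -m. The error is controlled by translations of the kernel that
    reproduces the packet. *)
Lemma packet_eigen (d e l m x y N : R) : 0 < e -> `|l - m| + e <= d ->
  (forall y, nrm1 (packet e l y) <= N) ->
  nrm1 (cexp (m * x) * packet e l (x + y) - packet e l y) <= 2 * N * vp_modulus (d * x).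
Proof.
move=> e0 led GN; have d0 : 0 < d by apply: lt_le_trans led; rewrite ltr_wpDl.
have dd : d / d = 1 by rewrite divff// gt_eqF.
pose D (z : T) := (d * (vp (d * z - d * x) - vp (d * z)))%:C * (cexp (m * z) * packet e l (z + y)).
have ptw z : nrm1 (D z) <= 2 * N * (d * `|vp (d * z - d * x) - vp (d * z)|).
  rewrite nrm1_RM normrM (gtr0_norm d0) [leRHS]mulrC.
  apply: ler_wpM2l; first by rewrite mulr_ge0// ltW.
  apply: le_trans (nrm1M _ _) _; apply: ler_pM; rewrite ?nrm1_ge0//; exact: nrm1_cexp.
have [i1 e1] := packet_reproduce y e0 led.
have [i2 e2] := packet_reproduce (x + y) e0 led.
have [j2 f2] := cintegral_shift (- x) i2.
have iM : leb.-integrable setT (EFin \o (fun z : T => 2 * N * (d * `|vp (d * z - d * x) - vp (d * z)|))) /\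
   \int[leb]_z (2 * N * (d * `|vp (d * z - d * x) - vp (d * z)|)) = 2 * N * vp_modulus (d * x).
  have [i ei] := integral_affine 0 d0 (integrable_vp_shift (d * x)).
  have E : (fun z => `|vp (d * z + 0 - d * x) - vp (d * z + 0)|) =
           (fun z => `|vp (d * z - d * x) - vp (d * z)|) by apply/funext => z; rewrite addr0.
  rewrite E in i ei.
  have i' := integrableZR d measurableT i.
  split; first exact: (integrableZR (2 * N) measurableT i').
  rewrite (RintegralZl (2 * N) measurableT i') (RintegralZl d measurableT i) ei.
  by rewrite /vp_modulus (mulrA d) dd mul1r.
case: iM => iM <-.
have k2 := cintegrableZ (cexp (m * x)) measurableT j2.
have k1 := cintegrableZ (-1) measurableT i1.
have DE : D = (fun z => cexp (m * x) * ((d * vp (d * (z - x)))%:C * cexp (m * (z - x)) *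
    packet e l (z - x + (x + y))) + -1 * ((d * vp (d * z))%:C * cexp (m * z) * packet e l (z + y))).
  apply/funext => z; rewrite /D; have -> : d * z - d * x = d * (z - x) by ring.
  have -> : z - x + (x + y) = z + y by ring.
  have -> : cexp (m * z) = cexp (m * x) * cexp (m * (z - x)) by rewrite -cexpD; congr cexp; ring.
  rewrite mulrBr rmorphB/=; ring.
have -> : cexp (m * x) * packet e l (x + y) - packet e l y = cintegral leb setT D.
  rewrite DE (cintegralD measurableT k2 k1) (cintegralZ _ measurableT j2).
  by rewrite (cintegralZ _ measurableT i1) f2 e2 e1 mulN1r.
have iD : cintegrable leb setT D by rewrite DE; exact: cintegrableD.
exact: (nrm1_cintegral measurableT (cintegrable_measurable iD) iM (fun z _ => ptw z)).
Qed.

End packets.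

(** * Wiener's theorem for bounded functions *)

Section wiener.
Context {R : realType}.
Local Notation T := (measurableTypeR R).
Local Notation leb := (@lebesgue_measure R).
Variables (k H : T -> R[i]) (M : R).
Hypotheses (ik : cintegrable leb setT k) (mH : cmeas H) (HM : forall x, nrm1 (H x) <= M).
Hypothesis kH : forall y, cintegral leb setT (fun x : T => k x * H (x + y)) = 0.

Let mk : cmeas k. Proof. exact: cintegrable_measurable ik. Qed.

(** Since k is orthogonal to the translates of H, it is orthogonal to those
    of each packet. *)
Lemma packet_correlation (e l y : R) : 0 < e ->
  cintegrable leb setT (fun x : T => k x * packet H e l (x + y)) /\
  cintegral leb setT (fun x : T => k x * packet H e l (x + y)) = 0.
Proof.
move=> e0.
pose F (x z : T) := k x * (wave e l z * H (z + (x + y))).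
have Fsym x z : F x z = wave e l z * (k x * H (x + (z + y))).
  by rewrite /F mulrCA; congr (_ * (_ * H _)); ring.
have dom x z : nrm1 (F x z) <= nrm1 (k x) * (M * (2 * fejer (e * z))).
  apply: le_trans (nrm1M _ _) _; apply: ler_wpM2l; first exact: nrm1_ge0.
  apply: le_trans (nrm1M _ _) _; rewrite mulrC.
  apply: ler_pM; [exact: nrm1_ge0|exact: nrm1_ge0|exact: HM|exact: nrm1_wave].
have mF : cmeas (fun xy : T * T => F xy.1 xy.2).
  apply: cmeasM; first exact: (cmeas_fst mk).
  apply: cmeasM; first exact: (cmeas_snd (cmeas_wave e l)).
  rewrite (_ : (fun xy : T * T => H _) = (fun xy => H (xy.1 + xy.2 + y))).
    exact: (cmeas_comp (measurable_add2 y) mH).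
  by apply/funext => xy; congr H; ring.
have [i1 _ eq] := fubini_C_prod mF (integrable_nrm1 measurableT ik)
  (integrableZR M measurableT (integrable_wave_bound e0)) dom.
have E : (fun x : T => cintegral leb setT (F x)) = (fun x => k x * packet H e l (x + y)).
  apply/funext => x; rewrite -(cintegralZ _ measurableT (cintegrable_packet mH HM l (x + y) e0)).
  by [].
rewrite -E; split; first exact: i1.
rewrite eq -[RHS](cintegral0 leb setT); apply: eq_cintegral => z _.
have ikH : cintegrable leb setT (fun x : T => k x * H (x + (z + y))).
  apply: (cintegrable_dom measurableT _ (integrableZR M measurableT (integrable_nrm1 measurableT ik))).
    by apply: cmeasM mk _; exact: cmeas_shift.
  move=> x _; apply: le_trans (nrm1M _ _) _; rewrite mulrC.
  apply: ler_wpM2r; [exact: nrm1_ge0|exact: HM].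
under eq_cintegral do rewrite Fsym.
by rewrite (cintegralZ _ measurableT ikH) kH mulr0.
Qed.

Definition khat (m : R) := cintegral leb setT (fun x : T => k x * cexp (- m * x)).

Definition kernel_modulus (d : R) := \int[leb]_x (nrm1 (k x) * vp_modulus (d * x)).

Let integrable_kernel_modulus (d : R) : leb.-integrable setT (EFin \o (fun x : T => nrm1 (k x) * vp_modulus (d * x))).
Proof.
have [V hV] := @vp_modulus_bound R.
have mm : measurable_fun setT (fun x : T => nrm1 (k x) * vp_modulus (d * x) : T).
  apply: measurable_funM; first exact: cmeas_nrm1.
  have := @measurable_comp_scale R _ d 0 (@measurable_vp_modulus R).
  by under eq_fun do rewrite addr0.
apply: (integrable_domR measurableT mm (integrableZR V measurableT (integrable_nrm1 measurableT ik))).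
move=> x _; rewrite normrM ger0_norm ?nrm1_ge0// ger0_norm ?vp_modulus_ge0// mulrC.
by apply: ler_wpM2r; [exact: nrm1_ge0|exact: hV].
Qed.

Lemma kernel_modulus_cvg (d : nat -> R) : d @ \oo --> (0 : R) -> kernel_modulus (d n) @[n --> \oo] --> (0 : R).
Proof.
move=> d0; have [V hV] := @vp_modulus_bound R.
have Z : \int[leb]_z (cst 0 z) = 0 :> R by rewrite /Rintegral integral0_eq.
suff D : (fun n => \int[leb]_x (nrm1 (k x) * vp_modulus (d n * x))) @ \oo -->
    \int[leb]_z (cst 0 z : R) by rewrite Z in D.
apply: (@dct_R _ T R leb _ _ (fun x : T => V * nrm1 (k x))).
- move=> n; apply/measurable_EFinP; exact: measurable_int (integrable_kernel_modulus (d n)).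
- exact: measurable_cst.
- apply: nearW => x; rewrite /= -[X in _ --> X](mulr0 (nrm1 (k x))); apply: cvgM; first exact: cvg_cst.
  by apply: vp_modulus_cvg; rewrite -[X in _ --> X](mul0r x); apply: cvgM => //; exact: cvg_cst.
- exact: (integrableZR V measurableT (integrable_nrm1 measurableT ik)).
- move=> n x; rewrite normrM ger0_norm ?nrm1_ge0// ger0_norm ?vp_modulus_ge0// mulrC.
  by apply: ler_wpM2r; [exact: nrm1_ge0|exact: hV].
Qed.

(** Were the packet exactly exponential, its correlation with k would be
    khat m times the packet. That correlation is 0, so khat m times the
    packet is as small as the deviation from an exponential. *)
Lemma packet_khat (d e l m y N : R) : 0 < e -> `|l - m| + e <= d ->
  (forall y, nrm1 (packet H e l y) <= N) ->
  nrm1 (khat m * packet H e l y) <= 4 * N * kernel_modulus d.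
Proof.
move=> e0 led GN.
pose D (x : T) := k x * cexp (- m * x) * (packet H e l y - cexp (m * x) * packet H e l (x + y)).
have ptw x : nrm1 (D x) <= 4 * N * (nrm1 (k x) * vp_modulus (d * x)).
  apply: le_trans (nrm1M _ _) _.
  have h1 : nrm1 (k x * cexp (- m * x)) <= nrm1 (k x) * 2.
    by apply: le_trans (nrm1M _ _) _; apply: ler_wpM2l; [exact: nrm1_ge0|exact: nrm1_cexp].
  have h2 := packet_eigen mH HM x y e0 led GN; rewrite -nrm1N opprB in h2.
  apply: le_trans (ler_pM (nrm1_ge0 _) (nrm1_ge0 _) h1 h2) _.
  by rewrite le_eqVlt; apply/orP; left; apply/eqP; ring.
have [i0 e0'] := packet_correlation l y e0.
have ikc : cintegrable leb setT (fun x : T => k x * cexp (- m * x)).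
  apply: (cintegrable_dom measurableT _ (integrableZR 2 measurableT (integrable_nrm1 measurableT ik))).
    by apply: cmeasM mk _; apply: cmeas_cexp; exact: mulrl_measurable.
  move=> x _; apply: le_trans (nrm1M _ _) _; rewrite mulrC.
  apply: ler_wpM2r; [exact: nrm1_ge0|exact: nrm1_cexp].
have DE : D = (fun x => packet H e l y * (k x * cexp (- m * x)) + -1 * (k x * packet H e l (x + y))).
  apply/funext => x; rewrite /D mulrBr; congr (_ + _); first exact: mulrC.
  rewrite mulN1r -mulrA (mulrA (cexp _)) mulNr cexpNK mul1r; ring.
have j1 := cintegrableZ (packet H e l y) measurableT ikc.
have j2 := cintegrableZ (-1) measurableT i0.
have iD : cintegrable leb setT D by rewrite DE; exact: cintegrableD.
have -> : khat m * packet H e l y = cintegral leb setT D.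
  rewrite DE (cintegralD measurableT j1 j2) (cintegralZ _ measurableT ikc).
  by rewrite (cintegralZ _ measurableT i0) e0' mulr0 addr0 mulrC.
rewrite /kernel_modulus -(RintegralZl (4 * N) measurableT (integrable_kernel_modulus d)).
exact: (nrm1_cintegral measurableT (cintegrable_measurable iD)
  (integrableZR (4 * N) measurableT (integrable_kernel_modulus d)) (fun x _ => ptw x)).
Qed.

(** The deviation is proportional to the supremum of the packet: once the
    factor is at most 1/2, this supremum is 0. *)
Lemma packet_eq0 (d e l m : R) : 0 < e -> `|l - m| + e <= d -> khat m != 0 ->
  nrm1 (khat m)^-1 * (4 * kernel_modulus d) <= 2^-1 ->
  forall y, packet H e l y = 0.
Proof.
move=> e0 led k0 small.
have [N0 hN0] := packet_bounded mH HM l e0.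
pose S := range (fun y => nrm1 (packet H e l y)).
have supS : has_sup S.
  split; first by exists (nrm1 (packet H e l 0)); exists 0.
  by exists N0 => _ [y _ <-]; exact: hN0.
pose N := sup S.
have hN y : nrm1 (packet H e l y) <= N by apply: sup_upper_bound => //; exists y.
have N0' : 0 <= N by apply: le_trans (hN 0); exact: nrm1_ge0.
have half y : nrm1 (packet H e l y) <= 2^-1 * N.
  rewrite -[packet H e l y](mulKf k0); apply: le_trans (nrm1M _ _) _.
  apply: le_trans (ler_wpM2l (nrm1_ge0 _) (packet_khat y e0 led hN)) _.
  rewrite (_ : nrm1 _ * _ = nrm1 (khat m)^-1 * (4 * kernel_modulus d) * N); last by ring.
  exact: ler_wpM2r.
have : N <= 2^-1 * N by apply: ge_sup; [exact: supS.1|move=> _ [y _ <-]; exact: half].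
move=> NN y; apply: nrm1_eq0; apply/le_anti/andP; split; last exact: nrm1_ge0.
by apply: le_trans (hN y) _; lra.
Qed.

Hypothesis khat0 : forall m, khat m != 0.
Hypotheses (cRe : continuous (fun x : R => complex.Re (H x)))
           (cIm : continuous (fun x : R => complex.Im (H x))).

Let bad (e l : R) := exists y, packet H e l y != 0.

Let bad_halve e l : 0 < e -> bad (2 * e) l ->
  exists l', bad e l' /\ `|l' - l| <= e.
Proof.
move=> e0 [y]; rewrite (packet_halve mH HM l y e0) => h.
have [h1|/negPn/eqP h1] := boolP (packet H e l y != 0).
  by exists l; split; [exists y|rewrite subrr normr0 ltW].
have [h2|/negPn/eqP h2] := boolP (packet H e (l + e) y != 0).
  by exists (l + e); split; [exists y|rewrite addrC addrA addNr add0r gtr0_norm].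
have [h3|/negPn/eqP h3] := boolP (packet H e (l - e) y != 0).
  by exists (l - e); split; [exists y|rewrite addrAC subrr add0r normrN gtr0_norm].
by move: h; rewrite h1 h2 h3 !(addr0, mulr0) eqxx.
Qed.

(** Bisection in frequency: a nonzero packet contains nonzero packets of
    bandwidth e / 2^n, whose bands shrink to some m. Since khat m is not 0,
    narrow packets near m vanish, a contradiction. *)
Let not_bad e l : 0 < e -> ~ bad e l.
Proof.
move=> e0 b0.
pose S := {p : R * R | 0 < p.1 /\ bad p.1 p.2}.
pose rel (p q : S) := 2 * (sval q).1 = (sval p).1 /\ `|(sval q).2 - (sval p).2| <= (sval q).1.
have step p : {q | rel p q}.
  apply: cid; case: p => -[e1 l1] /= [e10 b1].
  have h0 : 0 < e1 / 2 by rewrite divr_gt0.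
  have [|l' [b' hl']] := @bad_halve (e1 / 2) l1 h0; first by rewrite mulrC divfK.
  exists (exist _ (e1 / 2, l') (conj h0 b')); split => //=.
  by rewrite mulrC divfK.
have [f [f0 fS]] := dependent_choice step (exist _ (e, l) (conj e0 b0)).
pose E n := (sval (f n)).1; pose L n := (sval (f n)).2.
have Epos n : 0 < E n := (svalP (f n)).1.
have EE n : E n = e * 2^-1 ^+ n.
  elim: n => [|n IH]; first by rewrite /E f0 /= mulr1.
  by have [h _] := fS n; rewrite exprS mulrCA -IH /E -h mulKf.
have left_nd : nondecreasing_seq (fun n => L n - E n).
  apply/nondecreasing_seqP => n; have [h1 h2] := fS n; move: h1 h2.
  rewrite -/(E n) -/(E n.+1) -/(L n) -/(L n.+1) => h1; rewrite ler_norml => /andP[]; lra.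
have right_ni : nonincreasing_seq (fun n => L n + E n).
  apply/nonincreasing_seqP => n; have [h1 h2] := fS n; move: h1 h2.
  rewrite -/(E n) -/(E n.+1) -/(L n) -/(L n.+1) => h1; rewrite ler_norml => /andP[]; lra.
have lr i n : L i - E i <= L n + E n.
  apply: le_trans (left_nd _ _ (leq_maxl i n)) _.
  apply: le_trans (right_ni _ _ (leq_maxr i n)).
  have := Epos (maxn i n); lra.
(* m is the common point of the nested bands [L n - E n, L n + E n]. *)
pose m := sup (range (fun n => L n - E n)).
have hs : has_sup (range (fun n => L n - E n)).
  split; first by exists (L 0%N - E 0%N); exists 0%N.
  by exists (L 0%N + E 0%N) => _ [n _ <-].
have close n : `|L n - m| + E n <= 2 * E n.
  have h1 : L n - E n <= m by apply: sup_upper_bound => //; exists n.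
  have h2 : m <= L n + E n by apply: ge_sup; [exact: hs.1|move=> _ [i _ <-]].
  have : `|L n - m| <= E n by rewrite ler_norml; apply/andP; split; lra.
  lra.
have E0 : (fun n => 2 * E n) @ \oo --> (0 : R).
  rewrite (_ : (fun n => 2 * E n) = (fun n => (2 * e) * 2^-1 ^+ n)).
    rewrite -[X in _ --> X](mulr0 (2 * e)); apply: cvgM; first exact: cvg_cst.
    by apply: cvg_expr; rewrite gtr0_norm ?invr_gt0// invf_lt1// ltr1n.
  by apply/funext => n; rewrite EE mulrA.
pose c := nrm1 (khat m)^-1 * 4.
have c0 : 0 <= c by rewrite mulr_ge0// nrm1_ge0.
have small : c * kernel_modulus (2 * E n) @[n --> \oo] --> (0 : R).
  rewrite -[X in _ --> X](mulr0 c); apply: cvgM; [exact: cvg_cst|exact: kernel_modulus_cvg].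
have half0 : 0 < 2^-1 :> R by rewrite invr_gt0.
have [n _ hn] := (cvgr0Pnorm_le _).1 small _ half0.
have [y] := (svalP (f n)).2; rewrite -/(E n) -/(L n) => /eqP; apply.
apply: (packet_eq0 (Epos n) (close n) (khat0 m)).
rewrite mulrA -/c; apply: le_trans (ler_norm _) _; exact: (hn n (leqnn n)).
Qed.

(** The dilated Fejer kernels are an approximate identity. *)
Let packet_limit (g : R -> R) y : continuous g -> (forall x, `|g x| <= M) ->
  (forall n, \int[leb]_x (fejer x * g (x / n.+1%:R + y)) = 0) -> g y = 0.
Proof.
move=> cg gM g0.
have mg n : measurable_fun setT (fun x : T => g (x / n.+1%:R + y) : T).
  have := @measurable_comp_scale R _ (n.+1%:R^-1) y (continuous_measurable_fun cg).
  by under eq_fun do rewrite mulrC.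
have : (fun n => \int[leb]_x (fejer x * g (x / n.+1%:R + y))) @ \oo -->
   \int[leb]_x (fejer x * g y).
  apply: (@dct_R _ T R leb _ _ (fun x : T => M * fejer x)).
  - move=> n; apply: measurable_funM; [exact: measurable_fejer|exact: mg].
  - by apply: measurable_funM => //; exact: measurable_fejer.
  - apply: nearW => x; apply: cvgM; first exact: cvg_cst.
    have hx : x / n.+1%:R + y @[n --> \oo] --> y.
      rewrite -[X in _ --> X]add0r; apply: cvgD; last exact: cvg_cst.
      rewrite -[X in _ --> X](mulr0 x); apply: cvgM; first exact: cvg_cst.
      exact: cvg_harmonic.
    exact: (cvg_comp _ _ hx (cg y)).
  - exact: (integrableZR M measurableT (@integrable_fejer R)).
  - move=> n x; rewrite normrM ger0_norm ?fejer_ge0// mulrC.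
    by apply: ler_wpM2r; [exact: fejer_ge0|exact: gM].
rewrite (_ : (fun n => \int[leb]_x _) = fun=> 0); last by apply/funext => n; exact: g0.
rewrite (RintegralZr _ measurableT (@integrable_fejer R)) -/fejer_mass => h.
have e0 : (fun=> 0 : R) @ \oo --> (0 : R) by exact: cvg_cst.
have /eqP : fejer_mass * g y = 0.
  by rewrite -(cvg_lim (@Rhausdorff R) h) (cvg_lim (@Rhausdorff R) e0).
by rewrite mulf_eq0 gt_eqF ?fejer_mass_gt0//= => /eqP.
Qed.

(** Wiener's Tauberian theorem in dual form. By the bisection argument every
    packet of H vanishes, and H is the limit of its packets as the bandwidth
    grows. *)
Theorem wiener_Linfty y : H y = 0.
Proof.
have P n x : packet H n.+1%:R 0 x = 0.
  apply: contrapT => h; apply: (@not_bad n.+1%:R 0) => //; exists x; exact/eqP.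
have key n : cintegral leb setT (fun x : T => (fejer x)%:C * H (x / n.+1%:R + y)) = 0.
  have n0 : 0 < n.+1%:R :> R by rewrite ltr0n.
  have n1 : n.+1%:R != 0 :> R by rewrite gt_eqF.
  have iF : cintegrable leb setT (fun x : T => (fejer x)%:C * H (x / n.+1%:R + y)).
    apply: (cintegrable_dom measurableT _ (integrableZR M measurableT (@integrable_fejer R))).
      apply: cmeasM; first by apply: cmeasR; exact: measurable_fejer.
      apply: (cmeas_comp (phi := fun x : T => x / n.+1%:R + y : T)) mH.
      by apply: measurable_funD => //; exact: mulrr_measurable.
    move=> x _; rewrite nrm1_RM ger0_norm ?fejer_ge0// mulrC.
    by apply: ler_wpM2r; [exact: fejer_ge0|exact: HM].
  have [_] := cintegral_affine 0 n0 iF.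
  have -> : (fun x => (fejer (n.+1%:R * x + 0))%:C * H ((n.+1%:R * x + 0) / n.+1%:R + y)) =
            (fun x => wave n.+1%:R 0 x * H (x + y)).
    apply/funext => x; rewrite /wave mul0r cexp0 mulr1 addr0; congr (_ * H (_ + _)).
    by rewrite mulrAC divff ?mul1r.
  rewrite -/(packet H n.+1%:R 0 y) P => /esym/eqP.
  by rewrite mulf_eq0 eq_complex /= invr_eq0 (negbTE n1) /= => /eqP.
apply: cplxP.
  apply: (packet_limit (g := fun x => complex.Re (H x))) => //.
    by move=> x; apply: le_trans (nrm1_Re _) (HM x).
  move=> n; have h := congr1 (@complex.Re R) (key n).
  rewrite -[RHS]/(complex.Re (0 : R[i])) -h; apply: eq_Rintegral => x _; rewrite -[RHS]/(complex.Re ((fejer x)%:C * H (x / n.+1%:R + y))) cReM.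
  by rewrite /= mul0r subr0.
apply: (packet_limit (g := fun x => complex.Im (H x))) => //.
  by move=> x; apply: le_trans (nrm1_Im _) (HM x).
move=> n; have h := congr1 (@complex.Im R) (key n).
rewrite -[RHS]/(complex.Im (0 : R[i])) -h; apply: eq_Rintegral => x _; rewrite -[RHS]/(complex.Im ((fejer x)%:C * H (x / n.+1%:R + y))) cImM.
by rewrite /= mul0r addr0.
Qed.
End wiener.

(** * Proximate orders in the logarithmic variable *)

Section proximate.
Context {R : realType}.
Variables (rho : R -> R) (rho0 : R).
Hypothesis hrho : proximate_order rho rho0.

(** The deviation of ln V (exp x) from the linear function rho0 x. *)
Definition log_drift (x : R) : R := x * (rho (expR x) - rho0).
Local Notation v := log_drift.

Lemma prox_V_expR x : prox_V rho (expR x) = expR (rho0 * x + v x).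
Proof. by rewrite /prox_V -expRM /v; congr expR; ring. Qed.

Lemma expR_neq1 x : x != 0 -> expR x != 1 :> R.
Proof. by apply: contra => /eqP h; rewrite -(expRK x) h ln1. Qed.

Lemma log_driftN x : v (- x) = v x.
Proof.
have [->|x0] := eqVneq x 0; first by rewrite oppr0.
have [_ h _ _ _] := hrho.
rewrite /v expRN h ?expR_gt0 ?expR_neq1//; ring.
Qed.

Let dv (x : R) : R := rho (expR x) - rho0 + expR x * x * derive1 (fun r => rho r - rho0) (expR x).

Lemma is_derive_log_drift (x : R) : x != 0 -> is_derive x 1 v (dv x).
Proof.
move=> x0; have [_ _ h _ _] := hrho.
have [dr _] := h _ (expR_gt0 x) (expR_neq1 x0).
have hr : is_derive (expR x) 1 (fun r => rho r - rho0) (derive1 (fun r => rho r - rho0) (expR x)).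
  by apply: DeriveDef => //; rewrite derive1E.
have he := is_derive_expR x.
have hc : is_derive x 1 (fun y => rho (expR y) - rho0)
    (derive1 (fun r => rho r - rho0) (expR x) * expR x).
  exact: (@is_derive1_comp R (fun r => rho r - rho0) expR x _ _ hr he).
have hm := @is_deriveM _ _ (@id R) _ x 1 1 _ (is_derive_id _ _) hc.
rewrite (_ : dv x = x *: (derive1 (fun r => rho r - rho0) (expR x) * expR x) +
  (rho (expR x) - rho0) *: (1 : R)); first exact: hm.
rewrite /dv /GRing.scale/=; ring.
Qed.

Lemma expR_cvgy : expR x @[x --> +oo] --> (+oo : set_system R).
Proof.
apply/cvgryPge => A; near=> x.
apply: (@le_trans _ _ (1 + x)); last exact: expR_ge1Dx.
rewrite -lerBlDl; near: x; apply: nbhs_pinfty_ge; exact: num_real.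
Unshelve. all: by end_near. Qed.

Lemma dv_cvg : dv x @[x --> +oo] --> (0 : R).
Proof.
have [h1 _ _ h4 _] := hrho.
have h := cvgD (cvg_comp _ _ expR_cvgy h1) (cvg_comp _ _ expR_cvgy h4).
rewrite addr0 in h.
suff -> : dv = ((fun r => rho r - rho0) \o expR) \+
  ((fun r => r * ln r * derive1 (fun r => rho r - rho0) r) \o expR) by exact: h.
by apply/funext => x; rewrite /dv /= expRK.
Qed.

Lemma continuous_log_drift (x : R) : x != 0 -> {for x, continuous v}.
Proof.
move=> x0; apply: differentiable_continuous; apply/derivable1_diffP.
by have [] := is_derive_log_drift x0.
Qed.

(** The derivative of the drift tends to 0, by the limits of rho and of r ln
    r rho' (r). *)
Lemma log_drift_lip (e : R) : 0 < e -> exists X, 0 < X /\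
  forall x y, X <= x -> X <= y -> `|v y - v x| <= e * `|y - x|.
Proof.
move=> e0; have [X0 [_ hX0]] : \forall x \near +oo, `|dv x| <= e.
  exact: (cvgr0Pnorm_le _).1 dv_cvg e e0.
pose X := Num.max (X0 + 1) 1; exists X.
have X1 : X0 + 1 <= X by rewrite le_max lexx.
have X2 : 1 <= X by rewrite le_max lexx orbT.
split; first exact: lt_le_trans X2.
have main x y : X <= x -> x < y -> `|v y - v x| <= e * `|y - x|.
  move=> Xx xy.
  have [|| c] := @MVT R v dv x y xy.
  - move=> c; rewrite in_itv/= => /andP[xc _]; apply: is_derive_log_drift.
    by rewrite gt_eqF//; lra.
  - apply: continuous_in_subspaceT => c; rewrite inE/= in_itv/= => /andP[xc _].
    by apply: continuous_log_drift; rewrite gt_eqF//; lra.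
  rewrite in_itv/= => /andP[xc _] ->; rewrite normrM ler_wpM2r//.
  by apply: hX0; lra.
move=> x y Xx Xy; have [xy|yx|->] := ltgtP x y; first exact: main.
  by rewrite -normrN opprB -[X in _ * X]normrN opprB; exact: main.
by rewrite !subrr normr0 mulr0.
Qed.

(** Near 0 the bound comes from the continuous extension of V to 1,
    elsewhere from continuity; evenness reduces to x > 0. *)
Lemma log_drift_bounded X : exists B, forall x, `|x| <= X -> `|v x| <= B.
Proof.
have [_ _ _ _ h5] := hrho.
have [d /= d0 hd] : \forall x \near (0 : R)^', `|v x| <= 1.
  have : expR (v x) @[x --> (0:R)^'] --> (1 : R).
    have -> : (fun x => expR (v x)) = (fun r => r `^ (rho r - rho0)) \o expR.
      by apply/funext => x; rewrite /= -expRM.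
    apply: cvg_comp h5.
    have : expR x @[x --> (0:R)] --> (1 : R).
      by rewrite -expR0; exact: continuous_expR.
    move=> + A [e /= e0 he] => /(_ _ (nbhsx_ballx (1 : R) e e0)) [d /= d0 hd].
    exists d => //= x xd x0; apply: he; first exact: hd.
    exact: expR_neq1.
  move=> /cvgrPdist_lt /(_ (2^-1)); rewrite invr_gt0 => /(_ (ltr0Sn R 1)).
  apply: filterS => x; rewrite ltr_norml => /andP[h1 h2].
  have e1 := expR_ge1Dx (1 : R).
  rewrite ler_norml; apply/andP; split.
    rewrite leNgt; apply/negP => vx.
    have : expR (v x) < expR (-1) by rewrite ltr_expR.
    have : expR (-1) <= 2^-1 :> R.
      by rewrite expRN lef_pV2 ?posrE ?expR_gt0//; lra.
    lra.
  rewrite leNgt; apply/negP => vx.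
  have : expR 1 < expR (v x) by rewrite ltr_expR.
  lra.
have v0 : v 0 = 0 by rewrite /v mul0r.
pose d2 := d / 2; have d20 : 0 < d2 by rewrite divr_gt0.
have cw : {within `[d2, Num.max d2 X], continuous (fun x => `|v x|)}.
  apply: continuous_in_subspaceT => x; rewrite inE/= in_itv/= => /andP[xc _].
  apply: (@continuous_comp _ _ _ v Num.norm); last exact: norm_continuous.
  by apply: continuous_log_drift; rewrite gt_eqF//; exact: lt_le_trans xc.
have [|c _ hc] := EVT_max _ cw; first by rewrite le_max lexx.
exists (Num.max 1 `|v c|) => x xX.
wlog x0 : x xX / 0 <= x.
  move=> H; have [/H//|x0] := leP 0 x; first exact.
  by rewrite -log_driftN; apply: H; rewrite ?normrN// oppr_ge0 ltW.
rewrite ger0_norm// in xX; rewrite le_max.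
have [xd|dx] := ltP x d2; last first.
  by rewrite hc ?orbT// in_itv/= dx le_max xX orbT.
have [->|xn0] := eqVneq x 0; first by rewrite v0 normr0 ler01.
rewrite hd//=; rewrite sub0r normrN ger0_norm//; move: xd; rewrite /d2; lra.
Qed.

(** Far out the Lipschitz bound applies, on the negative side as well since
    the drift is even; in between the drift is bounded. *)
Lemma log_drift_step A : exists B, forall x t, `|t| <= A -> `|v (x + t) - v x| <= B.
Proof.
have [X [X0 hX]] := log_drift_lip (@ltr01 R).
have [B hB] := log_drift_bounded (X + A + A).
have far x t : `|t| <= A -> X + A < x -> `|v (x + t) - v x| <= A.
  move=> tA xX; have := tA; rewrite ler_norml => /andP[t1 t2].
  apply: le_trans (hX _ _ _ _) _; [lra|lra|].
  by rewrite mul1r (addrC (x + t)) addKr.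
exists (Num.max A (2 * B)) => x t tA; rewrite le_max.
have := tA; rewrite ler_norml => /andP[t1 t2].
have [h|h] := ltP (X + A) x; first by rewrite far.
have [h'|h'] := ltP (X + A) (- x).
  by rewrite -(log_driftN x) -(log_driftN (x + t)) opprD far ?normrN.
apply/orP; right; apply: le_trans (ler_normB _ _) _.
have b1 : `|v x| <= B by apply: hB; rewrite ler_norml; apply/andP; split; lra.
have b2 : `|v (x + t)| <= B by apply: hB; rewrite ler_norml; apply/andP; split; lra.
lra.
Qed.

Lemma log_drift_slow t : v (x + t) - v x @[x --> +oo] --> (0 : R).
Proof.
apply/cvgr0Pnorm_le => e e0.
have e1 : 0 < e / (`|t| + 1) by rewrite divr_gt0// ltr_wpDl.
have [X [X0 hX]] := log_drift_lip e1.
near=> x; apply: le_trans (hX _ _ _ _) _.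
- near: x; apply: nbhs_pinfty_ge; exact: num_real.
- rewrite -lerBlDr; near: x; apply: nbhs_pinfty_ge; exact: num_real.
- rewrite (addrC (x + t)) addKr mulrAC ler_pdivrMr ?ltr_wpDl//.
  by rewrite ler_wpM2l ?(ltW e0)// lerDl.
Unshelve. all: by end_near. Qed.

Local Notation gamma := (prox_gamma rho rho0).

Let ratioE x t : prox_V rho (expR x * expR t) / (expR t `^ rho0 * prox_V rho (expR x)) =
  expR (v (x + t) - v x).
Proof.
rewrite -expRD -expRM !prox_V_expR -expRD -expRB; congr expR; ring.
Qed.

Let gamma_set t := [set prox_V rho (r * expR t) / (expR t `^ rho0 * prox_V rho r) | r in `]0, +oo[].

Let gamma_has_sup t : has_sup (gamma_set t).
Proof.
split; first by exists (expR (v (0 + t) - v 0)); exists (expR 0); [rewrite /= in_itv/= expR_gt0|rewrite ratioE].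
have [B hB] := log_drift_step `|t|.
exists (expR B) => _ [r + <-]; rewrite /= in_itv/= andbT => r0.
have [x <-] := expR_total r0; rewrite ratioE ler_expR.
by apply: le_trans (ler_norm _) (hB _ _ _).
Qed.

Lemma prox_V_gt0 x : 0 < prox_V rho (expR x).
Proof. by rewrite prox_V_expR expR_gt0. Qed.

Lemma prox_V_ratio_le x t :
  prox_V rho (expR (x + t)) / prox_V rho (expR x) <= expR (rho0 * t) * gamma (expR t).
Proof.
rewrite !prox_V_expR -expRB.
have -> : rho0 * (x + t) + v (x + t) - (rho0 * x + v x) = rho0 * t + (v (x + t) - v x) by ring.
rewrite expRD ler_wpM2l ?expR_ge0// -ratioE.
apply: sup_upper_bound; first exact: gamma_has_sup.
by exists (expR x) => //; rewrite /= in_itv/= expR_gt0.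
Qed.

(** The ratio defining gamma tends to 1 at infinity. *)
Lemma prox_gamma_ge1 t : 1 <= gamma (expR t).
Proof.
have h : expR (v (x + t) - v x) @[x --> +oo] --> (1 : R).
  by rewrite -expR0; apply: (cvg_comp _ _ (log_drift_slow t)); exact: continuous_expR.
apply: (cvgr_to_le h).
apply: nearW => x; rewrite -ratioE.
apply: sup_upper_bound; first exact: gamma_has_sup.
by exists (expR x) => //; rewrite /= in_itv/= expR_gt0.
Qed.

Lemma prox_V_ratio_cvg t :
  prox_V rho (expR (x + t)) / prox_V rho (expR x) @[x --> +oo] --> expR (rho0 * t).
Proof.
have h : expR (v (x + t) - v x) @[x --> +oo] --> (1 : R).
  by rewrite -expR0; apply: (cvg_comp _ _ (log_drift_slow t)); exact: continuous_expR.
have E x : prox_V rho (expR (x + t)) / prox_V rho (expR x) = expR (rho0 * t) * expR (v (x + t) - v x).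
  by rewrite !prox_V_expR -expRB -expRD; congr expR; ring.
have h2 : expR (rho0 * t) * expR (v (x + t) - v x) @[x --> +oo] --> expR (rho0 * t) * 1.
  by apply: cvgM; [exact: cvg_cst|exact: h].
by rewrite mulr1 in h2; under eq_fun do rewrite E.
Qed.

Lemma prox_V_ratio_bounded A : exists B, forall x t, `|t| <= A ->
  prox_V rho (expR (x + t)) <= B * prox_V rho (expR x).
Proof.
have [B hB] := log_drift_step A.
exists (expR (`|rho0| * A + B)) => x t tA.
rewrite !prox_V_expR -expRD ler_expR.
have h1 := hB x t tA; have h2 := le_trans (ler_norm _) h1.
have h3 : rho0 * t <= `|rho0| * A.
  by apply: le_trans (ler_norm _) _; rewrite normrM ler_wpM2l.
lra.
Qed.

End proximate.

(** * Measures with a density *)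

Section density_measure.
Context d (T : measurableType d) (R : realType).
Variables (m : {measure set T -> \bar R}) (g : T -> R).
Hypotheses (mg : measurable_fun setT g) (g0 : forall x, 0 <= g x).

Definition density_measure of measurable_fun setT g & (forall x, 0 <= g x) :=
  fun A : set T => (\int[m]_(x in A) (g x)%:E)%E.
Local Notation dm := (density_measure mg g0).

Let dm0 : dm set0 = 0%E. Proof. exact: integral_set0. Qed.
Let dm_ge0 A : (0 <= dm A)%E.
Proof. by apply: integral_ge0 => x _; rewrite lee_fin. Qed.
Let dm_sigma_additive : semi_sigma_additive dm.
Proof.
move=> F mF tF mUF; rewrite /density_measure ge0_integral_bigcup//.
- by apply: is_cvg_nneseries => n _ _; exact: dm_ge0.
- by apply: measurable_funTS; exact/measurable_EFinP.
- by move=> x _; rewrite lee_fin.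
Qed.

HB.instance Definition _ := isMeasure.Build _ _ _ dm dm0 dm_ge0 dm_sigma_additive.

Import HBNNSimple.

Lemma ge0_integral_density (f : T -> \bar R) : measurable_fun setT f ->
  (forall x, 0 <= f x)%E ->
  (\int[dm]_x f x = \int[m]_x (f x * (g x)%:E))%E.
Proof.
move=> mf f0; pose h := nnsfun_approx measurableT mf.
have mg' : measurable_fun setT (EFin \o g) by exact/measurable_EFinP.
have mh n : measurable_fun setT (EFin \o h n) by exact/measurable_EFinP.
have cvh x : EFin (h n x) @[n --> \oo] --> f x.
  by apply: (cvg_nnsfun_approx measurableT mf); [move=> ? _; exact: f0|].
have -> : (\int[dm]_x f x = lim (\int[dm]_x (EFin \o h n) x @[n --> \oo]))%E.
  rewrite -monotone_convergence//.
  - by apply: eq_integral => x _; apply/esym/cvg_lim => //; exact: cvh.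
  - by move=> n x _; rewrite lee_fin.
  - by move=> x _ a b ab; rewrite lee_fin; exact/lefP/nd_nnsfun_approx.
have -> : (\int[m]_x (f x * (g x)%:E) = lim (\int[m]_x ((EFin \o h n) x * (g x)%:E) @[n --> \oo]))%E.
  rewrite -monotone_convergence//.
  - apply: eq_integral => x _; apply/esym/cvg_lim => //.
    by apply: cvgeZr => //; exact: cvh.
  - by move=> n; exact: emeasurable_funM.
  - by move=> n x _; rewrite mule_ge0 ?lee_fin.
  - by move=> x _ a b ab; rewrite lee_wpmul2r ?lee_fin//; exact/lefP/nd_nnsfun_approx.
suff suf n : (\int[dm]_x (EFin \o h n) x = \int[m]_x ((EFin \o h n) x * (g x)%:E))%E.
  by under eq_fun do rewrite suf.
transitivity (\sum_(y \in range (h n)) (y%:E * dm (h n @^-1` [set y])))%E.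
  transitivity (\int[dm]_x (\sum_(y \in range (h n)) (y * \1_(h n @^-1` [set y]) x)%:E))%E.
    by apply: eq_integral => t _; rewrite /= fimfunE -fsumEFin.
  rewrite ge0_integral_fsum//; last 2 first.
  - by move=> r; apply/measurable_EFinP; apply: measurable_funM => //.
  - by move=> r t _; exact: nnfun_muleindic_ge0.
  apply: eq_fsbigr => r rhn.
  under eq_integral do rewrite EFinM.
  by rewrite integralZl_indic_nnsfun// integral_indic// setIT.
transitivity (\int[m]_x (\sum_(y \in range (h n)) ((y * \1_(h n @^-1` [set y]) x)%:E * (g x)%:E)))%E.
  rewrite ge0_integral_fsum//; last 2 first.
  - move=> r; apply: emeasurable_funM; last exact: mg'.
    by apply/measurable_EFinP; apply: measurable_funM.
  - by move=> r t _; apply: mule_ge0; [exact: nnfun_muleindic_ge0|rewrite lee_fin].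
  apply: eq_fsbigr => r rhn.
  under [RHS]eq_integral do rewrite EFinM -muleA.
  have r0 : (0 <= r)%R by move: rhn; rewrite inE => -[t _ <-].
  rewrite ge0_integralZl//; last 2 first.
    - by apply: emeasurable_funM; [apply/measurable_EFinP|exact: mg'].
  - by move=> t _; rewrite mule_ge0 ?lee_fin.
  congr (_ * _)%E; rewrite /density_measure integral_mkcond.
  by apply: eq_integral => x _; rewrite epatch_indic muleC.
apply: eq_integral => x _; rewrite -ge0_mule_fsuml; last first.
  by move=> y; exact: nnfun_muleindic_ge0.
by rewrite fsumEFin// -fimfunE.
Qed.

End density_measure.

(** * The substitution r = exp x *)

Section exp_substitution.
Context {R : realType}.
Local Notation T := (measurableTypeR R).
Local Notation leb := (@lebesgue_measure R).

Let expR_nd : {homo @expR R : x y / x <= y}. Proof. by move=> x y; rewrite ler_expR. Qed.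
Let expR_rc : right_continuous (@expR R).
Proof. by apply/right_continuousW => x; exact: continuous_expR. Qed.
Let cexpR : cumulative R R := HB.pack (@expR R) (isCumulative.Build R _ R expR expR_nd expR_rc).

Let pos : set T := `]0, +oo[%classic.
Let mpos : measurable pos. Proof. exact: measurable_itv. Qed.
Let m1pos : measurable_fun setT (\1_pos : T -> R). Proof. exact: measurable_indic. Qed.
Let pos0 x : 0 <= (\1_pos : T -> R) x. Proof. by rewrite indicE. Qed.
Let mln : measurable_fun setT (@ln R : T -> T). Proof. exact: measurable_ln. Qed.
Let mexp : measurable_fun setT (@expR R : T -> R).
Proof. exact: measurable_expR. Qed.

Let nu1 : {measure set T -> \bar R} :=
  measure_function_pushforward__canonical__measure_function_Measure
    (density_measure leb m1pos pos0) mln.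
Let nu2 : {measure set T -> \bar R} := density_measure leb mexp (@expR_ge0 R).

Let LS_E (a b : R) : lebesgue_stieltjes_measure cexpR `]a, b]%classic =
  if a < b then (expR b - expR a)%:E else 0%E.
Proof.
have -> : lebesgue_stieltjes_measure cexpR `]a, b]%classic = wlength cexpR `]a, b]%classic.
  rewrite /lebesgue_stieltjes_measure /measure_extension.
  by rewrite measurable_mu_extE//; exact: is_ocitv.
case: ltP => ab; first by rewrite wlength_itv_bnd// ltW.
by rewrite set_itv_ge ?wlength0// bnd_simp -leNgt.
Qed.

Let nu1E A : measurable A -> lebesgue_stieltjes_measure cexpR A = nu1 A.
Proof.
apply: lebesgue_stieltjes_measure_unique => _ [[a b] _ <-] /=.
rewrite LS_E /nu1 /pushforward /= /density_measure.
have mp : measurable (@ln R @^-1` `]a, b]%classic : set T).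
  by rewrite -[X in measurable X]setTI; apply: mln => //; exact: measurable_itv.
rewrite integral_indic//.
have -> : pos `&` (@ln R @^-1` `]a, b]%classic) = `]expR a, expR b]%classic.
  apply/seteqP; split => x; rewrite /pos /= !in_itv/= andbT.
    move=> [x0 /andP[h1 h2]]; have hx : expR (ln x) = x by rewrite lnK ?posrE.
    by rewrite -hx ltr_expR ler_expR h1 h2.
  move=> /andP[h1 h2]; have x0 : 0 < x by apply: lt_trans h1; exact: expR_gt0.
  have hx : expR (ln x) = x by rewrite lnK ?posrE.
  by split => //; rewrite -ltr_expR -(ler_expR (ln x)) hx h1 h2.
transitivity (lebesgue_measure (`]expR a, expR b]%classic : set R)); last by [].
by rewrite lebesgue_measure_itv/= lte_fin ltr_expR EFinB.
Qed.

Let nu2E A : measurable A -> lebesgue_stieltjes_measure cexpR A = nu2 A.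
Proof.
apply: lebesgue_stieltjes_measure_unique => _ [[a b] _ <-] /=.
rewrite LS_E /nu2 /= /density_measure; case: ltP => ab; last first.
  by rewrite set_itv_ge ?integral_set0// bnd_simp -leNgt.
have me : measurable_fun setT (EFin \o @expR R : T -> \bar R) by exact/measurable_EFinP.
rewrite integral_itv_obnd_cbnd; last exact: measurable_funTS.
have cR (x : R) : expR z @[z --> x] --> expR x by exact: continuous_expR.
rewrite (@continuous_FTC2 R (@expR R) (@expR R) a b ab)//.
- exact: continuous_subspaceT.
- by split => [x _||]; [exact: derivable_expR|exact: cvg_at_right_filter|exact: cvg_at_left_filter].
- by move=> x _; rewrite derive1E; have [_ ->] := is_derive_expR x.
Qed.

(** Both the image of Lebesgue measure on (0, oo) under ln and the measure
    exp x dx are the Stieltjes measure of exp. *)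
Lemma ge0_integral_expR (f : T -> \bar R) : measurable_fun setT f ->
  (forall x, 0 <= f x)%E ->
  (\int[leb]_(x in `]0%R, +oo[) f x = \int[leb]_x (f (expR x) * (expR x)%:E))%E.
Proof.
move=> mf f0.
have mexp' : measurable_fun setT (@expR R : T -> T) by exact: measurable_expR.
have mfe : measurable_fun setT (fun y : T => f (expR y)) by exact: measurableT_comp mf mexp'.
transitivity (\int[nu2]_y f (expR y))%E; last by rewrite /nu2 ge0_integral_density.
transitivity (\int[nu1]_y f (expR y))%E; last first.
  by apply: eq_measure_integral => A mA _; rewrite -nu1E// nu2E.
rewrite [RHS](@ge0_integral_pushforward _ _ _ _ _ _ mln _ setT (fun y => f (expR y)))//.
rewrite preimage_setT ge0_integral_density//; [|exact: (measurableT_comp mfe mln)|by move=> x; exact: f0].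
transitivity (\int[leb]_x (f \_ pos) x)%E; first exact: integral_mkcond.
apply: eq_integral => x _; rewrite epatch_indic /= !indicE; case: (boolP (x \in _)) => [|_]; last by rewrite /= !mule0.
by rewrite inE /pos /= in_itv/= andbT => x0; rewrite /= !mule1 lnK ?posrE.
Qed.

Let patchm (f : T -> R) : measurable_fun (`]0, +oo[%classic : set T) f -> measurable_fun setT (f \_ pos).
Proof. by move=> mf; apply/(measurable_restrictT _ mpos). Qed.

Lemma measurable_comp_expR (f : T -> R) : measurable_fun (`]0, +oo[%classic : set T) f ->
  measurable_fun setT (fun x : T => f (expR x)).
Proof.
move=> mf.
have mexp' : measurable_fun setT (@expR R : T -> T) by exact: measurable_expR.
have := measurableT_comp (patchm mf) mexp'.
rewrite (_ : _ \o _ = fun x => f (expR x))//; apply/funext => x /=.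
by rewrite patchE ifT// inE /pos /= in_itv/= andbT expR_gt0.
Qed.

Lemma integrable_expR (f : T -> R) : measurable_fun (`]0, +oo[%classic : set T) f ->
  leb.-integrable `]0, +oo[ (EFin \o f) <->
  leb.-integrable setT (EFin \o (fun x : T => f (expR x) * expR x)).
Proof.
move=> mf.
have mfe := measurable_comp_expR mf.
have mf' := patchm mf.
have e : (\int[leb]_(x in `]0%R, +oo[) `|(f x)%:E| = \int[leb]_x `|(f (expR x) * expR x)%:E|)%E.
  transitivity (\int[leb]_(x in `]0%R, +oo[) `|((f \_ pos) x)%:E|)%E.
    by apply: eq_integral => x xp; rewrite patchE xp.
  rewrite (ge0_integral_expR (f := fun x => `|((f \_ pos) x)%:E|%E))//; last first.
    by apply: measurableT_comp => //; exact/measurable_EFinP.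
  apply: eq_integral => x _; rewrite patchE ifT; last by rewrite inE /pos /= in_itv/= andbT expR_gt0.
  by rewrite EFinM abseM (gee0_abs (x := (expR x)%:E))// lee_fin expR_ge0.
split => /integrableP[_ fin]; apply/integrableP; split.
- by apply/measurable_EFinP; apply: measurable_funM.
- by rewrite /comp -e.
- exact/measurable_EFinP.
- by rewrite /comp e.
Qed.

Lemma Rintegral_expR (f : T -> R) : measurable_fun (`]0, +oo[%classic : set T) f ->
  \int[leb]_(x in `]0%R, +oo[) f x = \int[leb]_x (f (expR x) * expR x).
Proof.
move=> mf.
have mf' := patchm mf.
have mg : measurable_fun setT (EFin \o (f \_ pos)) by exact/measurable_EFinP.
have pe x : (f \_ pos) (expR x) = f (expR x).
  by rewrite patchE ifT// inE /pos /= in_itv/= andbT expR_gt0.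
rewrite /Rintegral; congr fine.
transitivity (\int[leb]_(x in `]0%R, +oo[) (EFin \o (f \_ pos)) x)%E.
  by apply: eq_integral => x xp /=; rewrite patchE xp.
have mp : measurable_fun setT (fun x => (EFin \o (f \_ pos))^\+ x)%E by exact: measurable_funepos.
have mn : measurable_fun setT (fun x => (EFin \o (f \_ pos))^\- x)%E by exact: measurable_funeneg.
rewrite [LHS]integralE [RHS]integralE.
rewrite (ge0_integral_expR mp)//; rewrite (ge0_integral_expR mn)//.
have ep x : (0 <= (expR x)%:E :> \bar R)%E by rewrite lee_fin expR_ge0.
congr (_ - _)%E; apply: eq_integral => x _.
  by rewrite !funeposE /= pe EFinM maxe_pMl// mul0e.
by rewrite !funenegE /= pe -mulNr EFinM maxe_pMl// mul0e.
Qed.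

End exp_substitution.

(** * Test integrals of a convolution with a positive measure *)

Section integral_tools.
Context d (T : measurableType d) (R : realType).
Variable m : {measure set T -> \bar R}.

(** A measurable function that is not integrable has real-valued integral 0,
    and scaling preserves this. *)
Lemma RintegralZ_measurable (D : set T) (c : R) (f : T -> R) : measurable D -> measurable_fun D f ->
  \int[m]_(x in D) (c * f x) = c * \int[m]_(x in D) f x.
Proof.
move=> mD mf; have [->|c0] := eqVneq c 0.
  rewrite mul0r (_ : (fun x => 0 * f x) = cst 0); last by apply/funext => x; rewrite mul0r.
  by rewrite /Rintegral integral0_eq.
have junk (h : T -> R) : measurable_fun D h -> ~ m.-integrable D (EFin \o h) ->
    \int[m]_(x in D) h x = 0.
  move=> mh nh; rewrite /Rintegral; apply/eqP; apply: contra_notT nh => h0.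
  have mh' : measurable_fun D (EFin \o h) by exact/measurable_EFinP.
  apply/integrableP; split => //; apply: contraPP h0 => noo.
  have E : (\int[m]_(x in D) `|(EFin \o h) x| = \int[m]_(x in D) (EFin \o h)^\+ x + \int[m]_(x in D) (EFin \o h)^\- x)%E.
    rewrite -ge0_integralD//; [|exact: measurable_funepos|exact: measurable_funeneg].
    by apply: eq_integral => x _; rewrite -[in LHS]/((abse \o (EFin \o h)) x) fune_abse.
  have p0 : (0 <= \int[m]_(x in D) (EFin \o h)^\+ x)%E by apply: integral_ge0.
  have n0 : (0 <= \int[m]_(x in D) (EFin \o h)^\- x)%E by apply: integral_ge0.
  rewrite E in noo; apply/negP; rewrite negbK integralE; apply/eqP.
  move: noo p0 n0; case: (\int[m]_(x in D) (EFin \o h)^\+ x)%E => [a||]; case: (\int[m]_(x in D) (EFin \o h)^\- x)%E => [b||] //=.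
  by rewrite -EFinD ltry.
have [i|ni] := pselect (m.-integrable D (EFin \o f)); first exact: RintegralZl.
rewrite (junk f)// mulr0 junk//; first exact: measurable_funM.
apply: contra_not ni => i.
rewrite (_ : f = fun x => c^-1 * (c * f x)); first exact: integrableZR.
by apply/funext => x; rewrite mulKf.
Qed.
End integral_tools.

Section reflect.
Context {R : realType}.
Local Notation T := (measurableTypeR R).
Local Notation leb := (@lebesgue_measure R).

Lemma ge0_integral_reflect_shift (c : R) (f : T -> \bar R) :
  measurable_fun setT f -> (forall x, 0 <= f x)%E ->
  (\int[leb]_x f (c - x)%R = \int[leb]_x f x)%E.
Proof.
move=> mf f0.
have mg : measurable_fun setT (fun x : T => f (- x)%R).
  by apply: measurableT_comp mf _; exact: oppr_measurable.
rewrite -[RHS]ge0_integral_reflect//.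
have := ge0_integral_affine (- c) (@ltr01 R) mg (fun x => f0 _).
rewrite invr1 mul1e => <-; apply: eq_integral => x _; congr f; ring.
Qed.

Lemma Rintegral_reflect_shift (c : R) (f : T -> R) : measurable_fun setT f ->
  \int[leb]_x f (c - x) = \int[leb]_x f x.
Proof.
move=> mf; rewrite /Rintegral; congr fine; rewrite [LHS]integralE [RHS]integralE.
have mf' : measurable_fun setT (EFin \o f) by exact/measurable_EFinP.
have mp : measurable_fun setT (fun x => (EFin \o f)^\+ x)%E by exact: measurable_funepos.
have mn : measurable_fun setT (fun x => (EFin \o f)^\- x)%E by exact: measurable_funeneg.
rewrite -(ge0_integral_reflect_shift c mp)//; rewrite -(ge0_integral_reflect_shift c mn)//.
congr (_ - _)%E; apply: eq_integral => x _.
  by rewrite !funeposE.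
by rewrite !funenegE.
Qed.

Lemma sigma_finite_positive_radon (M : {measure set T -> \bar R}) :
  positive_radon M -> sigma_finite setT M.
Proof.
move=> [M0 MK].
exists (fun n : nat => `]-oo, 0]%classic `|` `[n.+1%:R^-1, n.+1%:R]%classic).
  apply/esym; rewrite -subTset => x _ /=.
  have [x0|x0] := leP x 0; first by exists 0%N => //; left; rewrite /= in_itv.
  have [n hn] : exists n : nat, x <= n.+1%:R /\ n.+1%:R^-1 <= x.
    exists (maxn (Num.truncn x) (Num.truncn x^-1)); split.
      apply: (le_trans (ltW (truncnS_gt _))).
      by rewrite ler_nat ltnS leq_maxl.
    rewrite -[leRHS]invrK lef_pV2 ?posrE ?invr_gt0//.
    apply: (le_trans (ltW (truncnS_gt _))).
    by rewrite ler_nat ltnS leq_maxr.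
  by exists n => //; right; rewrite /= in_itv/= hn.2 hn.1.
move=> n; split; first by apply: measurableU; exact: measurable_itv.
apply: le_lt_trans (measureU2 _ _ _) _; [exact: measurable_itv|exact: measurable_itv|].
have h0 : (M `]-oo, 0%R]%classic < +oo)%E by rewrite M0 ltry.
have i0 : 0 < n.+1%:R^-1 :> R by rewrite invr_gt0.
have h1 := MK _ n.+1%:R i0.
by apply: lte_add_pinfty; [exact: h0|exact: h1].
Qed.

Definition radon_copy (M : {measure set T -> \bar R}) of positive_radon M :
  set T -> \bar R := M.
HB.instance Definition _ M h := Measure.copy (@radon_copy M h) M.
HB.instance Definition _ M h := Measure_isSigmaFinite.Build _ _ _ (@radon_copy M h)
  (sigma_finite_positive_radon h).

Lemma test_function_measurable (phi : R -> R) : test_function phi ->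
  measurable_fun setT (phi : T -> R).
Proof. by move=> [c _]; exact: continuous_measurable_fun. Qed.

Lemma test_function_id (phi : R -> R) : test_function phi ->
  test_function (fun u => u * phi u).
Proof.
move=> [c [a [b [a0 h]]]]; split.
  by move=> x; apply: cvgM; [exact: cvg_id|exact: c].
by exists a, b; split => // x /h ->; rewrite mulr0.
Qed.

Lemma test_function_neg (phi : R -> R) x : test_function phi -> x <= 0 -> phi x = 0.
Proof.
move=> [c [a [b [a0 h]]]] x0; apply: h; rewrite /= in_itv/= => /andP[ax _].
by have := lt_le_trans a0 (le_trans ax x0); rewrite ltxx.
Qed.

End reflect.

Section dual_convolution.
Context {R : realType}.
Local Notation T := (measurableTypeR R).
Local Notation leb := (@lebesgue_measure R).
Variables (M : {measure set T -> \bar R}) (kappa phi w : R -> R).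
Hypotheses (hM : positive_radon M)
  (mk : measurable_fun (`]0, +oo[%classic : set T) (kappa : T -> R))
  (hphi : test_function phi)
  (iw : leb.-integrable setT (EFin \o (fun y : T => `|kappa (expR y)| * w y)))
  (hw : forall y, (\int[M]_t `|(t / expR y * phi (t / expR y))%:E| <= (w y)%:E)%E).

Let pos : set T := `]0, +oo[%classic.
Let mpos : measurable pos. Proof. exact: measurable_itv. Qed.
Let k0 : T -> R := kappa \_ pos.
Let mk0 : measurable_fun setT k0. Proof. exact/(measurable_restrictT _ mpos). Qed.
Let phi1 (u : T) : T := u * phi u.
Let mphi1 : measurable_fun setT phi1.
Proof. exact: test_function_measurable (test_function_id hphi). Qed.

Let F (x t : T) : R := phi1 (expR x) * k0 (t / expR x).
Let G (y t : T) : R := phi1 (t / expR y) * k0 (expR y).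

Let mexp : measurable_fun setT (@expR R : T -> T). Proof. exact: measurable_expR. Qed.
Let mfst : measurable_fun setT (fst : T * T -> T). Proof. exact: measurable_fst. Qed.
Let mdivc (c : R) : measurable_fun setT (fun t : T => t / c : T).
Proof. exact: mulrr_measurable. Qed.
Let mdiv : measurable_fun setT (fun xt : T * T => xt.2 / expR xt.1 : T).
Proof.
have m2 : measurable_fun setT (snd : T * T -> T) by exact: measurable_snd.
have me : measurable_fun setT (fun xt : T * T => expR (- xt.1) : T).
  have mn : measurable_fun setT (fun xt : T * T => - xt.1 : T).
    by apply: measurable_funN.
  exact: (measurableT_comp mexp mn).
rewrite (_ : (fun xt : T * T => xt.2 / expR xt.1) = (fun xt => xt.2 * expR (- xt.1))).
  exact: measurable_funM.
by apply/funext => xt; rewrite expRN.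
Qed.
Let mF : measurable_fun setT (fun xt : T * T => F xt.1 xt.2).
Proof.
apply: measurable_funM; last exact: (measurableT_comp mk0 mdiv).
exact: (measurableT_comp mphi1 (measurableT_comp mexp mfst)).
Qed.
Let mG : measurable_fun setT (fun xt : T * T => G xt.1 xt.2).
Proof.
apply: measurable_funM; first exact: (measurableT_comp mphi1 mdiv).
exact: (measurableT_comp mk0 (measurableT_comp mexp mfst)).
Qed.

(* In logarithmic variables the substitution r = t / v is x = ln t - y. *)
Let FG (y t : T) : 0 < t -> F (ln t - y) t = G y t.
Proof.
move=> t0; rewrite /F /G expRB lnK ?posrE//; congr (_ * k0 _).
by rewrite invf_div mulrCA divff ?mulr1// gt_eqF.
Qed.
Let F0 (x t : T) : t <= 0 -> F x t = 0.
Proof.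
move=> t0; rewrite /F /k0 patchE ifF ?mulr0//; apply/negP; rewrite inE /pos /= in_itv/= andbT.
by rewrite pmulr_lgt0 ?invr_gt0 ?expR_gt0// ltNge t0.
Qed.
Let G0 (y t : T) : t <= 0 -> G y t = 0.
Proof.
move=> t0; rewrite /G /phi1 (test_function_neg hphi) ?mulr0 ?mul0r//.
by rewrite pmulr_lle0// invr_gt0 expR_gt0.
Qed.

Let mFx (t : T) : measurable_fun setT (F^~ t).
Proof. exact: (measurableT_comp mF (measurable_pair2 t)). Qed.

Let intFG t : \int[leb]_x F x t = \int[leb]_y G y t.
Proof.
have [t0|t0] := leP t 0.
  have -> : F^~ t = cst 0 by apply/funext => x; exact: F0.
  by have -> : G^~ t = cst 0 by apply/funext => x; exact: G0.
rewrite -(Rintegral_reflect_shift (ln t) (mFx t)).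
by apply: eq_Rintegral => y _; rewrite FG.
Qed.

Let intFG_abs t : (\int[leb]_x `|F x t|%:E = \int[leb]_y `|G y t|%:E)%E.
Proof.
have [t0|t0] := leP t 0.
  by apply: eq_integral => x _; rewrite F0// G0.
have mA : measurable_fun setT (fun x => `|F x t|%:E).
  by apply/measurable_EFinP; apply: measurableT_comp => //; exact: mFx.
rewrite -(ge0_integral_reflect_shift (ln t) mA)//.
by apply: eq_integral => y _; rewrite FG.
Qed.

Let k0E y : k0 (expR y) = kappa (expR y).
Proof. by rewrite /k0 patchE ifT// inE /pos /= in_itv/= andbT expR_gt0. Qed.

Let finG : (\int[leb]_y \int[M]_t `|G y t|%:E < +oo)%E.
Proof.
have mk0e : measurable_fun setT (fun y : T => `|k0 (expR y)|%:E).
  by apply/measurable_EFinP; apply: measurableT_comp => //; exact: (measurableT_comp mk0 mexp).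
have le y : (\int[M]_t `|G y t|%:E <= `|(`|kappa (expR y)| * w y)%:E|)%E.
  apply: le_trans (lee_abs _); rewrite EFinM.
  rewrite (_ : (fun t => `|G y t|%:E) = (fun t => `|kappa (expR y)|%:E * `|(phi1 (t / expR y))%:E|)%E); last first.
    by apply/funext => t; rewrite /G k0E normrM mulrC EFinM.
  rewrite ge0_integralZl//.
    by apply: lee_wpmul2l; [rewrite lee_fin|exact: hw].
  apply: measurableT_comp => //; apply/measurable_EFinP; apply: measurableT_comp mphi1 _.
  exact: mulrr_measurable.
case/integrableP : iw => miw; apply: le_lt_trans.
pose M' : {sigma_finite_measure set T -> \bar R} := radon_copy hM.
apply: ge0_le_integral => //.
- by move=> y _; apply: integral_ge0.
- apply: (@measurable_fun_fubini_tonelli_F _ _ _ _ _ M' (fun xt : T * T => `|G xt.1 xt.2|%:E)) => //.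
  by apply/measurable_EFinP; apply: measurableT_comp.
- exact: measurableT_comp.
Qed.

Let finF : (\int[leb]_x \int[M]_t `|F x t|%:E < +oo)%E.
Proof.
pose M' : {sigma_finite_measure set T -> \bar R} := radon_copy hM.
have mAF : measurable_fun setT (fun xt : T * T => `|F xt.1 xt.2|%:E).
  by apply/measurable_EFinP; apply: measurableT_comp.
have mAG : measurable_fun setT (fun xt : T * T => `|G xt.1 xt.2|%:E).
  by apply/measurable_EFinP; apply: measurableT_comp.
have eF := @fubini_tonelli _ _ _ _ _ leb M' _ mAF (fun x => ltac:(by rewrite lee_fin)).
have eG := @fubini_tonelli _ _ _ _ _ leb M' _ mAG (fun x => ltac:(by rewrite lee_fin)).
move: finG; rewrite -[X in (X < _)%E -> _]/(\int[leb]_y \int[M']_t `|G y t|%:E)%E eG.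
rewrite -[X in _ -> (X < _)%E]/(\int[leb]_y \int[M']_t `|F y t|%:E)%E eF.
by under eq_integral do rewrite -intFG_abs.
Qed.

(** Fubini's theorem, with the substitution r = t / v in the inner integral:
    tested against phi, the convolution of kappa with M is a superposition
    of test integrals of dilations of M. The majorant w gives absolute
    convergence of one of the two double integrals, and the substitution
    carries it over to the other. *)
Lemma real_dual_convolution :
  let P := fun x : T => expR x * phi (expR x) * \int[M]_(t in `]0%R, +oo[) kappa (t / expR x) in
  let Q := fun y : T => kappa (expR y) * \int[M]_(t in `]0%R, +oo[) (t / expR y * phi (t / expR y)) in
  [/\ leb.-integrable setT (EFin \o P), leb.-integrable setT (EFin \o Q) &
      \int[leb]_x P x = \int[leb]_y Q y].
Proof.
move=> P Q.
pose M' : {sigma_finite_measure set T -> \bar R} := radon_copy hM.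
have PE : P = fun x => \int[M']_t F x t.
  apply/funext => x; rewrite /F RintegralZ_measurable//.
    rewrite /P /phi1; congr (_ * _).
    rewrite Rintegral_mkcond; apply: eq_Rintegral => t _.
    rewrite /k0 !patchE /pos; congr (if _ then _ else _).
    by apply/idP/idP; rewrite !inE /= !in_itv/= !andbT pmulr_lgt0 ?invr_gt0 ?expR_gt0.
  exact: (measurableT_comp mk0 (mdivc (expR x))).
have QE : Q = fun y => \int[M']_t G y t.
  apply/funext => y; rewrite /G.
  transitivity (\int[M']_t (k0 (expR y) * phi1 (t / expR y))); last first.
    by apply: eq_Rintegral => t _; rewrite mulrC.
  rewrite RintegralZ_measurable//; last exact: (measurableT_comp mphi1 (mdivc (expR y))).
  rewrite /Q k0E; congr (_ * _); rewrite Rintegral_mkcond; apply: eq_Rintegral => t _.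
  rewrite patchE; case: (boolP (t \in _)) => // tn; rewrite /phi1 (test_function_neg hphi) ?mulr0//.
  move: tn; rewrite notin_setE /= in_itv/= andbT => /negP; rewrite -leNgt => t0.
  by rewrite pmulr_lle0// invr_gt0 expR_gt0.
have [i1 _ _ _ e1] := @fubini_R _ _ _ _ _ leb M' F mF finF.
have [i2 _ _ _ e2] := @fubini_R _ _ _ _ _ leb M' G mG finG.
rewrite PE QE; split; [exact: i1|exact: i2|].
rewrite [LHS]e1 [RHS]e2; apply: eq_Rintegral => t _; exact: intFG.
Qed.

End dual_convolution.

(** * Complex measures paired with test functions *)

Section pairing.
Context {R : realType}.
Local Notation T := (measurableTypeR R).
Local Notation leb := (@lebesgue_measure R).
Implicit Types (mu nu : cmeasure R) (phi : R -> R).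

Definition parts_radon mu := [/\ positive_radon (re_pos mu), positive_radon (re_neg mu),
  positive_radon (im_pos mu) & positive_radon (im_neg mu)].

Definition pairing mu phi : R[i] := cmeasure_integral mu (fun x => (phi x)%:C).

Lemma cmeasure_integralE mu (f : R -> R[i]) :
  let I (m : {measure set T -> \bar R}) (g : T -> R) := \int[m]_(t in `]0%R, +oo[) g t in
  cmeasure_integral mu f =
  ((I (re_pos mu) (fun t => complex.Re (f t)) - I (re_neg mu) (fun t => complex.Re (f t)))
   - (I (im_pos mu) (fun t => complex.Im (f t)) - I (im_neg mu) (fun t => complex.Im (f t)))) +i*
  ((I (re_pos mu) (fun t => complex.Im (f t)) - I (re_neg mu) (fun t => complex.Im (f t)))
   + (I (im_pos mu) (fun t => complex.Re (f t)) - I (im_neg mu) (fun t => complex.Re (f t)))).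
Proof.
by move=> I; rewrite /I /cmeasure_integral; apply: cplxP => /=; ring.
Qed.

Lemma pairingE mu phi :
  let I (m : {measure set T -> \bar R}) := \int[m]_(t in `]0%R, +oo[) phi t in
  pairing mu phi = (I (re_pos mu) - I (re_neg mu)) +i* (I (im_pos mu) - I (im_neg mu)).
Proof.
move=> I; rewrite /pairing cmeasure_integralE /=.
have Z (m : {measure set T -> \bar R}) : \int[m]_(t in (`]0%R, +oo[%classic : set T)) (0 : R) = 0.
  by rewrite /Rintegral integral0_eq.
by rewrite !Z !subr0 !add0r.
Qed.

End pairing.

Section complex_dual.
Context {R : realType}.
Local Notation T := (measurableTypeR R).
Local Notation leb := (@lebesgue_measure R).
Variables (M : cmeasure R) (K : R -> R[i]) (phi w : R -> R).
Hypotheses (hM : parts_radon M) (mK : cmeasurable_fun `]0, +oo[ K) (hphi : test_function phi)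
  (iw1 : leb.-integrable setT (EFin \o (fun y : T => `|complex.Re (K (expR y))| * w y)))
  (iw2 : leb.-integrable setT (EFin \o (fun y : T => `|complex.Im (K (expR y))| * w y))).
Let bnd (m : {measure set T -> \bar R}) :=
  forall y, (\int[m]_t `|(t / expR y * phi (t / expR y))%:E| <= (w y)%:E)%E.
Hypotheses (h1 : bnd (re_pos M)) (h2 : bnd (re_neg M)) (h3 : bnd (im_pos M)) (h4 : bnd (im_neg M)).

(** The real identity, applied to the four parts of M and the two parts of
    K. *)
Lemma dual_convolution :
  let P := fun x : T => (expR x * phi (expR x))%:C * convolution_Psi K M (expR x) in
  let Q := fun y : T => K (expR y) * pairing M (fun t => t / expR y * phi (t / expR y)) in
  [/\ cintegrable leb setT P, cintegrable leb setT Q &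
      cintegral leb setT P = cintegral leb setT Q].
Proof.
move=> P Q; have [p1 p2 p3 p4] := hM; have [mr mi] := mK.
have [a1 b1 e1] := real_dual_convolution p1 mr hphi iw1 h1.
have [a2 b2 e2] := real_dual_convolution p2 mr hphi iw1 h2.
have [a3 b3 e3] := real_dual_convolution p3 mr hphi iw1 h3.
have [a4 b4 e4] := real_dual_convolution p4 mr hphi iw1 h4.
have [c1 d1 f1] := real_dual_convolution p1 mi hphi iw2 h1.
have [c2 d2 f2] := real_dual_convolution p2 mi hphi iw2 h2.
have [c3 d3 f3] := real_dual_convolution p3 mi hphi iw2 h3.
have [c4 d4 f4] := real_dual_convolution p4 mi hphi iw2 h4.
pose comb (u1 u2 u3 u4 : T -> R) := fun x => (u1 x - u2 x) - (u3 x - u4 x).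
pose comb' (u1 u2 u3 u4 : T -> R) := fun x => (u1 x - u2 x) + (u3 x - u4 x).
have cI u1 u2 u3 u4 : leb.-integrable setT (EFin \o u1) -> leb.-integrable setT (EFin \o u2) ->
    leb.-integrable setT (EFin \o u3) -> leb.-integrable setT (EFin \o u4) ->
   (leb.-integrable setT (EFin \o comb u1 u2 u3 u4) /\
    \int[leb]_x comb u1 u2 u3 u4 x = (\int[leb]_x u1 x - \int[leb]_x u2 x) - (\int[leb]_x u3 x - \int[leb]_x u4 x)) /\
   (leb.-integrable setT (EFin \o comb' u1 u2 u3 u4) /\
    \int[leb]_x comb' u1 u2 u3 u4 x = (\int[leb]_x u1 x - \int[leb]_x u2 x) + (\int[leb]_x u3 x - \int[leb]_x u4 x)).
  move=> i1 i2 i3 i4.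
  have j1 := integrableBR measurableT i1 i2; have j2 := integrableBR measurableT i3 i4.
  split; split.
  - exact: integrableBR j1 j2.
  - by rewrite (RintegralB measurableT j1 j2) (RintegralB measurableT i1 i2) (RintegralB measurableT i3 i4).
  - exact: integrableDR j1 j2.
  - by rewrite (RintegralD measurableT j1 j2) (RintegralB measurableT i1 i2) (RintegralB measurableT i3 i4).
have [[A1 E1] _] := cI _ _ _ _ a1 a2 c3 c4.
have [_ [A2 E2]] := cI _ _ _ _ c1 c2 a3 a4.
have [[A3 E3] _] := cI _ _ _ _ b1 b2 d3 d4.
have [_ [A4 E4]] := cI _ _ _ _ d1 d2 b3 b4.
set R1 := comb _ _ _ _ in A1 E1; set R2 := comb' _ _ _ _ in A2 E2.
set R3 := comb _ _ _ _ in A3 E3; set R4 := comb' _ _ _ _ in A4 E4.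
have PR : P = fun x => R1 x +i* R2 x.
  apply/funext => x; rewrite /P /convolution_Psi cmeasure_integralE.
  by apply: cplxP; rewrite !cplxE /= /R1 /R2 /comb /comb'; ring.
have QR : Q = fun x => R3 x +i* R4 x.
  apply/funext => y; rewrite /Q pairingE.
  by apply: cplxP; rewrite !cplxE /= /R3 /R4 /comb /comb'; ring.
rewrite PR QR; split; [by split|by split|].
apply: cplxP.
  by move: E1 E3; rewrite e1 e2 f3 f4 => E1 E3; exact: etrans E1 (esym E3).
by move: E2 E4; rewrite f1 f2 e3 e4 => E2 E4; exact: etrans E2 (esym E4).
Qed.
End complex_dual.

Section density_Rintegral.
Context d (T : measurableType d) (R : realType).
Variables (m : {measure set T -> \bar R}) (g : T -> R).
Hypotheses (mg : measurable_fun setT g) (g0 : forall x, 0 <= g x).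

Lemma Rintegral_density (D : set T) (f : T -> R) : measurable D -> measurable_fun setT f ->
  \int[density_measure m mg g0]_(x in D) f x = \int[m]_(x in D) (f x * g x).
Proof.
move=> mD mf; rewrite [LHS]Rintegral_mkcond [RHS]Rintegral_mkcond /Rintegral; congr fine.
have mfD : measurable_fun setT (f \_ D).
  by apply/(measurable_restrictT _ mD); exact: measurable_funTS.
have mf' : measurable_fun setT (EFin \o (f \_ D)) by exact/measurable_EFinP.
have mp : measurable_fun setT (fun x => (EFin \o (f \_ D))^\+ x)%E by exact: measurable_funepos.
have mn : measurable_fun setT (fun x => (EFin \o (f \_ D))^\- x)%E by exact: measurable_funeneg.
have gE x : ((fun x => f x * g x) \_ D) x = (f \_ D) x * g x.
  by rewrite !patchE; case: ifP => // _; rewrite mul0r.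
rewrite [LHS]integralE [RHS]integralE (ge0_integral_density m mg g0 mp)// (ge0_integral_density m mg g0 mn)//.
congr (_ - _)%E; apply: eq_integral => x _.
  by rewrite !funeposE /= gE EFinM maxe_pMl ?lee_fin// mul0e.
by rewrite !funenegE /= gE -mulNr EFinM maxe_pMl ?lee_fin// mul0e.
Qed.

End density_Rintegral.

Section eq_on.
Context d (T : measurableType d) (R : realType).
Variables (m1 m2 m3 m4 : {measure set T -> \bar R}) (A : set T).
Hypotheses (mA : measurable A)
  (f1 : (m1 A < +oo)%E) (f2 : (m2 A < +oo)%E) (f3 : (m3 A < +oo)%E) (f4 : (m4 A < +oo)%E).

(** Moving m2 and m4 to the other side turns the hypothesis into an equality
    of positive measures. *)
Lemma balanced_integral (f : T -> R) C :
  (forall E, measurable E -> E `<=` A -> fine (m1 E) - fine (m2 E) = fine (m3 E) - fine (m4 E)) ->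
  measurable_fun A f -> (forall x, A x -> `|f x| <= C) ->
  \int[m1]_(x in A) f x - \int[m2]_(x in A) f x =
  \int[m3]_(x in A) f x - \int[m4]_(x in A) f x.
Proof.
move=> bal mf fC.
have bf : [bounded f x | x in A].
  by exists C; split => [|u Cu x Ax]; [exact: num_real|exact: le_trans (fC _ Ax) (ltW Cu)].
have i1 := measurable_bounded_integrable mA f1 mf bf.
have i2 := measurable_bounded_integrable mA f2 mf bf.
have i3 := measurable_bounded_integrable mA f3 mf bf.
have i4 := measurable_bounded_integrable mA f4 mf bf.
have mf' : measurable_fun A (EFin \o f) by exact/measurable_EFinP.
have H : (\int[m1]_(x in A) (f x)%:E + \int[m4]_(x in A) (f x)%:E =
          \int[m3]_(x in A) (f x)%:E + \int[m2]_(x in A) (f x)%:E)%E.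
  have s1 := integral_measure_add mA i1 i4; have s2 := integral_measure_add mA i3 i2.
  rewrite -[LHS]s1 -[RHS]s2.
  apply: eq_measure_integral => E mE EA.
  rewrite [LHS](measure_addE m1 m4 E) [RHS](measure_addE m3 m2 E).
  have fin (m : {measure set T -> \bar R}) : (m A < +oo)%E -> m E \is a fin_num.
    by move=> fA; rewrite ge0_fin_numE//; apply: le_lt_trans fA; apply: le_measure => //; rewrite inE.
  rewrite -(fineK (fin _ f1)) -(fineK (fin _ f2)) -(fineK (fin _ f3)) -(fineK (fin _ f4)).
  by rewrite -!EFinD; congr EFin; have := bal _ mE EA; lra.
move: H; rewrite -(fineK (integrable_fin_num mA i1)) -(fineK (integrable_fin_num mA i2)).
rewrite -(fineK (integrable_fin_num mA i3)) -(fineK (integrable_fin_num mA i4)).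
rewrite -!EFinD => -[]; rewrite /Rintegral /= => H; lra.
Qed.
End eq_on.

(** * Radon measures are determined by test functions *)

Section radon_inj.
Context {R : realType}.
Local Notation T := (measurableTypeR R).
Implicit Types (P Q : {measure set T -> \bar R}) (phi : R -> R).

Lemma test_function_bounded phi : test_function phi -> exists C, forall x, `|phi x| <= C.
Proof.
move=> [c [a [b [a0 h]]]].
have [ab|ba] := leP a b; last first.
  exists 0 => x; rewrite h ?normr0//= in_itv/= => /andP[ax xb].
  by have := lt_le_trans ba (le_trans ax xb); rewrite ltxx.
have cn : {within `[a, b], continuous (fun x => `|phi x|)}.
  apply: continuous_subspaceT => x.
  by apply: (@continuous_comp _ _ _ phi Num.norm); [exact: c|exact: norm_continuous].
have [c0 _ hc] := EVT_max ab cn.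
exists (Num.max 0 `|phi c0|) => x; rewrite le_max.
have [xab|xab] := boolP (x \in `[a, b]%R); first by rewrite hc// orbT.
by rewrite h ?normr0 ?lexx//; exact/negP.
Qed.

Lemma test_integral_support P phi (a b : R) : 0 < a ->
  (forall x, ~ `[a, b]%classic x -> phi x = 0) ->
  \int[P]_(t in `]0%R, +oo[) phi t = \int[P]_(t in `[a, b]) phi t.
Proof.
move=> a0 h; rewrite [LHS]Rintegral_mkcond [RHS]Rintegral_mkcond.
apply: eq_Rintegral => t _; rewrite !patchE.
have [tab|tab] := boolP (t \in (`[a, b]%classic : set T)).
  rewrite ifT// inE/= in_itv/= andbT; move: tab; rewrite inE/= in_itv/= => /andP[ta _].
  exact: lt_le_trans ta.
rewrite h; first by rewrite if_same.
by move: tab; rewrite notin_setE.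
Qed.


(** Equal to 1 on [c + e, d] and to 0 outside [c, d + e], and piecewise
    linear: as e tends to 0 it converges to the indicator of ]c, d]. *)
Definition plateau (c d e x : R) : R :=
  Num.max 0 (Num.min 1 (Num.min ((x - c) / e) ((d + e - x) / e))).

Lemma plateau_test (c d e : R) : 0 < c -> 0 < e -> test_function (plateau c d e).
Proof.
move=> c0 e0; split.
  have cm (f g : R -> R) : continuous f -> continuous g -> continuous (fun x => Num.min (f x) (g x)).
    by move=> cf cg x; exact: (continuous_min (cf x) (cg x)).
  have cM (f g : R -> R) : continuous f -> continuous g -> continuous (fun x => Num.max (f x) (g x)).
    by move=> cf cg x; exact: (continuous_max (cf x) (cg x)).
  apply: (cM _ _); first by move=> x; exact: cvg_cst.
  apply: (cm _ _); first by move=> x; exact: cvg_cst.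
  apply: (cm _ _) => x.
    by apply: cvgM; [apply: cvgB; [exact: cvg_id|exact: cvg_cst]|exact: cvg_cst].
  by apply: cvgM; [apply: cvgB; [exact: cvg_cst|exact: cvg_id]|exact: cvg_cst].
exists c, (d + e); split => // x /=; rewrite in_itv/= => /negP.
rewrite negb_and -!ltNge => xcd; apply/max_idPl; rewrite ge_min; apply/orP; right.
rewrite ge_min !pmulr_lle0 ?invr_gt0// !subr_le0.
by case/orP: xcd => /ltW ->; rewrite ?orbT.
Qed.

Lemma plateau_itv (c d e x : R) : 0 <= plateau c d e x <= 1.
Proof. by rewrite /plateau le_max lexx/= ge_max ler01/= ge_min lexx. Qed.

Lemma plateau_cvg (c d x : R) : plateau c d n.+1%:R^-1 x @[n --> \oo] --> (\1_(`]c, d]%classic) x : R).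
Proof.
have small (h : R) : 0 < h -> \forall n \near \oo, n.+1%:R^-1 <= h.
  move=> h0; apply: filterS (near_infty_natSinv_lt (PosNum h0)) => n /=; exact: ltW.
have ps (n : nat) : 0 < n.+1%:R^-1 :> R by rewrite invr_gt0.
rewrite indicE; have [xcd|xcd] := boolP (x \in _).
  move: xcd; rewrite inE/= in_itv/= => /andP[cx xd].
  apply: cvg_near_cst.
  have xc0 : 0 < x - c by rewrite subr_gt0.
  apply: filterS (small _ xc0) => n hn; rewrite /plateau.
  have h : 1 <= Num.min ((x - c) / n.+1%:R^-1) ((d + n.+1%:R^-1 - x) / n.+1%:R^-1).
    by rewrite le_min !ler_pdivlMr// !mul1r hn/= addrAC lerDr subr_ge0.
  by rewrite (min_idPl h); apply/max_idPr; exact: ler01.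
move: xcd; rewrite notin_setE/= in_itv/= => /negP; rewrite negb_and -leNgt -ltNge => xcd.
apply: cvg_near_cst.
have [xc|cx] := leP x c.
  apply: nearW => n; rewrite /plateau; apply/max_idPl; rewrite ge_min; apply/orP; right.
  by rewrite ge_min pmulr_lle0 ?invr_gt0// subr_le0 xc.
have dx : 0 < x - d by case/orP: xcd; lra.
apply: filterS (small _ dx) => n hn; rewrite /plateau; apply/max_idPl; rewrite ge_min; apply/orP; right.
by rewrite ge_min orbC pmulr_lle0 ?invr_gt0//; rewrite -addrA; apply/orP; left; move: hn; set e := _^-1; lra.
Qed.

Lemma radon_itv_lty P (a b : R) : positive_radon P -> 0 < a -> (P `[a, b]%classic < +oo)%E.
Proof. by move=> [_ h] a0; exact: h. Qed.


Lemma bounded_cvg P (D : set T) (f_ : nat -> T -> R) (f : T -> R) (C : R) :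
  measurable D -> (P D < +oo)%E ->
  (forall n, measurable_fun D (f_ n)) -> measurable_fun D f ->
  (forall x, D x -> f_ ^~ x @ \oo --> f x) -> (forall n x, D x -> `|f_ n x| <= C) ->
  (fun n => \int[P]_(x in D) f_ n x) @ \oo --> \int[P]_(x in D) f x.
Proof.
move=> mD fD mf_ mf cvf fC.
have iC : P.-integrable D (EFin \o (cst C : T -> R)).
  apply: measurable_bounded_integrable => //.
  by exists `|C|; split => [|u Cu x _ /=]; [exact: num_real|exact: ltW].
have [] := @dominated_convergence _ _ _ P D mD (fun n => EFin \o f_ n)
  (EFin \o f) (EFin \o cst C).
- by move=> n; exact/measurable_EFinP.
- exact/measurable_EFinP.
- apply/aeW => x Dx; apply: cvg_EFin; last exact: cvf.
  exact: nearW.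
- exact: iC.
- by apply/aeW => x n Dx; rewrite lee_fin; exact: fC.
move=> ifn _ h.
have fi : (\int[P]_(x in D) (f x)%:E)%E \is a fin_num by exact: (integrable_fin_num mD ifn).
by apply: fine_cvg; rewrite fineK.
Qed.

Lemma radon_inj_itv P Q (c d : R) : positive_radon P -> positive_radon Q -> 0 < c ->
  (forall phi, test_function phi ->
    \int[P]_(t in `]0%R, +oo[) phi t = \int[Q]_(t in `]0%R, +oo[) phi t) ->
  P `]c, d]%classic = Q `]c, d]%classic.
Proof.
move=> hP hQ c0 PQ.
pose J : set T := `]c, d]%classic; pose I : set T := `[c, d + 1]%classic.
have mI : measurable I by exact: measurable_itv.
have mJ : measurable J by exact: measurable_itv.
have sub : J `<=` I.
  move=> x; rewrite /J /I /= !in_itv/= => /andP[cx xd]; rewrite (ltW cx)/=; lra.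
have ps (n : nat) : 0 < n.+1%:R^-1 :> R by rewrite invr_gt0.
have bt n := plateau_test d c0 (ps n).
have fin M : positive_radon M -> M J \is a fin_num.
  move=> hM; rewrite ge0_fin_numE//; apply: le_lt_trans (radon_itv_lty (d + 1) hM c0).
  by apply: le_measure => //; rewrite inE.
have lim M : positive_radon M ->
    \int[M]_(t in I) plateau c d n.+1%:R^-1 t @[n --> \oo] --> fine (M J).
  move=> hM; have fM := radon_itv_lty (d + 1) hM c0.
  have -> : fine (M J) = \int[M]_(t in I) \1_J t.
    rewrite /Rintegral integral_indic//; congr (fine (M _)).
    by apply/esym/setIidl.
  apply: (bounded_cvg (C := 1)) => //.
  - by move=> n; apply: measurable_funTS; exact: test_function_measurable.
  - by move=> x _; exact: plateau_cvg.
  - move=> n x _; have /andP[b0 b1] := plateau_itv c d n.+1%:R^-1 x.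
    by rewrite ger0_norm.
have supp M n : \int[M]_(t in I) plateau c d n.+1%:R^-1 t = \int[M]_(t in `]0%R, +oo[) plateau c d n.+1%:R^-1 t.
  apply/esym/test_integral_support => // x; rewrite /= in_itv/= => /negP.
  rewrite negb_and -!ltNge => xcd; apply/max_idPl; rewrite ge_min; apply/orP; right.
  rewrite ge_min !pmulr_lle0 ?invr_gt0//.
  have le1 : n.+1%:R^-1 <= 1 :> R by rewrite invf_le1 ?ltr0Sn// ler1n.
  by move: le1; set e := _^-1 => le1; case/orP: xcd => h; apply/orP; [left|right]; lra.
have lP := lim _ hP; have lQ := lim _ hQ.
have E : (fun n => \int[P]_(t in I) plateau c d n.+1%:R^-1 t) =
         (fun n => \int[Q]_(t in I) plateau c d n.+1%:R^-1 t).
  by apply/funext => n; rewrite !supp; apply: PQ.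
rewrite E in lP.
rewrite -(fineK (fin _ hP)) -(fineK (fin _ hQ)); congr EFin.
exact: cvg_unique lP lQ.
Qed.

(** Plateaus determine the masses of half-open intervals, and these
    intervals generate the Borel sets. *)
Lemma radon_inj P Q (a b : R) (E : set T) : positive_radon P -> positive_radon Q -> 0 < a ->
  (forall phi, test_function phi ->
    \int[P]_(t in `]0%R, +oo[) phi t = \int[Q]_(t in `]0%R, +oo[) phi t) ->
  measurable E -> E `<=` `[a, b] -> P E = Q E.
Proof.
move=> hP hQ a0 PQ mE Eab.
have a20 : 0 < a / 2 by rewrite divr_gt0.
pose D : set T := `]a / 2, b]%classic.
have mD : measurable D by exact: measurable_itv.
have ED : E `<=` D.
  move=> x /Eab; rewrite /D /= !in_itv/= => /andP[ax ->]; rewrite andbT; lra.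
have r M : M E = mrestr M mD E by rewrite /mrestr setIidl.
rewrite (r _ P) (r _ Q).
apply: (@measure_unique _ R T (@ocitv R) (fun n => `]-(n%:R), n%:R]%classic)) => //.
- exact: ocitvI.
- by move=> i; exists (- i%:R, i%:R).
- rewrite -subTset => x _; exists (Num.truncn `|x|).+1 => //=; rewrite in_itv/=.
  have := truncnS_gt `|x|; rewrite ltr_norml => /andP[-> /ltW ->] //.
- move=> _ [[c d] _ <-] /=; rewrite /mrestr.
  have -> : `]c, d]%classic `&` D = `](Num.max c (a/2)), (Num.min d b)]%classic.
    apply/seteqP; split => x; rewrite /D /= !in_itv/= gt_max le_min.
      by case=> /andP[-> ->] /andP[-> ->].
    by move=> /andP[/andP[-> ->] /andP[-> ->]].
  by apply: radon_inj_itv => //; rewrite lt_max a20 orbT.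
- move=> n; rewrite /= /mrestr; apply: le_lt_trans (radon_itv_lty b hP a20).
  apply: le_measure; rewrite ?inE//; first by apply: measurableI => //; exact: measurable_itv.
  by move=> x [_]; rewrite /D /= !in_itv/= => /andP[/ltW -> ->].
Qed.
End radon_inj.

(** * Pairings of densities and equality of complex measures *)

Section density_pairing.
Context {R : realType}.
Local Notation T := (measurableTypeR R).
Local Notation leb := (@lebesgue_measure R).
Implicit Types (P Q : {measure set T -> \bar R}) (phi : R -> R) (mu nu : cmeasure R).

(** On the support of phi the difference P - Q is that of the measures with
    densities max (g, 0) and max (- g, 0). *)
Lemma density_balanced P Q (g : R -> R) phi (a b : R) : positive_radon P -> positive_radon Q ->
  0 < a -> leb.-integrable `[a, b] (EFin \o (g : T -> R)) ->
  (forall E, measurable E -> E `<=` `[a, b] ->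
    fine (P E) - fine (Q E) = \int[leb]_(x in E) g x) ->
  test_function phi -> (forall x, ~ `[a, b]%classic x -> phi x = 0) ->
  \int[P]_(t in `]0%R, +oo[) phi t - \int[Q]_(t in `]0%R, +oo[) phi t =
  \int[leb]_(t in `]0%R, +oo[) (phi t * g t).
Proof.
move=> hP hQ a0 ig PQ hphi supp.
pose A : set T := `[a, b]%classic.
have mA : measurable A by exact: measurable_itv.
have mphi := test_function_measurable hphi.
have [C hC] := test_function_bounded hphi.
have mg : measurable_fun A (g : T -> R).
  by move/integrableP : ig => [/measurable_EFinP].
pose gp : T -> R := (fun x : T => Num.max (g x) 0) \_ A.
pose gn : T -> R := (fun x : T => Num.max (- g x) 0) \_ A.
have mgp : measurable_fun setT gp.
  by apply/(measurable_restrictT _ mA); apply: measurable_maxr.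
have mgn : measurable_fun setT gn.
  by apply/(measurable_restrictT _ mA); apply: measurable_maxr => //; exact: measurableT_comp.
have gp0 x : 0 <= gp x by rewrite /gp patchE; case: ifP => // _; rewrite le_max lexx orbT.
have gn0 x : 0 <= gn x by rewrite /gn patchE; case: ifP => // _; rewrite le_max lexx orbT.
have gE x : A x -> gp x - gn x = g x.
  move=> Ax; rewrite /gp /gn !patchE mem_set//.
  by case: (leP (g x) 0) => gx; case: (leP (- g x) 0) => gx'; lra.
have gpg x : A x -> `|gp x| <= `|g x|.
  move=> Ax; rewrite ger0_norm// /gp !patchE mem_set//.
  by rewrite ge_max ler_norm normr_ge0.
have gng x : A x -> `|gn x| <= `|g x|.
  move=> Ax; rewrite ger0_norm// /gn !patchE mem_set//.
  by rewrite ge_max -normrN ler_norm normr_ge0.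
have pgp x : A x -> `|phi x * gp x| <= C * `|g x|.
  by move=> Ax; rewrite normrM; apply: ler_pM => //; exact: gpg.
have pgn x : A x -> `|phi x * gn x| <= C * `|g x|.
  by move=> Ax; rewrite normrM; apply: ler_pM => //; exact: gng.
have ing : leb.-integrable A (EFin \o (fun x : T => `|g x|)).
  exact: (integrable_norm ig).
have iCg : leb.-integrable A (EFin \o (fun x : T => C * `|g x|)) by exact: integrableZR.
have igp : leb.-integrable A (EFin \o gp).
  by apply: (integrable_domR mA _ ing gpg); exact: measurable_funTS.
have ign : leb.-integrable A (EFin \o gn).
  by apply: (integrable_domR mA _ ing gng); exact: measurable_funTS.
have iphigp : leb.-integrable A (EFin \o (fun x => phi x * gp x)).
  by apply: (integrable_domR mA _ iCg pgp); apply: measurable_funTS; exact: measurable_funM.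
have iphign : leb.-integrable A (EFin \o (fun x => phi x * gn x)).
  by apply: (integrable_domR mA _ iCg pgn); apply: measurable_funTS; exact: measurable_funM.
pose m3 : {measure set T -> \bar R} := density_measure leb mgp gp0.
pose m4 : {measure set T -> \bar R} := density_measure leb mgn gn0.
have dE (h : T -> R) (mh : measurable_fun setT h) (h0 : forall x, 0 <= h x) E : measurable E -> E `<=` A ->
    leb.-integrable A (EFin \o h) -> density_measure leb mh h0 E = (\int[leb]_(x in E) h x)%:E.
  move=> mE EA ih; rewrite /Rintegral fineK//.
  by apply: integrable_fin_num => //; exact: (integrableS mA mE EA ih).
have e3 E : measurable E -> E `<=` A -> m3 E = (\int[leb]_(x in E) gp x)%:E.
  by move=> mE EA; exact: dE.
have e4 E : measurable E -> E `<=` A -> m4 E = (\int[leb]_(x in E) gn x)%:E.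
  by move=> mE EA; exact: dE.
have f3 : (m3 A < +oo)%E by rewrite e3// ltry.
have f4 : (m4 A < +oo)%E by rewrite e4// ltry.
rewrite (test_integral_support P a0 supp) (test_integral_support Q a0 supp).
rewrite (@balanced_integral _ T R P Q m3 m4 A mA (radon_itv_lty b hP a0) (radon_itv_lty b hQ a0) f3 f4 phi C);
  last 3 first.
- move=> E mE EA; rewrite PQ// e3// e4//=.
  rewrite -RintegralB//; [|exact: (integrableS mA mE EA)|exact: (integrableS mA mE EA)].
  by apply: eq_Rintegral => x; rewrite inE => /EA /gE.
- exact: measurable_funTS.
- by move=> x _; exact: hC.
rewrite [X in X - _](Rintegral_density leb mgp gp0 mA mphi) [X in _ - X](Rintegral_density leb mgn gn0 mA mphi).
rewrite -RintegralB//.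
transitivity (\int[leb]_(x in A) (phi x * g x)).
  by apply: eq_Rintegral => x; rewrite inE => /gE <-; rewrite mulrBr.
apply/esym; apply: (@test_integral_support R leb (fun x => phi x * g x) a b a0).
by move=> x /supp ->; rewrite mul0r.
Qed.

Lemma has_density_pairing mu (f : R -> R[i]) phi : has_density mu f -> test_function phi ->
  pairing mu phi = cintegral leb `]0, +oo[ (fun r => (phi r)%:C * f r).
Proof.
move=> [[[p1 p2 p3 p4] _] hd] hphi; have [_ [a [b [a0 supp]]]] := hphi.
have [[ir ii] hE] := hd a b a0.
rewrite pairingE; apply: cplxP => /=.
  rewrite (density_balanced p1 p2 a0 ir _ hphi supp); last first.
    by move=> E mE EA; have := congr1 (@complex.Re R) (hE E mE EA).
  by apply: eq_Rintegral => x _; rewrite !cplxE /=; ring.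
rewrite (density_balanced p3 p4 a0 ii _ hphi supp); last first.
  by move=> E mE EA; have := congr1 (@complex.Im R) (hE E mE EA).
by apply: eq_Rintegral => x _; rewrite !cplxE /=; ring.
Qed.

Lemma eq_cmeasure_pairing mu nu phi : parts_radon mu -> parts_radon nu -> eq_cmeasure mu nu ->
  test_function phi -> pairing mu phi = pairing nu phi.
Proof.
move=> [p1 p2 p3 p4] [q1 q2 q3 q4] mn hphi; have [_ [a [b [a0 supp]]]] := hphi.
have [C hC] := test_function_bounded hphi.
have mA : measurable (`[a, b]%classic : set T) by exact: measurable_itv.
have mphi : measurable_fun (`[a, b]%classic : set T) (phi : T -> R).
  by apply: measurable_funTS; exact: test_function_measurable.
have rc E : E `<=` (`[a, b]%classic : set T) -> rel_compact E by move=> h; exists a, b.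
have sup m := test_integral_support m a0 supp.
rewrite !pairingE; apply: cplxP => /=; rewrite !sup.
  apply: (balanced_integral mA _ _ _ _ (C := C)) => //; [exact: radon_itv_lty|exact: radon_itv_lty
    |exact: radon_itv_lty|exact: radon_itv_lty|].
  by move=> E mE EA; have := congr1 (@complex.Re R) (mn E mE (rc _ EA)).
apply: (balanced_integral mA _ _ _ _ (C := C)) => //; [exact: radon_itv_lty|exact: radon_itv_lty
    |exact: radon_itv_lty|exact: radon_itv_lty|].
by move=> E mE EA; have := congr1 (@complex.Im R) (mn E mE (rc _ EA)).
Qed.

Lemma test_integrable P phi : positive_radon P -> test_function phi ->
  P.-integrable `]0, +oo[ (EFin \o (phi : T -> R)).
Proof.
move=> hP hphi; have [_ [a [b [a0 supp]]]] := hphi.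
have [C hC] := test_function_bounded hphi.
have mA : measurable (`[a, b]%classic : set T) by exact: measurable_itv.
have mpos : measurable (`]0, +oo[%classic : set T) by exact: measurable_itv.
have mphi := test_function_measurable hphi.
have bf : [bounded phi x | x in (`[a, b]%classic : set T)].
  by exists C; split => [|u Cu x Ax]; [exact: num_real|exact: le_trans (hC _) (ltW Cu)].
have i1 := measurable_bounded_integrable mA (radon_itv_lty b hP a0) (measurable_funTS mphi) bf.
apply: (@integrableS _ _ _ P setT); [exact: measurableT|exact: mpos|exact: subsetT|].
have := (integrable_mkcond _ mA).1 i1.
congr (_.-integrable _ _); apply/funext => x; rewrite patchE.
by case: (boolP (x \in _)) => //; rewrite notin_setE => /supp /= ->.
Qed.

Lemma positive_radon_add P Q : positive_radon P -> positive_radon Q ->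
  positive_radon (measure_add P Q).
Proof.
move=> [p0 p] [q0 q]; split; first by rewrite [LHS](measure_addE P Q _) p0 q0 adde0.
by move=> a b a0; rewrite [X in (X < _)%E](measure_addE P Q _) lte_add_pinfty ?p ?q.
Qed.

Lemma Rintegral_measure_add P Q phi : positive_radon P -> positive_radon Q -> test_function phi ->
  \int[measure_add P Q]_(t in `]0%R, +oo[) phi t =
  \int[P]_(t in `]0%R, +oo[) phi t + \int[Q]_(t in `]0%R, +oo[) phi t.
Proof.
move=> hP hQ hphi.
have mpos : measurable (`]0, +oo[%classic : set T) by exact: measurable_itv.
have i1 := test_integrable hP hphi; have i2 := test_integrable hQ hphi.
rewrite /Rintegral -fineD; [|exact: (integrable_fin_num mpos i1)|exact: (integrable_fin_num mpos i2)].
congr fine; exact: (integral_measure_add mpos i1 i2).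
Qed.

(** The parts of the two measures may differ by a common summand, so the
    comparison is between re_pos mu + re_neg nu and re_pos nu + re_neg mu,
    and likewise for the imaginary parts. *)
Lemma pairing_inj mu nu : parts_radon mu -> parts_radon nu ->
  (forall phi, test_function phi -> pairing mu phi = pairing nu phi) -> eq_cmeasure mu nu.
Proof.
move=> [p1 p2 p3 p4] [q1 q2 q3 q4] mn E mE [a [b [a0 EA]]].
have fin P : positive_radon P -> P E \is a fin_num.
  move=> hP; rewrite ge0_fin_numE//; apply: le_lt_trans (radon_itv_lty b hP a0).
  by apply: le_measure; rewrite ?inE//; exact: measurable_itv.
have main P1 P2 Q1 Q2 : positive_radon P1 -> positive_radon P2 -> positive_radon Q1 -> positive_radon Q2 ->
   (forall phi, test_function phi ->
    \int[P1]_(t in `]0%R, +oo[) phi t - \int[P2]_(t in `]0%R, +oo[) phi t =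
    \int[Q1]_(t in `]0%R, +oo[) phi t - \int[Q2]_(t in `]0%R, +oo[) phi t) ->
   fine (P1 E) - fine (P2 E) = fine (Q1 E) - fine (Q2 E).
  move=> h1 h2 k1 k2 h.
  have : (P1 E + Q2 E = Q1 E + P2 E)%E.
    rewrite -[LHS](measure_addE P1 Q2 E) -[RHS](measure_addE Q1 P2 E).
    apply: (radon_inj (positive_radon_add h1 k2) (positive_radon_add k1 h2) a0 _ mE EA).
    move=> phi hphi.
    rewrite (Rintegral_measure_add h1 k2 hphi) (Rintegral_measure_add k1 h2 hphi).
    have := h _ hphi; lra.
  rewrite -(fineK (fin _ h1)) -(fineK (fin _ h2)) -(fineK (fin _ k1)) -(fineK (fin _ k2)).
  by rewrite -!EFinD /= => -[]; lra.
apply: cplxP; apply: main => // phi hphi; have := mn _ hphi; rewrite !pairingE => H.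
  by have := congr1 (@complex.Re R) H.
by have := congr1 (@complex.Im R) H.
Qed.

Lemma normc_le_nrm1 (z : R[i]) : `|z| <= (nrm1 z)%:C.
Proof.
case: z => x y; rewrite normc_def lecR /nrm1 /=.
rewrite -[leRHS]ger0_norm ?addr_ge0// -sqrtr_sqr ler_wsqrtr//.
have := mulr_ge0 (normr_ge0 x) (normr_ge0 y).
rewrite -(real_normK (num_real x)) -(real_normK (num_real y)); nra.
Qed.

Lemma cvg_cplx (u : nat -> R[i]) (l : R[i]) :
  ((u n : R[i]^o) @[n --> \oo] --> (l : R[i]^o)) <->
  ((complex.Re (u n) @[n --> \oo] --> complex.Re l) /\
   (complex.Im (u n) @[n --> \oo] --> complex.Im l)).
Proof.
split.
  move=> /cvgrPdist_lt h.
  have hr (e : R) : 0 < e -> \forall n \near \oo, `|l - u n| < e%:C.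
    by move=> e0; apply: h; rewrite ltcR.
  split; apply/cvgrPdist_lt => e e0; apply: filterS (hr _ e0) => n hn.
    rewrite -ltcR; apply: le_lt_trans hn; rewrite -cReN -cReD.
    exact: normc_ge_Re.
  rewrite -ltcR; apply: le_lt_trans hn; rewrite -cImN -cImD.
  by case: (l - u n) => x y; rewrite normc_def lecR /= -sqrtr_sqr ler_wsqrtr// lerDr sqr_ge0.
move=> [/cvgrPdist_lt hr /cvgrPdist_lt hi]; apply/cvgrPdist_lt => e.
case: e => e e'; rewrite ltcE /= => /andP[/eqP -> e0].
have e20 : 0 < e / 2 by rewrite divr_gt0.
near=> n; rewrite -[e +i* 0]/(e%:C); apply: le_lt_trans (normc_le_nrm1 _) _; rewrite ltcR /nrm1 !cplxE.
have h1 : `|complex.Re l - complex.Re (u n)| < e / 2 by near: n; exact: hr.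
have h2 : `|complex.Im l - complex.Im (u n)| < e / 2 by near: n; exact: hi.
lra.
Unshelve. all: by end_near. Qed.

End density_pairing.

(** * Diagonal extraction and Riemann sums *)

Section diagonal.
Context {R : realType}.

Lemma increasing_seq_ge (f : nat -> nat) n : increasing_seq f -> (n <= f n)%N.
Proof.
move=> /increasing_seqP h; elim: n => // n IH.
exact: leq_ltn_trans IH (h n).
Qed.

Lemma increasing_seq_cvg (f : nat -> nat) : increasing_seq f -> f n @[n --> \oo] --> \oo.
Proof.
move=> h; apply/cvgnyPge => A; exists A => // n /= An.
exact: leq_trans An (increasing_seq_ge n h).
Qed.

Lemma increasing_seq_comp (f g : nat -> nat) : increasing_seq f -> increasing_seq g ->
  increasing_seq (f \o g).
Proof. by move=> hf hg m n; exact: etrans (hf _ _) (hg _ _). Qed.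

(** Nested extractions by the Bolzano-Weierstrass theorem: the diagonal is
    eventually a subsequence of each of them. *)
Lemma diagonal_extraction (u : nat -> nat -> R) : (forall k, bounded_fun (u k)) ->
  exists2 f : nat -> nat, increasing_seq f & forall k, cvgn (u k \o f).
Proof.
move=> bu.
have step (k : nat) (g : nat -> nat) : {h | increasing_seq h /\ cvgn (u k \o (g \o h))}.
  apply: cid; have [|h ih ch] := @bolzano_weierstrass R (u k \o g); last by exists h.
  have [M [Mr hM]] := bu k.
  by exists M; split => // x Mx n _; exact: hM.
pose h k g := projT1 (step k g).
have hI k g : increasing_seq (h k g) by have [] := projT2 (step k g).
have hC k g : cvgn (u k \o (g \o h k g)) by have [] := projT2 (step k g).
pose G := fix G k := if k is k'.+1 then G k' \o h k (G k') else h 0%N id.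
have GS k : G k.+1 = G k \o h k.+1 (G k) by [].
have GI k : increasing_seq (G k).
  by elim: k => [|k IH]; [exact: hI|rewrite GS; apply: increasing_seq_comp => //; exact: hI].
have GC k : cvgn (u k \o G k) by case: k => [|k]; [exact: (hC 0%N id)|exact: hC].
have fact k n : exists2 p, (n <= p)%N & G (k + n)%N (k + n)%N = G k p.
  have gen j : exists2 q : nat -> nat, (forall i, i <= q i)%N & G (k + j)%N = G k \o q.
    elim: j => [|j [q hq Gq]]; first by exists id; rewrite ?addn0.
    exists (q \o h (k + j).+1 (G (k + j)%N)).
      by move=> i /=; apply: leq_trans (hq _); exact: increasing_seq_ge.
    by rewrite addnS GS Gq.
  by have [q hq ->] := gen n; exists (q (k + n)%N) => //; apply: leq_trans (hq _); exact: leq_addl.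
exists (fun n => G n n).
  apply/increasing_seqP => n; rewrite GS /=.
  have /increasing_seqP _ := GI n.
  have : (n < h n.+1 (G n) n.+1)%N by exact: increasing_seq_ge.
  have E : (G n (h n.+1 (G n) n.+1) <= G n n)%N = (h n.+1 (G n) n.+1 <= n)%N := GI n _ _.
  by move=> lt; change (G n n < G n (h n.+1 (G n) n.+1))%N; rewrite ltnNge E -ltnNge.
move=> k; apply/cvg_ex; have /cvg_ex[l hl] := GC k; exists l.
apply/cvgrPdist_lt => e e0.
have /cvgrPdist_lt/(_ _ e0)[N _ hN] := hl.
exists (k + N)%N => // n /= kn.
have kn' : n = (k + (n - k))%N by rewrite subnKC// (leq_trans _ kn)// leq_addr.
have [p pn E] := fact k (n - k)%N.
rewrite -kn' in E; rewrite E; apply: (hN p) => /=; apply: leq_trans pn.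
by rewrite leq_subRL ?(leq_trans _ kn)// leq_addr.
Qed.

(** Two sequences at vanishing distance whose images stay apart would be
    bounded, since one of the two points lies in the support, and would have
    a common limit point. *)
Lemma test_unif_continuous (phi : R -> R) e : test_function phi -> 0 < e ->
  exists2 d, 0 < d & forall x y, `|x - y| <= d -> `|phi x - phi y| <= e.
Proof.
move=> [c [a [b [a0 supp]]]] e0; apply: contrapT => hn.
have H n : {xy : R * R | `|xy.1 - xy.2| <= n.+1%:R^-1 /\ e < `|phi xy.1 - phi xy.2|}.
  apply: cid; apply: contrapT => hh; apply: hn; exists n.+1%:R^-1; first by rewrite invr_gt0.
  by move=> x y xy; rewrite leNgt; apply/negP => he; apply: hh; exists (x, y).
pose x n := (projT1 (H n)).1; pose y n := (projT1 (H n)).2.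
have xy n : `|x n - y n| <= n.+1%:R^-1 by have [] := projT2 (H n).
have pe n : e < `|phi (x n) - phi (y n)| by have [] := projT2 (H n).
have xb : bounded_fun x.
  exists (`|a| + `|b| + 1); split; first exact: num_real.
  move=> M hM n _ /=.
  have n1 : n.+1%:R^-1 <= 1 :> R by rewrite invf_le1 ?ltr0Sn// ler1n.
  have xy1 := le_trans (xy n) n1.
  have [||hh] : [\/ a <= x n <= b, a <= y n <= b | phi (x n) - phi (y n) = 0].
  - have [h|h] := boolP (a <= x n <= b); first by apply: Or31.
    have [h'|h'] := boolP (a <= y n <= b); first by apply: Or32.
    by apply: Or33; rewrite !supp ?subrr//; apply/negP; rewrite in_itv.
  - move=> /andP[ax xb'].
    have := ler_norm a; have := ler_norm b; have := ler_norm (- a); have := ler_norm (- b); rewrite !normrN => ????.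
    by apply: le_trans (ltW hM); rewrite ler_norml; apply/andP; split; have := normr_ge0 a; have := normr_ge0 b; lra.
  - move=> /andP[ay yb'].
    have := ler_norm a; have := ler_norm b; have := ler_norm (- a); have := ler_norm (- b); rewrite !normrN => ????.
    move: xy1; rewrite ler_norml => /andP[x1 x2].
    by apply: le_trans (ltW hM); rewrite ler_norml; apply/andP; split; have := normr_ge0 a; have := normr_ge0 b; lra.
  - by have := pe n; rewrite hh normr0 ltNge (ltW e0).
have [f fI /cvg_ex[l xl]] := bolzano_weierstrass xb.
have sm : (x (f n) - y (f n)) @[n --> \oo] --> (0 : R).
  apply/cvgr0Pnorm_le => d d0; have [N _ hN] := near_infty_natSinv_lt (PosNum d0).
  exists N => // n /= Nn; apply: le_trans (xy _) (ltW (hN _ _)) => /=.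
  exact: leq_trans Nn (increasing_seq_ge n fI).
have yl : y (f n) @[n --> \oo] --> l.
  have -> : (fun n => y (f n)) = (fun n => x (f n) - (x (f n) - y (f n))).
    by apply/funext => n; ring.
  by rewrite -[l]subr0; apply: cvgB.
have px : phi (x (f n)) @[n --> \oo] --> phi l by apply: (cvg_comp _ _ xl); exact: c.
have py : phi (y (f n)) @[n --> \oo] --> phi l by apply: (cvg_comp _ _ yl); exact: c.
have pl : phi (x (f n)) - phi (y (f n)) @[n --> \oo] --> (0 : R).
  by rewrite -(subrr (phi l)); apply: cvgB.
have [N _ hN] := (cvgr0Pnorm_le _).1 pl e e0.
by have := hN N (leqnn _); rewrite /= leNgt pe.
Qed.

End diagonal.

Section riemann.
Context {R : realType}.
Local Notation T := (measurableTypeR R).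
Implicit Types (m : {measure set T -> \bar R}) (phi : R -> R).

Lemma measure_itv_lty m (a b : R) : positive_radon m -> 0 < a -> (m `]a, b]%classic < +oo)%E.
Proof.
move=> hm a0; apply: le_lt_trans (radon_itv_lty b hm a0).
apply: le_measure; rewrite ?inE; [exact: measurable_itv|exact: measurable_itv|].
by move=> x; rewrite /= !in_itv/= => /andP[/ltW -> ->].
Qed.

Lemma itv_oc_setU (a b c : R) : a <= b -> b <= c ->
  `]a, c]%classic = `]a, b]%classic `|` `]b, c]%classic :> set R.
Proof.
move=> ab bc; apply/seteqP; split => x; rewrite /= !in_itv/=.
  by move=> /andP[ax xc]; case: (leP x b) => xb; [left; rewrite ax|right].
by case=> /andP[h1 h2]; [rewrite h1 (le_trans h2)|rewrite h2 (le_lt_trans ab)].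
Qed.

Lemma fine_itv_add m (a b c : R) : positive_radon m -> 0 < a -> a <= b -> b <= c ->
  fine (m `]a, c]%classic) = fine (m `]a, b]%classic) + fine (m `]b, c]%classic).
Proof.
move=> hm a0 ab bc; have b0 := lt_le_trans a0 ab.
have f1 := measure_itv_lty b hm a0; have f2 := measure_itv_lty c hm b0.
rewrite -fineD ?ge0_fin_numE//; congr fine.
have -> : `]a, c]%classic = `]a, b]%classic `|` `]b, c]%classic :> set R.
  exact: itv_oc_setU.
rewrite measureU//.
apply/seteqP; split => // x []; rewrite /= !in_itv/= => /andP[_ xb] /andP[bx _].
by move: (lt_le_trans bx xb); rewrite ltxx.
Qed.

Lemma riemann_sum m phi (e : R) (q : nat -> R) N : positive_radon m -> test_function phi ->
  0 <= e -> (forall i, 0 < q i) -> (forall i, q i <= q i.+1) ->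
  (forall i x, q i < x <= q i.+1 -> `|phi x - phi (q i)| <= e) ->
  `|\int[m]_(x in `](q 0%N), (q N)]) phi x - \sum_(i < N) phi (q i) * fine (m `](q i), (q i.+1)]%classic)|
   <= e * fine (m `](q 0%N), (q N)]%classic).
Proof.
move=> hm hphi e0 q0 qS hq.
have [C hC] := test_function_bounded hphi.
have mI (a b : R) : measurable (`]a, b]%classic : set T) by exact: measurable_itv.
have ii a b : 0 < a -> m.-integrable `]a, b] (EFin \o (phi : T -> R)).
  move=> a0; apply: measurable_bounded_integrable => //; first exact: measure_itv_lty.
    by apply: measurable_funTS; exact: test_function_measurable.
  by exists C; split => [|u Cu x Ax]; [exact: num_real|exact: le_trans (hC _) (ltW Cu)].
have q0N n : q 0%N <= q n by elim: n => // n /le_trans; exact.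
elim: N => [|N IH].
  rewrite big_ord0 subr0 set_itv_ge ?bnd_simp ?ltxx//.
  by rewrite /Rintegral integral_set0 measure0 /= normr0 mulr0.
rewrite big_ord_recr /=.
have -> : \int[m]_(x in `](q 0%N), (q N.+1)]) phi x =
   \int[m]_(x in `](q 0%N), (q N)]) phi x + \int[m]_(x in `](q N), (q N.+1)]) phi x.
  have E : `](q 0%N), (q N.+1)]%classic = `](q 0%N), (q N)]%classic `|` `](q N), (q N.+1)]%classic :> set R.
    exact: itv_oc_setU.
  rewrite E Rintegral_setU//; first by rewrite -E; exact: ii.
  apply/disj_setPS => x []; rewrite /= !in_itv/= => /andP[_ xb] /andP[bx _].
  by move: (lt_le_trans bx xb); rewrite ltxx.
rewrite (fine_itv_add hm (q0 0%N) (q0N N) (qS N)) mulrDr.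
have h2 : `|\int[m]_(x in `](q N), (q N.+1)]) phi x - phi (q N) * fine (m `](q N), (q N.+1)]%classic)| <=
   e * fine (m `](q N), (q N.+1)]%classic).
  set A : set T := `](q N), (q N.+1)]%classic.
  have fA : (m A < +oo)%E by exact: measure_itv_lty.
  have ic (c : R) : m.-integrable A (EFin \o (cst c : T -> R)).
    apply: measurable_bounded_integrable => //; first exact: mI.
    by exists `|c|; split => [|u Cu x _ /=]; [exact: num_real|exact: ltW].
  have cE (c : R) : c * fine (m A) = \int[m]_(_ in A) c := esym (Rintegral_cst m (mI _ _) c).
  rewrite !cE.
  rewrite -(RintegralB (mI _ _) (ii _ _ (q0 N)) (ic _)).
  have iB := integrableBR (mI _ _) (ii _ (q N.+1) (q0 N)) (ic (phi (q N))).
  apply: le_trans (le_normr_Rintegral (mI _ _) iB) _.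
  apply: (le_Rintegral (mI _ _) (integrable_norm iB) (ic e)).
  by move=> x; rewrite /A /= in_itv/= => /hq.
apply: le_trans (lerD IH h2); apply: le_trans (ler_normD _ _).
rewrite le_eqVlt; apply/orP; left; apply/eqP; congr `|_|; ring.
Qed.

(** G and P stand for two versions of a distribution function, interlaced at
    the nodes. Summation by parts moves P - G onto the increments of phi,
    and by interlacing the sum of the P - G is at most the variation of G. *)
Lemma abel_bound (e : R) (phi_ G P : nat -> R) N : 0 <= e ->
  (forall i, G i <= P i <= G i.+1) -> (forall i, `|phi_ i.+1 - phi_ i| <= e) ->
  `|\sum_(i < N) phi_ i * (P i.+1 - P i) - \sum_(i < N) phi_ i * (G i.+1 - G i)
    - phi_ N * (P N - G N) + phi_ 0%N * (P 0%N - G 0%N)| <= e * (G N.+1 - G 1%N).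
Proof.
move=> e0 hG hphi; elim: N => [|N IH].
  by rewrite !big_ord0 subrr sub0r addNr normr0 subrr mulr0.
rewrite !big_ord_recr /=.
have -> : e * (G N.+2 - G 1%N) = e * (G N.+1 - G 1%N) + e * (G N.+2 - G N.+1) by ring.
have h2 : `|- (phi_ N.+1 - phi_ N) * (P N.+1 - G N.+1)| <= e * (G N.+2 - G N.+1).
  have /andP[h1 h2] := hG N.+1.
  by rewrite normrM normrN ler_pM// ger0_norm ?subr_ge0// lerB.
apply: le_trans (lerD IH h2); apply: le_trans (ler_normD _ _).
rewrite le_eqVlt; apply/orP; left; apply/eqP; congr `|_|; ring.
Qed.
End riemann.

(** * Helly's selection theorem *)

Section helly_tools.
Context {R : realType}.
Local Notation T := (measurableTypeR R).

Lemma test_integral_on (m : {measure set T -> \bar R}) (phi : R -> R) (D : set T) :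
  D `<=` `]0, +oo[ -> (forall x, ~ D x -> phi x = 0) ->
  \int[m]_(t in `]0%R, +oo[) phi t = \int[m]_(t in D) phi t.
Proof.
move=> D0 h; rewrite [LHS]Rintegral_mkcond [RHS]Rintegral_mkcond.
apply: eq_Rintegral => t _; rewrite !patchE.
have [tD|tD] := boolP (t \in D).
  by rewrite mem_set//; apply: D0; exact: set_mem.
by rewrite h ?if_same//; move: tD; rewrite notin_setE.
Qed.

Lemma cvg_sum_ord (u : nat -> nat -> R) (l : nat -> R) N :
  (forall i, u i n @[n --> \oo] --> l i) ->
  \sum_(i < N) u i n @[n --> \oo] --> \sum_(i < N) l i.
Proof.
move=> ul; elim: N => [|N IH].
  by rewrite big_ord0; under eq_fun do rewrite big_ord0; exact: cvg_cst.
rewrite big_ord_recr; under eq_fun do rewrite big_ord_recr.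
by apply: cvgD; [exact: IH|exact: ul].
Qed.

End helly_tools.

Section helly.
Context {R : realType}.
Local Notation T := (measurableTypeR R).
Variable m : nat -> {measure set T -> \bar R}.
Hypotheses (hm : forall n, positive_radon (m n))
 (hb : forall a b : R, 0 < a -> exists C : R, forall n, (m n `[a, b]%classic <= C%:E)%E).

(** The distribution function is based at 1 because the mass near 0 may be
    infinite. *)
Let F (n : nat) (x : R) : R := fine (m n `]1, x]%classic) - fine (m n `]x, 1]%classic).

Let empty_itv n (x y : R) : y <= x -> fine (m n `]x, y]%classic) = 0.
Proof. by move=> yx; rewrite set_itv_ge ?measure0// bnd_simp -leNgt. Qed.

Let F_itv n a b : 0 < a -> a <= b -> fine (m n `]a, b]%classic) = F n b - F n a.
Proof.
move=> a0 ab; have h := fine_itv_add (hm n).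
have [b1|b1] := leP b 1.
  have a1 := le_trans ab b1.
  rewrite /F (empty_itv n b1) (empty_itv n a1) (h a b 1 a0 ab b1); ring.
have [a1|a1] := leP a 1.
  rewrite /F (empty_itv n a1) (empty_itv n (ltW b1)) (h a 1 b a0 a1 (ltW b1)); ring.
by rewrite /F (empty_itv n (ltW b1)) (empty_itv n (ltW a1)) (h 1 a b ltr01 (ltW a1) ab); ring.
Qed.

Let fine_bound a b : 0 < a -> exists C : R, 0 <= C /\
  forall n c d, a <= c -> d <= b -> fine (m n `]c, d]%classic) <= C.
Proof.
move=> a0; have [C hC] := hb b a0.
have C0 : 0 <= C by rewrite -lee_fin; apply: le_trans (hC 0%N).
exists C; split => // n c d ac db.
have c0 := lt_le_trans a0 ac.
rewrite -lee_fin fineK; last by rewrite ge0_fin_numE//; exact: measure_itv_lty.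
apply: le_trans (hC n); apply: le_measure; rewrite ?inE; [exact: measurable_itv|exact: measurable_itv|].
move=> x; rewrite /= !in_itv/= => /andP[cx xd].
by rewrite (le_trans ac (ltW cx)) (le_trans xd).
Qed.

Let F_bounded x : 0 < x -> exists C : R, forall n, `|F n x| <= C.
Proof.
move=> x0; have [C1 [_ h1]] := fine_bound x (@ltr01 R); have [C2 [_ h2]] := fine_bound 1 x0.
exists (C1 + C2) => n; apply: le_trans (ler_normB _ _) _.
by rewrite !ger0_norm ?fine_ge0// lerD ?h1 ?h2.
Qed.

Lemma distribution_extraction : exists2 f, increasing_seq f &
  forall q : rat, 0 < q -> cvgn (fun n => F (f n) (ratr q)).
Proof.
pose dec (k : nat) : option rat := unpickle k.
pose u k n := if dec k is Some q then if 0 < q then F n (ratr q) else 0 else 0.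
have [|f fI fC] := @diagonal_extraction R u.
  move=> k; rewrite /u; case: (dec k) => [q|]; last first.
    by exists 0; split => [|M M0 n _ /=]; [exact: num_real|rewrite normr0 ltW].
  case: (boolP (0 < q)) => q0; last by exists 0; split => [|M M0 n _ /=]; [exact: num_real|rewrite normr0 ltW].
  have [|C hC] := @F_bounded (ratr q); first by rewrite ltr0q.
  by exists C; split => [|M M0 n _ /=]; [exact: num_real|exact: le_trans (hC n) (ltW M0)].
exists f; first exact: fI.
move=> q q0; have := fC (pickle q).
by rewrite /u /comp /dec pickleK q0.
Qed.

Variable f : nat -> nat.
Hypothesis (hf : forall q : rat, 0 < q -> cvgn (fun n => F (f n) (ratr q))).

Let G (q : rat) : R := lim (F (f n) (ratr q) @[n --> \oo]).
Let GC q : 0 < q -> F (f n) (ratr q) @[n --> \oo] --> G q. Proof. exact: hf. Qed.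
Let G_mono q q' : 0 < q -> q <= q' -> G q <= G q'.
Proof.
move=> q0 qq; apply: (ler_cvg_to (GC q0) (GC (lt_le_trans q0 qq))).
apply: nearW => n; rewrite -subr_ge0 -F_itv ?ltr0q ?ler_rat//.
Qed.

Let above (x : R) := [set G q | q in [set q : rat | x < ratr q]].
(** The limits are known at rational points only; the infimum over larger
    rationals makes them a right-continuous function. *)
Let P (x : R) : R := inf (above x).

Let above_lb q x : 0 < q -> ratr q <= x -> lbound (above x) (G q).
Proof.
by move=> q0 qx _ [p /= xp <-]; apply: G_mono => //; rewrite -(ler_rat R) (le_trans qx (ltW xp)).
Qed.

Let above_inf x : 0 < x -> has_inf (above x).
Proof.
move=> x0; split.
  have [|q] := @rat_in_itvoo R x (x + 1); first by rewrite ltrDl.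
  by rewrite in_itv/= => /andP[xq _]; exists (G q); exists q.
have [q] := rat_in_itvoo x0; rewrite in_itv/= ltr0q => /andP[q0 qx].
by exists (G q); apply: above_lb => //; exact: ltW.
Qed.

Let P_le x q : 0 < x -> x < ratr q -> P x <= G q.
Proof. by move=> x0 xq; apply: (ge_inf (above_inf x0).2); exists q. Qed.

Let le_P q x : 0 < q -> ratr q <= x -> G q <= P x.
Proof.
move=> q0 qx; apply: lb_le_inf; last exact: above_lb.
by have [] := @above_inf x; rewrite ?(lt_le_trans _ qx) ?ltr0q.
Qed.

Let P_mono x y : 0 < x -> x <= y -> P x <= P y.
Proof.
move=> x0 xy; apply: lb_le_inf; first by have [] := above_inf (lt_le_trans x0 xy).
by move=> _ [q /= yq <-]; apply: P_le => //; exact: le_lt_trans yq.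
Qed.

Let cum (y : R) : R := P (expR y).

Let cum_nd : {homo cum : x y / x <= y}.
Proof. by move=> x y xy; apply: P_mono; rewrite ?expR_gt0 ?ler_expR. Qed.

Let cum_rc : right_continuous cum.
Proof.
move=> x; apply/cvgrPdist_lt => e e0.
have [_ [q xq <-] qe] := inf_adherent e0 (above_inf (expR_gt0 x)).
have xq' : x < ln (ratr q).
  rewrite -ltr_expR lnK// posrE; exact: lt_trans (expR_gt0 x) xq.
near=> y.
have xy : x < y by near: y; exact: nbhs_right_gt.
have yq : y < ln (ratr q) by near: y; exact: nbhs_right_lt.
have h1 : cum x <= cum y by apply: cum_nd; exact: ltW.
have h2 : cum y <= G q.
  apply: P_le; first exact: expR_gt0.
  by rewrite -[ratr q]lnK ?ltr_expR// posrE; exact: lt_trans (expR_gt0 x) xq.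
rewrite distrC ger0_norm ?subr_ge0// ltrBlDl; exact: le_lt_trans qe.
Unshelve. all: by end_near. Qed.

Let ccum : cumulative R R := HB.pack cum (isCumulative.Build R _ R cum cum_nd cum_rc).

Let mexp : measurable_fun setT (@expR R : T -> T). Proof. exact: measurable_expR. Qed.

Let nu : {measure set T -> \bar R} :=
  measure_function_pushforward__canonical__measure_function_Measure
    (lebesgue_stieltjes_measure ccum) mexp.

Let nu_itv a b : 0 < a -> a <= b -> nu `]a, b]%classic = (P b - P a)%:E.
Proof.
move=> a0 ab; have b0 := lt_le_trans a0 ab.
rewrite /nu /= /pushforward.
have -> : @expR R @^-1` `]a, b]%classic = `]ln a, ln b]%classic.
  apply/seteqP; split => x; rewrite /= !in_itv/=.
    by move=> /andP[ax xb]; rewrite -ltr_expR -(ler_expR x) !lnK ?posrE// ax xb.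
  by rewrite -ltr_expR -(ler_expR x) !lnK ?posrE.
have -> : lebesgue_stieltjes_measure ccum `]ln a, ln b]%classic = wlength ccum `]ln a, ln b]%classic.
  rewrite /lebesgue_stieltjes_measure /measure_extension.
  by rewrite measurable_mu_extE//; exact: is_ocitv.
by rewrite wlength_itv_bnd ?ler_ln ?posrE// /= /cum !lnK ?posrE.
Qed.

Let nu_radon : positive_radon nu.
Proof.
split.
  rewrite /nu /= /pushforward (_ : _ @^-1` _ = set0) ?measure0//.
  by apply/seteqP; split => // x; rewrite /= in_itv/= leNgt expR_gt0.
move=> a b a0; have a20 : 0 < a / 2 by rewrite divr_gt0.
have [ab|ba] := leP a b; last by rewrite set_itv_ge ?measure0 ?ltry// bnd_simp -ltNge.
apply: (@le_lt_trans _ _ (nu `](a/2), b]%classic)).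
  apply: le_measure; rewrite ?inE; [exact: measurable_itv|exact: measurable_itv|].
  move=> x; rewrite /= !in_itv/= => /andP[ax ->]; rewrite andbT; lra.
by rewrite nu_itv ?ltry//; lra.
Qed.

(** At a rational node P and G may differ by the mass of an atom of the
    limit, but by Abel summation this changes a Riemann sum by little. *)
Lemma distribution_limit : exists2 nu : {measure set T -> \bar R}, positive_radon nu &
  forall phi, test_function phi ->
    \int[m (f n)]_(t in `]0%R, +oo[) phi t @[n --> \oo] --> \int[nu]_(t in `]0%R, +oo[) phi t.
Proof.
exists nu; first exact: nu_radon.
move=> phi hphi; have [_ [a [b [a0 supp]]]] := hphi.
have [qs] := rat_in_itvoo a0; rewrite in_itv/= ltr0q => /andP[qs0 qsa].
pose N0 := (Num.truncn `|b|).+1.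
have bN0 : b < N0%:R by apply: le_lt_trans (ler_norm b) (truncnS_gt _).
(* Partitions of step 1 / (j + 1) from a rational point below the support;
   after N0 (j + 1) steps they have passed it. *)
pose x_ j i : rat := qs + i%:R / j.+1%:R.
have x_0 j i : 0 < x_ j i by rewrite /x_ ltr_wpDr// divr_ge0.
have x_S j i : x_ j i <= x_ j i.+1.
  by rewrite /x_ lerD2l ler_pM2r ?invr_gt0 ?ltr0n// ler_nat.
have x_d j i : ratr (x_ j i.+1) - ratr (x_ j i) = j.+1%:R^-1 :> R.
  rewrite -raddfB /= /x_ -natr1; set u := j.+1%:R.
  have -> : qs + (i%:R + 1) / u - (qs + i%:R / u) = u^-1 by ring.
  by rewrite fmorphV /= ratr_nat.
have q0R : 0 < ratr qs :> R by rewrite ltr0q.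
have [C [C0 hC]] := fine_bound (ratr qs + N0%:R) q0R.
pose V := G (qs + N0%:R + 1) - G qs.
have V0 : 0 <= V by rewrite subr_ge0; apply: G_mono => //; rewrite -addrA lerDl addr_ge0.
apply/cvgrPdist_lt => e e0.
(* C bounds the mass of all measures on the partitioned interval, and V the
   variation of the limit; each of three errors below is at most eps times one of them. *)
pose eps := e / 2 / (C + V + V + 1).
have K0 : 0 < C + V + V + 1 by lra.
have eps0 : 0 < eps by rewrite !divr_gt0.
have epsK : eps * (C + V + V) <= e / 2.
  by rewrite /eps mulrAC ler_pdivrMr// ler_wpM2l ?divr_ge0 ?(ltW e0)// lerDl.
have [d d0 hd] := test_unif_continuous hphi eps0.
have [j _ hj] := near_infty_natSinv_lt (PosNum d0).
have jd : j.+1%:R^-1 <= d by apply/ltW; exact: (hj j (leqnn _)).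
pose N := (N0 * j.+1)%N.
pose X i : R := ratr (x_ j i).
have Xpos i : 0 < X i by rewrite /X ltr0q.
have XS i : X i <= X i.+1 by rewrite /X ler_rat.
have XSl i : X i < X i.+1 by rewrite -subr_gt0 x_d invr_gt0.
have x0E : x_ j 0 = qs by rewrite /x_ mul0r addr0.
have xNE : x_ j N = qs + N0%:R by rewrite /x_ /N natrM mulfK// pnatr_eq0.
have xN1 : x_ j N.+1 <= qs + N0%:R + 1.
  rewrite /x_ -natr1 mulrDl addrA -/(x_ j N) xNE lerD2l mul1r.
  by rewrite invf_le1 ?ltr0Sn// ler1n.
have x01 : qs <= x_ j 1 by rewrite -x0E.
have X0N : X 0%N <= X N.
  by rewrite /X ler_rat x0E xNE lerDl.
have XNb : b < X N.
  rewrite /X xNE raddfD /= ratr_nat; apply: lt_trans bN0 _; rewrite ltrDr//.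
have X0a : X 0%N < a by rewrite /X x0E.
have osc i y : X i < y <= X i.+1 -> `|phi y - phi (X i)| <= eps.
  move=> /andP[y1 y2]; apply: hd; apply: le_trans jd; rewrite -(x_d j i) -/(X i) -/(X i.+1).
  by rewrite ger0_norm ?subr_ge0 ?(ltW y1)// lerB.
have suppX (M : {measure set T -> \bar R}) : \int[M]_(t in `]0%R, +oo[) phi t = \int[M]_(t in `](X 0%N), (X N)]) phi t.
  apply: test_integral_on.
    move=> x; rewrite /= !in_itv/= andbT => /andP[xx _]; exact: lt_trans xx.
  move=> x hx; apply: supp; apply: contra_not hx; rewrite /= !in_itv/= => /andP[ax xb].
  by rewrite (lt_le_trans X0a ax) (le_trans xb (ltW XNb)).
have rs (M : {measure set T -> \bar R}) (hM : positive_radon M) := riemann_sum N hM hphi (ltW eps0) Xpos XS osc.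
pose S n := \sum_(i < N) phi (X i) * (F (f n) (X i.+1) - F (f n) (X i)).
pose A := \sum_(i < N) phi (X i) * (G (x_ j i.+1) - G (x_ j i)).
pose B := \sum_(i < N) phi (X i) * (P (X i.+1) - P (X i)).
have h1 n : `|\int[m (f n)]_(t in `]0%R, +oo[) phi t - S n| <= eps * C.
  rewrite suppX; apply: (le_trans _ (ler_wpM2l (ltW eps0) (hC (f n) (X 0%N) (X N) _ _))).
  - apply: le_trans (rs _ (hm (f n))); rewrite le_eqVlt; apply/orP; left; apply/eqP.
    by congr `|_ - _|; apply: eq_bigr => i _; rewrite F_itv.
  - by rewrite /X x0E.
  - by rewrite /X xNE raddfD /= ratr_nat.
have SA : S n @[n --> \oo] --> A.
  apply: (@cvg_sum_ord R (fun i n => phi (X i) * (F (f n) (X i.+1) - F (f n) (X i)))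
    (fun i => phi (X i) * (G (x_ j i.+1) - G (x_ j i)))) => i.
  apply: cvgM; first exact: cvg_cst.
  by apply: cvgB; exact: GC.
have GP i : G (x_ j i) <= P (X i) <= G (x_ j i.+1).
  by rewrite le_P//= P_le.
have h2 : `|\int[nu]_(t in `]0%R, +oo[) phi t - B| <= eps * V.
  rewrite suppX; apply: (@le_trans _ _ (eps * fine (nu `](X 0%N), (X N)]%classic))).
    apply: le_trans (rs _ nu_radon); rewrite le_eqVlt; apply/orP; left; apply/eqP.
    by congr `|_ - _|; apply: eq_bigr => i _; rewrite nu_itv.
  rewrite ler_wpM2l ?(ltW eps0)// nu_itv//= lerB//.
    by have /andP[_ h] := GP N; apply: le_trans h _; exact: G_mono.
  by have /andP[h _] := GP 0%N; rewrite -{1}x0E.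
have h3 : `|B - A| <= eps * V.
  have := @abel_bound R eps (fun i => phi (X i)) (fun i => G (x_ j i)) (fun i => P (X i)) N (ltW eps0) GP.
  rewrite -/A -/B (supp (X N)); last by rewrite /= in_itv/= => /andP[_ h]; have := lt_le_trans XNb h; rewrite ltxx.
  rewrite (supp (X 0%N)); last by rewrite /= in_itv/= => /andP[h _]; have := lt_le_trans X0a h; rewrite ltxx.
  rewrite !mul0r subr0 addr0 => h.
  apply: le_trans (h _) _; first by move=> i; apply: osc; rewrite XSl lexx.
  by rewrite ler_wpM2l ?(ltW eps0)// lerB// G_mono.
have e20 : 0 < e / 2 by rewrite divr_gt0.
move/cvgrPdist_lt : SA => /(_ _ e20); apply: filterS => n hn.
have := h1 n; move: hn h2 h3 epsK.
rewrite !mulrDr.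
set I1 := \int[nu]_(t in _) _; set I2 := \int[m _]_(t in _) _; set s := S n.
move=> hn h2 h3 epsK h4.
have -> : I1 - I2 = (I1 - B) + (B - A) + (A - s) - (I2 - s) by ring.
apply: le_lt_trans (ler_normB _ _) _.
have t1 := ler_normD (I1 - B + (B - A)) (A - s); have t2 := ler_normD (I1 - B) (B - A).
lra.
Qed.

End helly.

Theorem helly (R : realType) (m : nat -> {measure set (measurableTypeR R) -> \bar R}) :
  (forall n, positive_radon (m n)) ->
  (forall a b : R, 0 < a -> exists C : R, forall n, (m n `[a, b]%classic <= C%:E)%E) ->
  exists2 f, increasing_seq f &
  exists2 nu : {measure set (measurableTypeR R) -> \bar R}, positive_radon nu &
  forall phi, test_function phi ->
    \int[m (f n)]_(t in `]0%R, +oo[) phi t @[n --> \oo] --> \int[nu]_(t in `]0%R, +oo[) phi t.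
Proof.
move=> hm hb; have [f fI fC] := distribution_extraction hm hb.
by exists f => //; exact: distribution_limit fC.
Qed.

(** * Growth of the parts of a measure *)

Section part_bounds.
Context {R : realType}.
Local Notation T := (measurableTypeR R).
Implicit Types (m : {measure set T -> \bar R}) (mu : cmeasure R).

Lemma variation_ge mu (E A : set T) : measurable A -> rel_compact A -> A `<=` E ->
  ((ComplexField.Normc.normc (cmeasure_val mu A))%:E <= cmeasure_variation mu E)%E.
Proof.
move=> mA rA AE; apply: ereal_sup_ubound.
exists 1%N, (fun i : nat => if i == 0%N then A else set0); split.
- by move=> i; case: ifP.
- move=> i; case: ifP => // _; exists 1, 1; split => //.
- by move=> i; case: ifP => // _ x.
- apply/trivIsetP => i j _ _ ij.
  have [i0|i0] := eqVneq i 0%N; last by rewrite set0I.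
  by have [j0|j0] := eqVneq j 0%N; [rewrite i0 j0 in ij|rewrite setI0].
- by rewrite big_ord_recl big_ord0 addr0.
Qed.

Lemma mutually_singular_sym m1 m2 : mutually_singular m1 m2 -> mutually_singular m2 m1.
Proof.
by move=> [P mP [h1 h2]]; exists (~` P); [exact: measurableC|rewrite setCK].
Qed.

Lemma singular_carrier m1 m2 (E : set T) : mutually_singular m1 m2 -> measurable E ->
  exists A, [/\ measurable A, A `<=` E, m1 A = m1 E & m2 A = 0%E].
Proof.
move=> [P mP [h1 h2]] mE; exists (E `\` P); split.
- exact: measurableD.
- exact: subDsetl.
- rewrite (measureDI m1 mE mP) [X in (_ + X)%E](_ : _ = 0%E) ?adde0//.
  apply/eqP; rewrite eq_le measure_ge0 andbT -h1.
  by apply: le_measure; rewrite ?inE//; exact: measurableI.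
- apply/eqP; rewrite eq_le measure_ge0 andbT -h2.
  by apply: le_measure; rewrite ?inE//; [exact: measurableD|exact: measurableC].
Qed.

Lemma normc_Re_le (z : R[i]) : `|complex.Re z| <= ComplexField.Normc.normc z.
Proof. by case: z => x y /=; rewrite -sqrtr_sqr ler_wsqrtr// lerDl sqr_ge0. Qed.

Lemma normc_Im_le (z : R[i]) : `|complex.Im z| <= ComplexField.Normc.normc z.
Proof. by case: z => x y /=; rewrite -sqrtr_sqr ler_wsqrtr// lerDr sqr_ge0. Qed.

Definition parts_all (Q : {measure set T -> \bar R} -> Prop) mu :=
  [/\ Q (re_pos mu), Q (re_neg mu), Q (im_pos mu) & Q (im_neg mu)].

(** By mutual singularity a part is carried by a set where its counterpart
    vanishes; on that set its mass is at most the modulus of the value of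
    mu. *)
Lemma part_le_variation mu (a b : R) : radon mu -> 0 < a ->
  parts_all (fun m => (m `[a, b]%classic <= cmeasure_variation mu `[a, b]%classic)%E) mu.
Proof.
move=> [[p1 p2 p3 p4] [sr si]] a0.
pose E : set T := `[a, b]%classic; have mE : measurable E by exact: measurable_itv.
have main m1 m2 (g : R[i] -> R) : positive_radon m1 -> mutually_singular m1 m2 ->
    (forall z, `|g z| <= ComplexField.Normc.normc z) ->
    (forall A, `|g (cmeasure_val mu A)| = `|fine (m1 A) - fine (m2 A)|) ->
    (m1 E <= cmeasure_variation mu E)%E.
  move=> hm1 sm hg gv; have [A [mA AE A1 A2]] := singular_carrier sm mE.
  have rA : rel_compact A by exists a, b.
  apply: (@le_trans _ _ (ComplexField.Normc.normc (cmeasure_val mu A))%:E); last exact: variation_ge.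
  rewrite -(fineK (_ : m1 E \is a fin_num)); last by rewrite ge0_fin_numE//; exact: radon_itv_lty.
  rewrite lee_fin; apply: (@le_trans _ _ `|g (cmeasure_val mu A)|); last exact: hg.
  rewrite gv A1 A2 subr0.
  exact: ler_norm.
split.
- exact: (main _ _ (@complex.Re R) p1 sr normc_Re_le).
- apply: (main _ _ (@complex.Re R) p2 (mutually_singular_sym sr) normc_Re_le) => A.
  by rewrite distrC.
- exact: (main _ _ (@complex.Im R) p3 si normc_Im_le).
- apply: (main _ _ (@complex.Im R) p4 (mutually_singular_sym si) normc_Im_le) => A.
  by rewrite distrC.
Qed.

End part_bounds.

Section growth.
Context {R : realType}.
Local Notation T := (measurableTypeR R).
Variables (rho : R -> R) (rho0 : R).
Hypothesis hrho : proximate_order rho rho0.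
Implicit Types (m : {measure set T -> \bar R}) (mu : cmeasure R).
Local Notation V := (prox_V rho).

(** The interval [a e^z, b e^z] is covered by a fixed number of intervals
    [r, e r], and on each of them V is comparable with V (e^z). *)
Lemma local_bound m (C a b : R) : 0 < a -> positive_radon m ->
  (forall r, 0 < r -> (m `[r, (expR 1 * r)%R]%classic <= (C * V r)%:E)%E) ->
  exists2 C', 0 <= C' & forall z, (m `[(a * expR z)%R, (b * expR z)%R]%classic <= (C' * V (expR z))%:E)%E.
Proof.
move=> a0 hm hC.
have C0 : 0 <= C.
  have := le_trans (measure_ge0 m _) (hC 1 ltr01); rewrite lee_fin.
  by rewrite pmulr_lge0// -[1]expR0; exact: (prox_V_gt0 rho rho0).
have step (k : R) : exists2 C1, 0 <= C1 &
    forall z, (m `[(a * expR k * expR z)%R, (expR 1 * (a * expR k * expR z))%R]%classic <= (C1 * V (expR z))%:E)%E.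
  have [B hB] := prox_V_ratio_bounded hrho `|k + ln a|.
  have B0 : 0 <= B.
    have h2 := prox_V_gt0 rho rho0 0.
    have h := le_trans (ltW (prox_V_gt0 rho rho0 (0 + (k + ln a)))) (hB 0 (k + ln a) (lexx _)).
    by rewrite (pmulr_lge0 B h2) in h.
  exists (C * B); first exact: mulr_ge0.
  move=> z; have E : a * expR k * expR z = expR (z + (k + ln a)).
    by rewrite !expRD lnK ?posrE//; ring.
  rewrite E; apply: le_trans (hC _ (expR_gt0 _)) _.
  by rewrite lee_fin -mulrA ler_wpM2l// hB.
have ind N : exists2 C1, 0 <= C1 &
    forall z, (m `[(a * expR z)%R, (a * expR N%:R * expR z)%R]%classic <= (C1 * V (expR z))%:E)%E.
  elim: N => [|N [C1 C10 IH]].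
    have [C1 C10 h] := step 0; exists C1 => // z; apply: le_trans (h z).
    apply: le_measure; rewrite ?inE; [exact: measurable_itv|exact: measurable_itv|].
    rewrite expR0 !mulr1; apply: subset_itvl; rewrite bnd_simp.
    rewrite ler_peMl// ?mulr_ge0 ?expR_ge0 ?(ltW a0)//; have := expR_ge1Dx (1 : R); lra.
  have [C2 C20 h] := step N%:R; exists (C1 + C2); first exact: addr_ge0.
  move=> z; rewrite mulrDl EFinD.
  apply: le_trans (leeD (IH z) (h z)).
  apply: le_trans _ (measureU2 _ _ _); [|exact: measurable_itv|exact: measurable_itv].
  apply: le_measure; rewrite ?inE; [exact: measurable_itv|apply: measurableU; exact: measurable_itv|].
  move=> x; rewrite /= !in_itv/= => /andP[x1 x2].
  have [x3|x3] := leP x (a * expR N%:R * expR z); [left; rewrite x1|right; rewrite (ltW x3)] => //=.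
  by apply: le_trans x2 _; rewrite -natr1 expRD; rewrite le_eqVlt; apply/orP; left; apply/eqP; ring.
have [N bN] : exists N : nat, b <= a * expR N%:R.
  exists (Num.truncn `|b / a|).+1; rewrite -ler_pdivrMl// mulrC.
  apply: le_trans (ler_norm _) _; apply: le_trans (ltW (truncnS_gt _)) _.
  by apply: le_trans (expR_ge1Dx _); rewrite lerDr.
have [C1 C10 h] := ind N; exists C1 => // z; apply: le_trans (h z).
apply: le_measure; rewrite ?inE; [exact: measurable_itv|exact: measurable_itv|].
by apply: subset_itvl; rewrite bnd_simp ler_wpM2r ?expR_ge0.
Qed.

End growth.

Section test_functions.
Context {R : realType}.
Local Notation T := (measurableTypeR R).
Implicit Types (m : {measure set T -> \bar R}) (phi : R -> R).

Lemma test_function_scale phi c : 0 < c -> test_function phi -> test_function (fun t => phi (t / c)).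
Proof.
move=> c0 [cphi [a [b [a0 h]]]]; split.
  move=> x; have hc : t / c @[t --> x] --> x / c.
    by apply: cvgM; [exact: cvg_id|exact: cvg_cst].
  exact: (cvg_comp _ _ hc (cphi _)).
exists (a * c), (b * c); split; first exact: mulr_gt0.
move=> x hx; apply: h; apply: contra_not hx; rewrite /= !in_itv/=.
by rewrite ler_pdivlMr// ler_pdivrMr.
Qed.

Lemma test_function_norm phi : test_function phi -> test_function (fun t => `|phi t|).
Proof.
move=> [c [a [b [a0 h]]]]; split.
  by move=> x; apply: (@continuous_comp _ _ _ phi Num.norm); [exact: c|exact: norm_continuous].
by exists a, b; split => // x /h ->; rewrite normr0.
Qed.

Lemma test_integral_norm m phi : positive_radon m -> test_function phi ->
  (\int[m]_t `|(phi t)%:E|)%E = (\int[m]_(t in `]0%R, +oo[) `|phi t|)%:E.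
Proof.
move=> hm hphi; have hn := test_function_norm hphi.
have mpos : measurable (`]0, +oo[%classic : set T) by exact: measurable_itv.
rewrite /Rintegral fineK; last exact: (integrable_fin_num mpos (test_integrable hm hn)).
rewrite [RHS]integral_mkcond; apply: eq_integral => x _; rewrite /= patchE.
case: (boolP (x \in _)) => //; rewrite notin_setE /= in_itv/= andbT => /negP; rewrite -leNgt => x0.
by rewrite (test_function_neg hphi x0) normr0.
Qed.

Lemma test_integral_bound m phi (a b e : R) : positive_radon m -> test_function phi -> 0 < a ->
  (forall x, ~ `[a, b]%classic x -> phi x = 0) -> (forall x, `|phi x| <= e) ->
  \int[m]_(t in `]0%R, +oo[) `|phi t| <= e * fine (m `[a, b]%classic).
Proof.
move=> hm hphi a0 supp he.
have mA : measurable (`[a, b]%classic : set T) by exact: measurable_itv.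
have hn := test_function_norm hphi.
have ii : m.-integrable (`[a, b]%classic : set T) (EFin \o (fun x : T => `|phi x|)).
  apply: (integrableS _ mA _ (test_integrable hm hn)); first exact: measurable_itv.
  move=> x; rewrite /= !in_itv/= andbT => /andP[ax _]; exact: lt_le_trans ax.
have ic : m.-integrable (`[a, b]%classic : set T) (EFin \o (cst e : T -> R)).
  apply: measurable_bounded_integrable => //; first exact: radon_itv_lty.
  by exists `|e|; split => [|u Cu x _ /=]; [exact: num_real|exact: ltW].
rewrite (@test_integral_support _ m (fun t => `|phi t|) a b a0); last first.
  by move=> x /supp ->; rewrite normr0.
have -> : e * fine (m `[a, b]%classic) = \int[m]_(_ in `[a, b]) e.
  by rewrite Rintegral_cst.
by apply: (le_Rintegral mA ii ic) => x _; exact: he.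
Qed.

Lemma le_norm_test_integral m phi : positive_radon m -> test_function phi ->
  `|\int[m]_(t in `]0%R, +oo[) phi t| <= \int[m]_(t in `]0%R, +oo[) `|phi t|.
Proof.
move=> hm hphi; apply: le_normr_Rintegral; [exact: measurable_itv|exact: test_integrable].
Qed.

End test_functions.

(** * Existence of densities, and dilations *)

Section exp_local.
Context {R : realType}.
Local Notation T := (measurableTypeR R).
Local Notation leb := (@lebesgue_measure R).
Let pos : set T := `]0, +oo[%classic.
Let mpos : measurable pos. Proof. exact: measurable_itv. Qed.

Lemma measurable_of_expR (f : R -> R) : measurable_fun setT (fun x : T => f (expR x) * expR x) ->
  measurable_fun (`]0, +oo[%classic : set T) (f : T -> R).
Proof.
move=> mf.
have mln : measurable_fun setT (@ln R : T -> T) by exact: measurable_ln.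
have mfl : measurable_fun pos (fun r : T => (f (expR (ln r)) * expR (ln r)) * expR (- ln r)).
  apply: measurable_funTS; apply: measurable_funM; first exact: (measurableT_comp mf mln).
  apply: measurableT_comp; first exact: measurable_expR.
  by apply: measurableT_comp mln; exact: oppr_measurable.
apply: eq_measurable_fun mfl => r; rewrite inE /pos /= in_itv/= andbT => r0.
by rewrite expRN lnK ?posrE// mulfK// gt_eqF.
Qed.

(** Test with a plateau that equals 1 on [a, b]. *)
Lemma local_integrable_of_expR (h : R -> R) :
  (forall phi, test_function phi ->
    leb.-integrable setT (EFin \o (fun x : T => expR x * phi (expR x) * h (expR x)))) ->
  forall a b : R, 0 < a -> leb.-integrable `[a, b] (EFin \o (h : T -> R)).
Proof.
move=> H a b a0; have a20 : 0 < a / 2 by rewrite divr_gt0.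
pose phi := plateau (a / 2) b (a / 2).
have hphi : test_function phi by exact: plateau_test.
have i1 := H _ hphi.
have E : (fun x : T => expR x * phi (expR x) * h (expR x)) =
         (fun x : T => (fun r => phi r * h r) (expR x) * expR x).
  by apply/funext => x /=; ring.
rewrite E in i1.
have mf : measurable_fun (`]0, +oo[%classic : set T) (fun r : T => phi r * h r).
  by apply: measurable_of_expR; move/integrableP : i1 => [/measurable_EFinP].
have i2 := (integrable_expR mf).2 i1.
have mA : measurable (`[a, b]%classic : set T) by exact: measurable_itv.
have sub : (`[a, b]%classic : set T) `<=` `]0, +oo[.
  by move=> x; rewrite /= !in_itv/= andbT => /andP[ax _]; exact: lt_le_trans ax.
have i3 := integrableS mpos mA sub i2.
apply: eq_integrable i3 => // x; rewrite inE /= in_itv/= => /andP[ax xb].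
congr EFin; rewrite -[RHS]mul1r; congr (_ * _); rewrite /phi /plateau.
have h1 : 1 <= Num.min ((x - a / 2) / (a / 2)) ((b + a / 2 - x) / (a / 2)).
  by rewrite le_min !ler_pdivlMr// !mul1r; apply/andP; split; lra.
by rewrite (min_idPl h1); apply/max_idPr; exact: ler01.
Qed.

End exp_local.

Section density_exists.
Context {R : realType}.
Local Notation T := (measurableTypeR R).
Local Notation leb := (@lebesgue_measure R).
Let pos : set T := `]0, +oo[%classic.
Let mpos : measurable pos. Proof. exact: measurable_itv. Qed.

Lemma measurable_of_local (h : R -> R) :
  (forall a b : R, 0 < a -> leb.-integrable `[a, b] (EFin \o (h : T -> R))) ->
  measurable_fun (`]0, +oo[%classic : set T) (h : T -> R).
Proof.
move=> H.
have -> : (`]0, +oo[%classic : set T) = \bigcup_n (`[n.+1%:R^-1, n.+1%:R]%classic : set T).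
  apply/seteqP; split => x; rewrite /= ?in_itv/= ?andbT.
    move=> x0; exists (maxn (Num.truncn x) (Num.truncn x^-1)) => //=; rewrite in_itv/=.
    apply/andP; split.
      rewrite -[leRHS]invrK lef_pV2 ?posrE ?invr_gt0//.
      apply: (le_trans (ltW (truncnS_gt _))).
      by rewrite ler_nat ltnS leq_maxr.
    apply: (le_trans (ltW (truncnS_gt _))).
    by rewrite ler_nat ltnS leq_maxl.
  by move=> [n _ /=]; rewrite in_itv/= => /andP[h1 _]; apply: lt_le_trans h1; rewrite invr_gt0.
apply/measurable_fun_bigcup => n; first exact: measurable_itv.
have i0 : 0 < n.+1%:R^-1 :> R by rewrite invr_gt0.
by move/integrableP : (H _ n.+1%:R i0) => [/measurable_EFinP].
Qed.

(** The positive and the negative part of h are densities of mutually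
    singular measures. *)
Lemma real_density_exists (h : R -> R) :
  (forall a b : R, 0 < a -> leb.-integrable `[a, b] (EFin \o (h : T -> R))) ->
  exists P Q : {measure set T -> \bar R}, [/\ positive_radon P, positive_radon Q,
    mutually_singular P Q &
    forall a b E, 0 < a -> measurable E -> E `<=` (`[a, b]%classic : set T) ->
      fine (P E) - fine (Q E) = \int[leb]_(x in E) h x].
Proof.
move=> H; have mh := measurable_of_local H.
pose h0 : T -> R := h \_ pos.
have mh0 : measurable_fun setT h0 by exact/(measurable_restrictT _ mpos).
pose hp (x : T) : R := Num.max (h0 x) 0; pose hn (x : T) : R := Num.max (- h0 x) 0.
have mhp : measurable_fun setT hp by exact: measurable_maxr.
have mhn : measurable_fun setT hn by apply: measurable_maxr => //; exact: measurableT_comp.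
have hp0 x : 0 <= hp x by rewrite /hp le_max lexx orbT.
have hn0 x : 0 <= hn x by rewrite /hn le_max lexx orbT.
have hE x : hp x - hn x = h0 x.
  by rewrite /hp /hn; case: (leP (h0 x) 0) => gx; case: (leP (- h0 x) 0) => gx'; lra.
have hph x : `|hp x| <= `|h0 x| by rewrite ger0_norm// /hp ge_max ler_norm normr_ge0.
have hnh x : `|hn x| <= `|h0 x| by rewrite ger0_norm// /hn ge_max -normrN ler_norm normr_ge0.
have neg x : x <= 0 -> h0 x = 0.
  by move=> x0; rewrite /h0 patchE ifF//; apply/negP; rewrite inE /pos /= in_itv/= andbT ltNge x0.
have ih0 a b : 0 < a -> leb.-integrable `[a, b] (EFin \o (fun x : T => `|h0 x|)).
  move=> a0; have i := H a b a0.
  have mA : measurable (`[a, b]%classic : set T) by exact: measurable_itv.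
  apply: eq_integrable (integrable_norm i) => // x; rewrite inE /= in_itv/= => /andP[ax _].
  by congr EFin; rewrite /h0 patchE ifT// inE /pos /= in_itv/= andbT; exact: lt_le_trans ax.
have dom (g : T -> R) : measurable_fun setT g -> (forall x, `|g x| <= `|h0 x|) -> forall a b : R, 0 < a ->
    leb.-integrable `[a, b] (EFin \o (g : T -> R)).
  move=> mg gh a b a0; have mA : measurable (`[a, b]%classic : set T) by exact: measurable_itv.
  apply: (integrable_domR mA _ (ih0 a b a0)); first exact: measurable_funTS.
  by move=> x _; exact: gh.
pose P : {measure set T -> \bar R} := density_measure leb mhp hp0.
pose Q : {measure set T -> \bar R} := density_measure leb mhn hn0.
have zero (g : T -> R) (E : set T) : (forall x, E x -> g x = 0) -> (\int[leb]_(x in E) (g x)%:E = 0)%E.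
  by move=> gE; apply: integral0_eq => x Ex; rewrite gE.
have val (g : T -> R) (mg : measurable_fun setT g) (g0 : forall x, 0 <= g x) a b E :
    (forall x, `|g x| <= `|h0 x|) -> 0 < a -> measurable E -> E `<=` (`[a, b]%classic : set T) ->
    density_measure leb mg g0 E = (\int[leb]_(x in E) g x)%:E /\ leb.-integrable E (EFin \o g).
  move=> gh a0 mE EA; have mA : measurable (`[a, b]%classic : set T) by exact: measurable_itv.
  have i := integrableS mA mE EA (dom g mg gh a b a0).
  by split => //; rewrite /Rintegral fineK//; exact: (integrable_fin_num mE i).
have vP a b E : 0 < a -> measurable E -> E `<=` (`[a, b]%classic : set T) ->
    P E = (\int[leb]_(x in E) hp x)%:E /\ leb.-integrable E (EFin \o hp).
  by move=> a0 mE EA; exact: val hph a0 mE EA.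
have vQ a b E : 0 < a -> measurable E -> E `<=` (`[a, b]%classic : set T) ->
    Q E = (\int[leb]_(x in E) hn x)%:E /\ leb.-integrable E (EFin \o hn).
  by move=> a0 mE EA; exact: val hnh a0 mE EA.
exists P, Q; split.
- split; first by apply: zero => x; rewrite /= in_itv/= => /neg; rewrite /hp => ->; rewrite maxxx.
  move=> a b a0; have [-> _] := vP a b _ a0 (measurable_itv _) (@subset_refl _ _).
  exact: ltry.
- split; first by apply: zero => x; rewrite /= in_itv/= => /neg; rewrite /hn => ->; rewrite oppr0 maxxx.
  move=> a b a0; have [-> _] := vQ a b _ a0 (measurable_itv _) (@subset_refl _ _).
  exact: ltry.
- exists [set x | h0 x <= 0].
    by rewrite -[X in measurable X]setTI; apply: measurable_fun_le.
  split; first by apply: zero => x /= hx; exact/max_idPr.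
  by apply: zero => x /= /negP; rewrite -ltNge => hx; apply/max_idPr; rewrite oppr_le0 ltW.
- move=> a b E a0 mE EA.
  have [-> i1] := vP a b E a0 mE EA.
  have [-> i2] := vQ a b E a0 mE EA.
  rewrite /= -RintegralB//; apply: eq_Rintegral => x; rewrite inE => Ex.
  rewrite hE /h0 patchE ifT// inE /pos /= in_itv/= andbT.
  by have := EA x Ex; rewrite /= in_itv/= => /andP[ax _]; exact: lt_le_trans ax.
Qed.

Lemma density_exists (g : R -> R[i]) :
  (forall a b : R, 0 < a -> cintegrable leb `[a, b] g) -> exists nu, has_density nu g.
Proof.
move=> H.
have [P [Q [hP hQ PQ E1]]] := real_density_exists (fun a b a0 => (H a b a0).1).
have [P' [Q' [hP' hQ' PQ' E2]]] := real_density_exists (fun a b a0 => (H a b a0).2).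
exists (CMeasure P Q P' Q'); split; first by split.
move=> a b a0; split; first exact: H.
by move=> E mE EA; apply: cplxP; [exact: E1 EA|exact: E2 EA].
Qed.

End density_exists.

Section scaling.
Context {R : realType}.
Local Notation T := (measurableTypeR R).
Implicit Types (m : {measure set T -> \bar R}) (phi : R -> R) (mu : cmeasure R).

Lemma positive_radon_dilate m (c : R) : 0 < c -> positive_radon m -> positive_radon (dilate c m).
Proof.
move=> c0 [m0 mK]; split.
  rewrite -m0 /dilate /pushforward; congr (m _); apply/seteqP; split => x; rewrite /= !in_itv/=.
    by rewrite pmulr_lle0// invr_gt0.
  by move=> x0; rewrite pmulr_lle0// invr_gt0.
move=> a b a0.
have E : dilate c m `[a, b]%classic = m `[a * c, b * c]%classic.
  rewrite /dilate /pushforward; congr (m _).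
  by apply/seteqP; split => x; rewrite /= !in_itv/= ler_pdivlMr// ler_pdivrMr.
have h := mK _ (b * c) (mulr_gt0 a0 c0); rewrite -E in h; exact: h.
Qed.

Lemma positive_radon_mscale m (k : {nonneg R}) : positive_radon m -> positive_radon (mscale k m).
Proof.
move=> [m0 mK].
have E A : mscale k m A = ((k%:num)%:E * m A)%E by [].
split; first by have := E `]-oo, 0%R]%classic; rewrite m0 mule0; apply.
move=> a b a0.
suff : (mscale k m `[a, b]%classic < +oo)%E by apply.
by rewrite E; apply: lte_mul_pinfty => //; exact: mK.
Qed.

Definition part_scale (rho : R -> R) (c : R) m : {measure set T -> \bar R} :=
  mscale (NngNum (prox_V_inv_ge0 rho c)) (dilate c m).

Lemma positive_radon_scale rho c m : 0 < c -> positive_radon m -> positive_radon (part_scale rho c m).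
Proof. by move=> c0 hm; apply: positive_radon_mscale; exact: positive_radon_dilate. Qed.

Lemma integral_part_scale rho c m phi : 0 < c -> positive_radon m -> test_function phi ->
  \int[part_scale rho c m]_(t in `]0%R, +oo[) phi t =
  (prox_V rho c)^-1 * \int[m]_(t in `]0%R, +oo[) phi (t / c).
Proof.
move=> c0 hm hphi.
have mpos : measurable (`]0, +oo[%classic : set T) by exact: measurable_itv.
have mphi := test_function_measurable hphi.
have hmc := positive_radon_dilate c0 hm.
have ic := test_integrable hmc hphi.
have i := test_integrable hm (test_function_scale c0 hphi).
have mc : measurable_fun setT (fun x : T => (x / c : T)) by exact: mulrr_measurable.
have pE : (fun x : T => (x / c : T)) @^-1` `]0, +oo[ = (`]0, +oo[%classic : set T).
  apply/seteqP; split => x; rewrite /= !in_itv/= !andbT.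
    by rewrite pmulr_lgt0// invr_gt0.
  by move=> x0; rewrite pmulr_lgt0// invr_gt0.
have e1 : (\int[dilate c m]_(t in `]0%R, +oo[) (phi t)%:E = \int[m]_(t in `]0%R, +oo[) (phi (t / c))%:E)%E.
  rewrite /dilate (integral_pushforward mc) ?pE//; exact/measurable_EFinP.
have mphiE : measurable_fun (`]0, +oo[%classic : set T) (EFin \o (phi : T -> R)).
  by apply: measurable_funTS; exact/measurable_EFinP.
rewrite {1}/Rintegral /part_scale [X in fine X]integralE.
rewrite !ge0_integral_mscale//; [|exact: measurable_funeneg|exact: measurable_funepos].
rewrite -muleBr//; last first.
  exact: integrable_add_def.
rewrite -integralE e1 /Rintegral fineM//.
exact: (integrable_fin_num mpos i).
Qed.

Lemma pairing_scale rho mu c phi : 0 < c -> parts_radon mu -> test_function phi ->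
  pairing (azarin_scale rho mu c) phi = ((prox_V rho c)^-1)%:C * pairing mu (fun t => phi (t / c)).
Proof.
move=> c0 [p1 p2 p3 p4] hphi; rewrite !pairingE.
have H m (hm : positive_radon m) := integral_part_scale rho c0 hm hphi.

by apply: cplxP; rewrite !cplxE /= mul0r ?subr0 ?addr0 mulrBr -!H.
Qed.

End scaling.

(** * Limits of dilated measures *)

Section growth_class.
Context {R : realType}.
Local Notation T := (measurableTypeR R).
Local Notation leb := (@lebesgue_measure R).
Variables (rho : R -> R) (rho0 : R).
Hypothesis hrho : proximate_order rho rho0.
Implicit Types (m : {measure set T -> \bar R}) (mu : cmeasure R) (phi : R -> R).
Local Notation V := (prox_V rho).

(** The bound for V (T e^y) / V (T) that holds for all T. *)
Definition gamma_weight (y : R) : R := expR (rho0 * y) * prox_gamma rho rho0 (expR y).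

Lemma gamma_weight_ge (y : R) : expR (rho0 * y) <= gamma_weight y.
Proof. by rewrite /gamma_weight ler_peMr ?expR_ge0// prox_gamma_ge1. Qed.

Lemma gamma_weight_ge0 (y : R) : 0 <= gamma_weight y.
Proof. exact: le_trans (expR_ge0 _) (gamma_weight_ge y). Qed.

(** What Fubini's theorem and dominated convergence require of a measure:
    one weight for the dilations of any test function. *)
Definition tame (w : R -> R) m := forall phi, test_function phi ->
  exists2 C, 0 <= C & forall y, \int[m]_(t in `]0%R, +oo[) `|phi (t / expR y)| <= C * w y.

Definition growth m := positive_radon m /\
  exists C : R, forall r, 0 < r -> (m `[r, (expR 1 * r)%R]%classic <= (C * V r)%:E)%E.

Lemma class_growth mu : class_M rho mu -> parts_all growth mu.
Proof.
move=> [hr [C hC]]; have [[p1 p2 p3 p4] _] := hr.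
have h r (r0 : 0 < r) := part_le_variation (expR 1 * r) hr r0.
by split; split => //; exists C => r r0; have [h1 h2 h3 h4] := h r r0;
  apply: le_trans (hC r r0).
Qed.

Lemma scaled_growth m phi : growth m -> test_function phi ->
  exists2 C, 0 <= C & forall x y,
    \int[part_scale rho (expR x) m]_(t in `]0%R, +oo[) `|phi (t / expR y)| <=
    C * (V (expR (x + y)) / V (expR x)).
Proof.
move=> [hm [C0 hC0]] hphi; have [_ [a [b [a0 supp]]]] := hphi.
have [Cp hCp] := test_function_bounded hphi.
have Cp0 : 0 <= Cp := le_trans (normr_ge0 _) (hCp 0).
have [C C'0 hC] := local_bound hrho b a0 hm hC0.
exists (Cp * C); first exact: mulr_ge0.
move=> x y; have ey : 0 < expR y := expR_gt0 y.
have exy : 0 < expR (x + y) := expR_gt0 _.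
have hy := test_function_norm (test_function_scale ey hphi).
rewrite (integral_part_scale rho (expR_gt0 x) hm hy).
have E : (fun t => `|phi (t / expR x / expR y)|) = (fun t => `|phi (t / expR (x + y))|).
  by apply/funext => t; rewrite -mulrA -invfM -expRD.
rewrite E.
have Vx : 0 < V (expR x) := prox_V_gt0 rho rho0 x.
have hb : \int[m]_(t in `]0%R, +oo[) `|phi (t / expR (x + y))| <=
   Cp * fine (m `[(a * expR (x + y))%R, (b * expR (x + y))%R]%classic).
  apply: (test_integral_bound hm (test_function_scale exy hphi)).
  - exact: mulr_gt0.
  - move=> t ht; apply: supp; apply: contra_not ht; rewrite /= !in_itv/=.
    by rewrite ler_pdivlMr// ler_pdivrMr.
  - by move=> t; exact: hCp.
have fb : fine (m `[(a * expR (x + y))%R, (b * expR (x + y))%R]%classic) <= C * V (expR (x + y)).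
  rewrite -lee_fin fineK; first exact: hC.
  by rewrite ge0_fin_numE//; apply: radon_itv_lty => //; exact: mulr_gt0.
rewrite mulrA [leRHS]mulrC ler_wpM2l ?invr_ge0 ?(ltW Vx)//.
by apply: le_trans hb _; rewrite -mulrA ler_wpM2l.
Qed.

Lemma scaled_gamma_bound m phi : growth m -> test_function phi ->
  exists2 C, 0 <= C & forall x y,
    \int[part_scale rho (expR x) m]_(t in `]0%R, +oo[) `|phi (t / expR y)| <= C * gamma_weight y.
Proof.
move=> hm hphi; have [C C0 h] := scaled_growth hm hphi; exists C => // x y.
by apply: le_trans (h x y) _; rewrite ler_wpM2l// prox_V_ratio_le.
Qed.

Lemma growth_tame m : growth m -> tame gamma_weight m.
Proof.
move=> hm phi hphi; have [C C0 h] := scaled_gamma_bound hm hphi; exists C => // y.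
have := h 0 y.
rewrite (integral_part_scale rho (expR_gt0 0) hm.1 (test_function_norm (test_function_scale (expR_gt0 y) hphi))).
rewrite (_ : (fun t => `|phi (t / expR 0 / expR y)|) = (fun t => `|phi (t / expR y)|)).
  by rewrite expR0 /prox_V powR1 invr1 mul1r.
by apply/funext => t; rewrite expR0 divr1.
Qed.

Lemma part_scale_itv m (c a b : R) : 0 < c ->
  part_scale rho c m `[a, b]%classic = ((V c)^-1%:E * m `[(a * c)%R, (b * c)%R]%classic)%E.
Proof.
move=> c0; transitivity ((V c)^-1%:E * dilate c m `[a, b]%classic)%E; first by [].
congr (_ * _)%E; rewrite /dilate /pushforward; congr (m _).
by apply/seteqP; split => x; rewrite /= !in_itv/= ler_pdivlMr// ler_pdivrMr.
Qed.

Lemma part_limit m (x_ : nat -> R) : growth m ->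
  exists2 f, increasing_seq f &
  exists2 nu : {measure set T -> \bar R}, positive_radon nu &
  forall phi, test_function phi ->
    \int[part_scale rho (expR (x_ (f n))) m]_(t in `]0%R, +oo[) phi t @[n --> \oo]
      --> \int[nu]_(t in `]0%R, +oo[) phi t.
Proof.
move=> [hm [C hC]]; apply: (helly (m := fun n => part_scale rho (expR (x_ n)) m)).
  by move=> n; apply: positive_radon_scale => //; exact: expR_gt0.
move=> a b a0; have [C' C'0 h] := local_bound hrho b a0 hm hC.
exists C' => n; rewrite part_scale_itv ?expR_gt0//.
have V0 : 0 < V (expR (x_ n)) := prox_V_gt0 rho rho0 _.
rewrite muleC lee_pdivrMr//.
Qed.

(** V (T e^y) / V (T) tends to e^(rho0 y), so the weight loses the factor
    gamma in the limit. This makes bounded the function to which Wiener's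
    theorem will be applied. *)
Lemma limit_tame m (nu : {measure set T -> \bar R}) (x_ : nat -> R) : growth m ->
  x_ n @[n --> \oo] --> +oo ->
  (forall phi, test_function phi ->
    \int[part_scale rho (expR (x_ n)) m]_(t in `]0%R, +oo[) phi t @[n --> \oo]
      --> \int[nu]_(t in `]0%R, +oo[) phi t) ->
  tame (fun y => expR (rho0 * y)) nu.
Proof.
move=> hm xoo hc phi hphi; have [C C0 h] := scaled_growth hm hphi; exists C => // y.
have l1 := hc _ (test_function_norm (test_function_scale (expR_gt0 y) hphi)).
have l2 : C * (V (expR (x_ n + y)) / V (expR (x_ n))) @[n --> \oo] --> C * expR (rho0 * y).
  have l : V (expR (x_ n + y)) / V (expR (x_ n)) @[n --> \oo] --> expR (rho0 * y).
    exact: (cvg_comp _ (fun x => V (expR (x + y)) / V (expR x)) xoo (@prox_V_ratio_cvg R rho rho0 hrho y)).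
  by apply: cvgM; [exact: cvg_cst|exact: l].
by apply: (ler_cvg_to l1 l2); apply: nearW => n; exact: h.
Qed.

Lemma tame_le (w w' : R -> R) m : (forall y, w y <= w' y) -> tame w m -> tame w' m.
Proof.
move=> ww ht phi hphi; have [C C0 h] := ht _ hphi; exists C => // y.
by apply: le_trans (h y) _; rewrite ler_wpM2l.
Qed.

End growth_class.

Section dual_tame.
Context {R : realType}.
Local Notation T := (measurableTypeR R).
Local Notation leb := (@lebesgue_measure R).
Variables (w : R -> R) (K : R -> R[i]).
Hypotheses (w0 : forall y, 0 <= w y) (mK : cmeasurable_fun `]0, +oo[ K)
  (iw1 : leb.-integrable setT (EFin \o (fun y : T => `|complex.Re (K (expR y))| * w y)))
  (iw2 : leb.-integrable setT (EFin \o (fun y : T => `|complex.Im (K (expR y))| * w y))).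

Lemma dual_convolution_tame (M : cmeasure R) (phi : R -> R) : parts_radon M -> parts_all (tame w) M ->
  test_function phi ->
  let P := fun x : T => (expR x * phi (expR x))%:C * convolution_Psi K M (expR x) in
  let Q := fun y : T => K (expR y) * pairing M (fun t => t / expR y * phi (t / expR y)) in
  [/\ cintegrable leb setT P, cintegrable leb setT Q &
      cintegral leb setT P = cintegral leb setT Q].
Proof.
move=> hM [t1 t2 t3 t4] hphi; have hphi1 := test_function_id hphi.
have [p1 p2 p3 p4] := hM.
have [C1 C10 h1] := t1 _ hphi1; have [C2 C20 h2] := t2 _ hphi1.
have [C3 C30 h3] := t3 _ hphi1; have [C4 C40 h4] := t4 _ hphi1.
pose C := C1 + C2 + C3 + C4.
have bnd m D : positive_radon m -> D <= C ->
    (forall y, \int[m]_(t in `]0%R, +oo[) `|t / expR y * phi (t / expR y)| <= D * w y) ->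
    forall y, (\int[m]_t `|(t / expR y * phi (t / expR y))%:E| <= (C * w y)%:E)%E.
  move=> hm DC h y.
  rewrite (test_integral_norm hm (test_function_scale (expR_gt0 y) hphi1)) lee_fin.
  by apply: le_trans (h y) _; rewrite ler_wpM2r.
have iC1 : leb.-integrable setT (EFin \o (fun y : T => `|complex.Re (K (expR y))| * (C * w y))).
  rewrite (_ : (fun y : T => _) = (fun y : T => C * (`|complex.Re (K (expR y))| * w y))); first exact: integrableZR.
  by apply/funext => y; ring.
have iC2 : leb.-integrable setT (EFin \o (fun y : T => `|complex.Im (K (expR y))| * (C * w y))).
  rewrite (_ : (fun y : T => _) = (fun y : T => C * (`|complex.Im (K (expR y))| * w y))); first exact: integrableZR.
  by apply/funext => y; ring.
apply: (dual_convolution hM mK hphi iC1 iC2).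
- by apply: (bnd _ C1) => //; rewrite /C; lra.
- by apply: (bnd _ C2) => //; rewrite /C; lra.
- by apply: (bnd _ C3) => //; rewrite /C; lra.
- by apply: (bnd _ C4) => //; rewrite /C; lra.
Qed.

Lemma convolution_local_integrable (M : cmeasure R) : parts_radon M -> parts_all (tame w) M ->
  forall a b : R, 0 < a -> cintegrable leb `[a, b] (convolution_Psi K M).
Proof.
move=> hM ht a b a0; split; apply: local_integrable_of_expR => // phi hphi;
  have [[i1 i2] _ _] := dual_convolution_tame hM ht hphi.
- move: i1; congr (_.-integrable _ _); apply/funext => x; congr EFin; rewrite cReM /=; ring.
- move: i2; congr (_.-integrable _ _); apply/funext => x; congr EFin; rewrite cImM /=; ring.
Qed.

Lemma cintegral_expR (phi : R -> R) (h : R -> R[i]) :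
  cintegrable leb setT (fun x : T => (expR x * phi (expR x))%:C * h (expR x)) ->
  cintegral leb `]0, +oo[ (fun r => (phi r)%:C * h r) =
  cintegral leb setT (fun x : T => (expR x * phi (expR x))%:C * h (expR x)).
Proof.
move=> [/integrableP[/measurable_EFinP i1 _] /integrableP[/measurable_EFinP i2 _]].
have e1 (x : T) : complex.Re ((expR x * phi (expR x))%:C * h (expR x)) =
    complex.Re ((phi (expR x))%:C * h (expR x)) * expR x by rewrite !cReM /=; ring.
have e2 (x : T) : complex.Im ((expR x * phi (expR x))%:C * h (expR x)) =
    complex.Im ((phi (expR x))%:C * h (expR x)) * expR x by rewrite !cImM /=; ring.
apply: cplxP => /=.
  under [RHS]eq_Rintegral do rewrite e1.
  apply: (Rintegral_expR (f := fun r => complex.Re ((phi r)%:C * h r))).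
  by apply: measurable_of_expR; under eq_fun do rewrite -e1.
under [RHS]eq_Rintegral do rewrite e2.
apply: (Rintegral_expR (f := fun r => complex.Im ((phi r)%:C * h r))).
by apply: measurable_of_expR; under eq_fun do rewrite -e2.
Qed.

End dual_tame.

(** * Dilations of the convolution *)

Section weighted_kernel.
Context {R : realType}.
Local Notation T := (measurableTypeR R).
Local Notation leb := (@lebesgue_measure R).
Variables (rho : R -> R) (rho0 : R) (K : R -> R[i]).
Hypotheses (hrho : proximate_order rho rho0)
  (hKint : cintegrable leb `]0, +oo[
     (fun t => (t `^ (rho0 - 1) * prox_gamma rho rho0 t)%:C * K t)).
Local Notation w := (gamma_weight rho rho0).

Lemma weighted_kernel_integrable :
  leb.-integrable setT (EFin \o (fun y : T => `|complex.Re (K (expR y))| * w y)) /\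
  leb.-integrable setT (EFin \o (fun y : T => `|complex.Im (K (expR y))| * w y)).
Proof.
have [hr hi] := hKint.
have main (g : R -> R) :
    leb.-integrable `]0, +oo[ (EFin \o (fun t : T => (t `^ (rho0 - 1) * prox_gamma rho rho0 t) * g t)) ->
    leb.-integrable setT (EFin \o (fun y : T => `|g (expR y)| * w y)).
  move=> ig.
  have mg : measurable_fun (`]0, +oo[%classic : set T)
      (fun t : T => (t `^ (rho0 - 1) * prox_gamma rho rho0 t) * g t).
    by move/integrableP : ig => [/measurable_EFinP].
  have := integrable_norm ((integrable_expR mg).1 ig).
  congr (_.-integrable _ _); apply/funext => y; rewrite /=; congr EFin.
  have -> : expR y `^ (rho0 - 1) * prox_gamma rho rho0 (expR y) * g (expR y) * expR y = g (expR y) * w y.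
    rewrite /gamma_weight -expRM.
    have -> : expR (rho0 * y) = expR (y * (rho0 - 1)) * expR y by rewrite -expRD; congr expR; ring.
    ring.
  by rewrite normrM [X in _ * X]ger0_norm// gamma_weight_ge0.
split; [apply: (main (fun t => complex.Re (K t)))|apply: (main (fun t => complex.Im (K t)))].
  by move: hr; congr (_.-integrable _ _); apply/funext => y; congr EFin; rewrite cReM /=; ring.
by move: hi; congr (_.-integrable _ _); apply/funext => y; congr EFin; rewrite cImM /=; ring.
Qed.

End weighted_kernel.

Section key.
Context {R : realType}.
Local Notation T := (measurableTypeR R).
Local Notation leb := (@lebesgue_measure R).

Lemma pairingZ (mu : cmeasure R) (c : R) (phi : R -> R) : test_function phi ->
  pairing mu (fun t => c * phi t) = c%:C * pairing mu phi.
Proof.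
move=> hphi; rewrite !pairingE.
have mpos : measurable (`]0, +oo[%classic : set T) by exact: measurable_itv.
have Z (m : {measure set T -> \bar R}) : \int[m]_(t in `]0%R, +oo[) (c * phi t) = c * \int[m]_(t in `]0%R, +oo[) phi t.
  by apply: RintegralZ_measurable => //; apply: measurable_funTS; exact: test_function_measurable.
by apply: cplxP; rewrite !cplxE /= !Z; ring.
Qed.

Lemma nrm1_pairing (mu : cmeasure R) (phi : R -> R) (C1 C2 C3 C4 : R) : parts_radon mu -> test_function phi ->
  \int[re_pos mu]_(t in `]0%R, +oo[) `|phi t| <= C1 ->
  \int[re_neg mu]_(t in `]0%R, +oo[) `|phi t| <= C2 ->
  \int[im_pos mu]_(t in `]0%R, +oo[) `|phi t| <= C3 ->
  \int[im_neg mu]_(t in `]0%R, +oo[) `|phi t| <= C4 ->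
  nrm1 (pairing mu phi) <= C1 + C2 + C3 + C4.
Proof.
move=> [p1 p2 p3 p4] hphi h1 h2 h3 h4; rewrite pairingE /nrm1 /=.
have b1 := le_trans (le_norm_test_integral p1 hphi) h1.
have b2 := le_trans (le_norm_test_integral p2 hphi) h2.
have b3 := le_trans (le_norm_test_integral p3 hphi) h3.
have b4 := le_trans (le_norm_test_integral p4 hphi) h4.
have n1 := ler_normB (\int[re_pos mu]_(t in `]0%R, +oo[) phi t) (\int[re_neg mu]_(t in `]0%R, +oo[) phi t).
have n2 := ler_normB (\int[im_pos mu]_(t in `]0%R, +oo[) phi t) (\int[im_neg mu]_(t in `]0%R, +oo[) phi t).
lra.
Qed.

Lemma cvg_pairing (mu_ : nat -> cmeasure R) (nu : cmeasure R) (phi : R -> R) :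
  (\int[re_pos (mu_ n)]_(t in `]0%R, +oo[) phi t @[n --> \oo] --> \int[re_pos nu]_(t in `]0%R, +oo[) phi t) ->
  (\int[re_neg (mu_ n)]_(t in `]0%R, +oo[) phi t @[n --> \oo] --> \int[re_neg nu]_(t in `]0%R, +oo[) phi t) ->
  (\int[im_pos (mu_ n)]_(t in `]0%R, +oo[) phi t @[n --> \oo] --> \int[im_pos nu]_(t in `]0%R, +oo[) phi t) ->
  (\int[im_neg (mu_ n)]_(t in `]0%R, +oo[) phi t @[n --> \oo] --> \int[im_neg nu]_(t in `]0%R, +oo[) phi t) ->
  (pairing (mu_ n) phi : R[i]^o) @[n --> \oo] --> (pairing nu phi : R[i]^o).
Proof.
move=> h1 h2 h3 h4; have eR := cvgB h1 h2; have eI := cvgB h3 h4.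
apply/cvg_cplx; split.
  rewrite [in X in _ --> X]pairingE /= (_ : (fun n => complex.Re (pairing (mu_ n) phi)) =
    fun n => \int[re_pos (mu_ n)]_(t in `]0%R, +oo[) phi t - \int[re_neg (mu_ n)]_(t in `]0%R, +oo[) phi t); first exact: eR.
  by apply/funext => n; rewrite pairingE.
rewrite [in X in _ --> X]pairingE /= (_ : (fun n => complex.Im (pairing (mu_ n) phi)) =
    fun n => \int[im_pos (mu_ n)]_(t in `]0%R, +oo[) phi t - \int[im_neg (mu_ n)]_(t in `]0%R, +oo[) phi t); first exact: eI.
by apply/funext => n; rewrite pairingE.
Qed.

Variables (rho : R -> R) (rho0 : R).
Hypothesis hrho : proximate_order rho rho0.
Variables (mu : cmeasure R) (K : R -> R[i]) (s sigma : cmeasure R).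
Hypotheses (hmu : class_M rho mu) (hK : cmeasurable_fun `]0, +oo[ K)
  (hKint : cintegrable leb `]0, +oo[
     (fun t => (t `^ (rho0 - 1) * prox_gamma rho rho0 t)%:C * K t))
  (hs : has_density s (convolution_Psi K mu))
  (hsig : Fr_is_singleton (fun r => rho r + 1) s sigma).
Local Notation w := (gamma_weight rho rho0).
Local Notation V := (prox_V rho).
Let w0 := gamma_weight_ge0 hrho.
Let iw1 := (weighted_kernel_integrable hrho hKint).1.
Let iw2 := (weighted_kernel_integrable hrho hKint).2.

Lemma prox_V_add1 x : prox_V (fun r => rho r + 1) (expR x) = expR x * V (expR x).
Proof. by rewrite /prox_V -!expRM -expRD; congr expR; ring. Qed.

Let hmuR : parts_radon mu. Proof. by have [[]] := hmu. Qed.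
Let hsR : parts_radon s. Proof. by have [[]] := hs. Qed.
Let hgr : parts_all (growth rho) mu. Proof. exact: class_growth. Qed.
Let htame : parts_all (tame w) mu.
Proof. by have [h1 h2 h3 h4] := hgr; split; apply: growth_tame. Qed.

Definition kernel_pairing (nu : cmeasure R) (phi : R -> R) (y : R) : R[i] :=
  K (expR y) * pairing nu (fun t => t / expR y * phi (t / expR y)).

(** A test integral of the dilated measure s is the average over y, with
    weight K (e^y), of test integrals of the dilated measure mu. *)
Lemma pairing_scaled_density x phi : test_function phi ->
  cintegrable leb setT (kernel_pairing (azarin_scale rho mu (expR x)) phi : T -> R[i]) /\
  pairing (azarin_scale (fun r => rho r + 1) s (expR x)) phi =
  cintegral leb setT (kernel_pairing (azarin_scale rho mu (expR x)) phi : T -> R[i]).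
Proof.
move=> hphi; have hphi1 := test_function_id hphi.
have ex := expR_gt0 x; have Vx : 0 < V (expR x) := prox_V_gt0 rho rho0 x.
have hx := test_function_scale ex hphi.
pose c := expR x * V (expR x); have c0 : 0 < c by exact: mulr_gt0.
have cE : c^-1 * expR x = (V (expR x))^-1 by rewrite /c invfM mulrAC mulVf ?mul1r// gt_eqF.
have CE : (c^-1)%:C * (expR x)%:C = ((V (expR x))^-1)%:C.
  by apply: cplxP; rewrite !cplxE /= ?cE; ring.
have aux (A z p : R) : z != 0 -> A * p = z * (A / z * p).
  by move=> z0; rewrite mulrA [z * _]mulrC divfK.
have [iP iQ PQ] := dual_convolution_tame w0 hK iw1 iw2 hmuR htame hx.
have kE : (kernel_pairing (azarin_scale rho mu (expR x)) phi : T -> R[i]) =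
    fun y => (c^-1)%:C * (K (expR y) * pairing mu (fun t => t / expR y * phi (t / expR y / expR x))).
  apply/funext => y; rewrite /kernel_pairing.
  rewrite (pairing_scale rho ex hmuR (test_function_scale (expR_gt0 y) hphi1)).
  have -> : (fun t => t / expR y * phi (t / expR y / expR x)) =
      (fun t => expR x * (t / expR x / expR y * phi (t / expR x / expR y))).
    apply/funext => t; have -> : t / expR x / expR y = t / expR y / expR x by rewrite mulrAC.
    exact: aux (lt0r_neq0 ex).
  rewrite (pairingZ mu _ (test_function_scale ex (test_function_scale (expR_gt0 y) hphi1))).
  rewrite -CE; move: (K _) (pairing _ _) => k p; ring.
have e : pairing s (fun t => phi (t / expR x)) = cintegral leb setT (fun y : T =>
    K (expR y) * pairing mu (fun t => t / expR y * phi (t / expR y / expR x))).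
  exact: etrans (has_density_pairing hs hx) (etrans (cintegral_expR iP) PQ).
rewrite kE; split; first exact: (cintegrableZ _ measurableT iQ).
transitivity ((c^-1)%:C * pairing s (fun t => phi (t / expR x))).
  by rewrite (pairing_scale _ ex hsR hphi) prox_V_add1.
rewrite e; exact: esym (cintegralZ (c^-1)%:C measurableT iQ).
Qed.

Lemma scaled_pairing_bound phi : test_function phi ->
  exists2 C, 0 <= C & forall x y,
    nrm1 (pairing (azarin_scale rho mu (expR x)) (fun t => phi (t / expR y))) <= C * w y.
Proof.
move=> hphi; have [g1 g2 g3 g4] := hgr.
have [C1 C10 h1] := scaled_gamma_bound hrho g1 hphi; have [C2 C20 h2] := scaled_gamma_bound hrho g2 hphi.
have [C3 C30 h3] := scaled_gamma_bound hrho g3 hphi; have [C4 C40 h4] := scaled_gamma_bound hrho g4 hphi.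
exists (C1 + C2 + C3 + C4); first by lra.
move=> x y; rewrite !mulrDl.
apply: (nrm1_pairing _ (test_function_scale (expR_gt0 y) hphi)); [|exact: h1|exact: h2|exact: h3|exact: h4].
by have [p1 p2 p3 p4] := hmuR; split; apply: positive_radon_scale => //; exact: expR_gt0.
Qed.

(** Dominated convergence in y, with the majorant given by the integrability
    hypothesis on K. *)
Lemma cvg_kernel_pairing (x_ : nat -> R) (nu : cmeasure R) phi :
  cmeas (kernel_pairing nu phi : T -> R[i]) -> test_function phi ->
  (forall psi, test_function psi ->
    (pairing (azarin_scale rho mu (expR (x_ n))) psi : R[i]^o) @[n --> \oo] --> (pairing nu psi : R[i]^o)) ->
  (pairing (azarin_scale (fun r => rho r + 1) s (expR (x_ n))) phi : R[i]^o) @[n --> \oo]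
    --> (cintegral leb setT (kernel_pairing nu phi : T -> R[i]) : R[i]^o).
Proof.
move=> [mkr mki] hphi hc; have hphi1 := test_function_id hphi.
have [C C0 hC] := scaled_pairing_bound hphi1.
pose f_ n : T -> R[i] := kernel_pairing (azarin_scale rho mu (expR (x_ n))) phi.
pose f : T -> R[i] := kernel_pairing nu phi.
pose g (y : T) := C * (`|complex.Re (K (expR y))| * w y + `|complex.Im (K (expR y))| * w y).
have fg n y : nrm1 (f_ n y) <= g y.
  apply: le_trans (nrm1M _ _) _; rewrite /g -mulrDl mulrCA /nrm1.
  by apply: ler_wpM2l; [rewrite addr_ge0|exact: hC].
have fr n y : `|complex.Re (f_ n y)| <= g y := le_trans (nrm1_Re _) (fg n y).
have fi n y : `|complex.Im (f_ n y)| <= g y := le_trans (nrm1_Im _) (fg n y).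
have cv y : (complex.Re (f_ n y) @[n --> \oo] --> complex.Re (f y)) /\
            (complex.Im (f_ n y) @[n --> \oo] --> complex.Im (f y)).
  have /cvg_cplx[hr hi] := hc _ (test_function_scale (expR_gt0 y) hphi1).
  pose p_ n := pairing (azarin_scale rho mu (expR (x_ n))) (fun t => t / expR y * phi (t / expR y)).
  rewrite /f /kernel_pairing cReM cImM; split.
    rewrite (_ : (fun n => complex.Re (f_ n y)) = fun n => complex.Re (K (expR y)) * complex.Re (p_ n) - complex.Im (K (expR y)) * complex.Im (p_ n)); last first.
      by apply/funext => n; rewrite /f_ /kernel_pairing cReM.
    by apply: cvgB; apply: cvgM; first [exact: cvg_cst|exact: hr|exact: hi].
  rewrite (_ : (fun n => complex.Im (f_ n y)) = fun n => complex.Re (K (expR y)) * complex.Im (p_ n) + complex.Im (K (expR y)) * complex.Re (p_ n)); last first.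
    by apply/funext => n; rewrite /f_ /kernel_pairing cImM.
  by apply: cvgD; apply: cvgM; first [exact: cvg_cst|exact: hr|exact: hi].
have E n : pairing (azarin_scale (fun r => rho r + 1) s (expR (x_ n))) phi = cintegral leb setT (f_ n).
  by have [_] := pairing_scaled_density (x_ n) hphi.
have mfr n : measurable_fun setT (fun y : T => complex.Re (f_ n y)).
  by have [[/integrableP[/measurable_EFinP]]] := pairing_scaled_density (x_ n) hphi.
have mfi n : measurable_fun setT (fun y : T => complex.Im (f_ n y)).
  by have [[_ /integrableP[/measurable_EFinP]]] := pairing_scaled_density (x_ n) hphi.
have cvr : {ae leb, forall y : T, complex.Re (f_ n y) @[n --> \oo] --> complex.Re (f y)}.
  by apply/aeW => y; have [] := cv y.
have cvi : {ae leb, forall y : T, complex.Im (f_ n y) @[n --> \oo] --> complex.Im (f y)}.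
  by apply/aeW => y; have [] := cv y.
rewrite (_ : (fun n => _) = fun n => cintegral leb setT (f_ n)); last by apply/funext.
apply/cvg_cplx.
have ig : leb.-integrable setT (EFin \o g).
  by apply: integrableZR => //; apply: integrableDR.
split; rewrite /cintegral /=.
  exact: (dct_R mfr mkr cvr ig fr).
exact: (dct_R mfi mki cvi ig fi).
Qed.

End key.

(** * Limits along subsequences *)

Section dilation_continuous.
Context {R : realType}.
Local Notation T := (measurableTypeR R).

Lemma dilation_continuous (m : {measure set T -> \bar R}) (psi : R -> R) : positive_radon m ->
  test_function psi ->
  continuous (fun z : R => \int[m]_(t in `]0%R, +oo[) psi (t / expR z)).
Proof.
move=> hm hpsi z0; have [_ [a [b [a0 supp]]]] := hpsi.
(* [A, B] contains the supports of all dilations with |z - z0| <= 1. *)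
pose A := a * expR (z0 - 1); pose B := `|b| * expR (z0 + 1).
have A0 : 0 < A by rewrite mulr_gt0 ?expR_gt0.
pose M := fine (m `[A, B]%classic); have M0 : 0 <= M by exact: fine_ge0.
apply/cvgrPdist_le => e e0.
pose eps := e / (M + 1).
have M1 : 0 < M + 1 by lra.
have eps0 : 0 < eps by rewrite divr_gt0.
have epsM : eps * M <= e by rewrite /eps mulrAC ler_pdivrMr// ler_wpM2l ?(ltW e0)//; lra.
have [d d0 hd] := test_unif_continuous hpsi eps0.
have cc : `|B| * `|(expR z0)^-1 - (expR z)^-1| @[z --> z0] --> (0 : R).
  have -> : (0 : R) = `|B| * `|(expR z0)^-1 - (expR z0)^-1| by rewrite subrr normr0 mulr0.
  apply: cvgM; first exact: cvg_cst.
  have ce : {for z0, continuous (fun z : R => (expR z)^-1)}.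
    have -> : (fun z : R => (expR z)^-1) = expR \o -%R by apply/funext => z; rewrite /= expRN.
    by apply: continuous_comp; [exact: opp_continuous|exact: continuous_expR].
  apply: cvg_norm; apply: cvgB; [exact: cvg_cst|exact: ce].
have near1 : \forall z \near z0, `|B| * `|(expR z0)^-1 - (expR z)^-1| <= d.
  have hcc := (cvgr0Pnorm_le _).1 cc d d0.
  near=> z; have : `|(`|B| * `|(expR z0)^-1 - (expR z)^-1|)| <= d by near: z; exact: hcc.
  by rewrite ger0_norm// mulr_ge0.
have near2 : \forall z \near z0, `|z0 - z| < 1 by exact: (nbhsx_ballx z0 1 ltr01).
near=> z.
have zd : `|B| * `|(expR z0)^-1 - (expR z)^-1| <= d by near: z.
have z1 : `|z0 - z| <= 1.
  by apply/ltW; near: z.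
have {z1} /andP[z1 z2] : z0 - 1 <= z <= z0 + 1.
  by move: z1; rewrite ler_norml => /andP[h1 h2]; apply/andP; split; lra.
have out y t : z0 - 1 <= y <= z0 + 1 -> ~ `[A, B]%classic t -> psi (t / expR y) = 0.
  move=> /andP[y1 y2] ht; apply: supp; apply: contra_not ht; rewrite /= !in_itv/=.
  rewrite ler_pdivlMr ?expR_gt0// ler_pdivrMr ?expR_gt0// => /andP[h1 h2]; apply/andP; split.
    by apply: le_trans h1; rewrite ler_wpM2l ?(ltW a0)// ler_expR.
  apply: (le_trans h2); apply: (@le_trans _ _ (`|b| * expR y)).
    by rewrite ler_wpM2r ?expR_ge0// ler_norm.
  by rewrite ler_wpM2l// ler_expR.
pose eta t := psi (t / expR z0) - psi (t / expR z).
have outE t : ~ `[A, B]%classic t -> eta t = 0.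
  by move=> ht; rewrite /eta !out ?subrr// ?z1 ?z2//; apply/andP; split; lra.
have h0 := test_function_scale (expR_gt0 z0) hpsi; have hz := test_function_scale (expR_gt0 z) hpsi.
have heta : test_function eta.
  split; last by exists A, B.
  by move=> t; apply: cvgB; [exact: h0.1|exact: hz.1].
have etae t : `|eta t| <= eps.
  have [tAB|tAB] := pselect (`[A, B]%classic t); last by rewrite outE// normr0 ltW.
  apply: hd; rewrite -mulrBr normrM; apply: le_trans zd; rewrite ler_wpM2r//.
  move: tAB; rewrite /= in_itv/= => /andP[At tB].
  rewrite ger0_norm; last exact: le_trans (ltW A0) At.
  exact: le_trans tB (ler_norm _).
have mpos : measurable (`]0, +oo[%classic : set T) by exact: measurable_itv.
have bb := test_integral_bound hm heta A0 outE etae.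
rewrite -(RintegralB mpos (test_integrable hm h0) (test_integrable hm hz)).
apply: (le_trans (le_norm_test_integral hm heta)).
exact: (le_trans bb epsM).
Unshelve. all: by end_near. Qed.

End dilation_continuous.

Section limits.
Context {R : realType}.
Local Notation T := (measurableTypeR R).
Local Notation leb := (@lebesgue_measure R).
Variables (rho : R -> R) (rho0 : R).
Hypothesis hrho : proximate_order rho rho0.
Variables (mu : cmeasure R) (K : R -> R[i]) (s sigma : cmeasure R).
Hypotheses (hmu : class_M rho mu) (hK : cmeasurable_fun `]0, +oo[ K)
  (hKint : cintegrable leb `]0, +oo[
     (fun t => (t `^ (rho0 - 1) * prox_gamma rho rho0 t)%:C * K t))
  (hs : has_density s (convolution_Psi K mu))
  (hsig : Fr_is_singleton (fun r => rho r + 1) s sigma).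
Local Notation w := (gamma_weight rho rho0).
Local Notation V := (prox_V rho).
Local Notation rho1 := (fun r => rho r + 1).
Let w0 := gamma_weight_ge0 hrho.
Let iw1 := (weighted_kernel_integrable hrho hKint).1.
Let iw2 := (weighted_kernel_integrable hrho hKint).2.

Let hsR : parts_radon s. Proof. by have [[]] := hs. Qed.
Let hsigR : parts_radon sigma. Proof. by have [[[]]] := hsig. Qed.

Lemma cvg_increasing_subseq (X : topologicalType) (u : nat -> X) (l : X) (g : nat -> nat) :
  increasing_seq g -> u n @[n --> \oo] --> l -> u (g n) @[n --> \oo] --> l.
Proof. by move=> gI ul; exact: (cvg_comp _ _ (increasing_seq_cvg gI) ul). Qed.

Lemma expR_seq_cvgy (x_ : nat -> R) : x_ n @[n --> \oo] --> +oo -> expR (x_ n) @[n --> \oo] --> +oo.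
Proof. by move=> xoo; exact: (cvg_comp _ _ xoo expR_cvgy). Qed.

(** Helly's theorem gives a limit nu of the dilations of mu. Along the same
    subsequence the dilations of s converge to the measure whose density is
    the convolution of K with nu; it belongs to the limit set of s, so it is
    sigma. Hence all limits nu solve the same convolution equation. *)
Lemma subsequence_limit (x_ : nat -> R) : x_ n @[n --> \oo] --> +oo ->
  exists f nu, [/\ increasing_seq f, parts_radon nu & parts_all (tame (fun y => expR (rho0 * y))) nu] /\
  [/\ forall phi, test_function phi ->
     (pairing (azarin_scale rho mu (expR (x_ (f n)))) phi : R[i]^o) @[n --> \oo] --> (pairing nu phi : R[i]^o),
    forall phi, test_function phi ->
     (pairing (azarin_scale rho1 s (expR (x_ (f n)))) phi : R[i]^o) @[n --> \oo] --> (pairing sigma phi : R[i]^o) &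
    forall phi, test_function phi ->
      cintegrable leb setT (kernel_pairing K nu phi : T -> R[i]) /\
      cintegral leb setT (kernel_pairing K nu phi : T -> R[i]) = pairing sigma phi].
Proof.
move=> xoo; have [g1 g2 g3 g4] := class_growth hmu.
have [f1 I1 [nu1 p1 c1]] := part_limit hrho x_ g1.
have [f2 I2 [nu2 p2 c2]] := part_limit hrho (x_ \o f1) g2.
have [f3 I3 [nu3 p3 c3]] := part_limit hrho (x_ \o f1 \o f2) g3.
have [f4 I4 [nu4 p4 c4]] := part_limit hrho (x_ \o f1 \o f2 \o f3) g4.
pose f := f1 \o (f2 \o (f3 \o f4)).
have I34 := increasing_seq_comp I3 I4; have I234 := increasing_seq_comp I2 I34.
have fI : increasing_seq f := increasing_seq_comp I1 I234.
pose nu := CMeasure nu1 nu2 nu3 nu4.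
have hnu : parts_radon nu by [].
have xf : x_ (f n) @[n --> \oo] --> +oo by exact: (cvg_comp _ _ (increasing_seq_cvg fI) xoo).
have d1 phi (h : test_function phi) := cvg_increasing_subseq I234 (c1 phi h).
have d2 phi (h : test_function phi) := cvg_increasing_subseq I34 (c2 phi h).
have d3 phi (h : test_function phi) := cvg_increasing_subseq I4 (c3 phi h).
have te : parts_all (tame (fun y => expR (rho0 * y))) nu.
  split; [exact: (limit_tame hrho g1 xf d1)|exact: (limit_tame hrho g2 xf d2)
         |exact: (limit_tame hrho g3 xf d3)|exact: (limit_tame hrho g4 xf c4)].
have tw : parts_all (tame w) nu.
  by have [h1 h2 h3 h4] := te; split; apply: (tame_le (gamma_weight_ge hrho)).
have cmu phi : test_function phi ->
    (pairing (azarin_scale rho mu (expR (x_ (f n)))) phi : R[i]^o) @[n --> \oo] --> (pairing nu phi : R[i]^o).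
  by move=> h; apply: cvg_pairing; [exact: d1|exact: d2|exact: d3|exact: c4].
have dual phi (h : test_function phi) := dual_convolution_tame w0 hK iw1 iw2 hnu tw h.
have [sig' hsig'] := density_exists (convolution_local_integrable w0 hK iw1 iw2 hnu tw).
have val phi : test_function phi ->
    cintegral leb setT (kernel_pairing K nu phi : T -> R[i]) = pairing sig' phi.
  move=> h; have [iP iQ PQ] := dual phi h.
  exact: esym (etrans (has_density_pairing hsig' h) (etrans (cintegral_expR iP) PQ)).
have cs phi : test_function phi ->
    (pairing (azarin_scale rho1 s (expR (x_ (f n)))) phi : R[i]^o) @[n --> \oo] --> (pairing sig' phi : R[i]^o).
  move=> h; rewrite -(val phi h).
  apply: (cvg_kernel_pairing hrho hmu hK hKint hs (x_ := x_ \o f) _ h cmu).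
  by have [_ /cintegrable_measurable iQ _] := dual phi h.
have FR : Fr rho1 s sig'.
  split; first by have [] := hsig'.
  exists (fun n => expR (x_ (f n))); split; first exact: expR_seq_cvgy.
  by move=> phi h; exact: cs.
have eqs : eq_cmeasure sig' sigma by exact: hsig.2.
have hs' : parts_radon sig' by have [[]] := hsig'.
have pe phi : test_function phi -> pairing sig' phi = pairing sigma phi.
  exact: (eq_cmeasure_pairing hs' hsigR eqs).
exists f, nu; split; first exact: And3 fI hnu te.
split; first exact: cmu.
- by move=> phi h; rewrite -(pe phi h); exact: cs.
- move=> phi h; have [_ iQ _] := dual phi h; split; first exact: iQ.
  by rewrite -(pe phi h); exact: val.
Qed.

Lemma cvg_cplx_unique (u : nat -> R[i]) (l l' : R[i]) :
  (u n : R[i]^o) @[n --> \oo] --> (l : R[i]^o) -> (u n : R[i]^o) @[n --> \oo] --> (l' : R[i]^o) -> l = l'.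
Proof.
move=> /cvg_cplx[h1 h2] /cvg_cplx[k1 k2].
by apply: cplxP; [exact: (cvg_unique _ h1 k1)|exact: (cvg_unique _ h2 k2)].
Qed.

Lemma cvg_cplxR (u : nat -> R) (v : nat -> R[i]) (a : R) (l : R[i]) :
  u n @[n --> \oo] --> a -> (v n : R[i]^o) @[n --> \oo] --> (l : R[i]^o) ->
  ((u n)%:C * v n : R[i]^o) @[n --> \oo] --> (a%:C * l : R[i]^o).
Proof.
move=> ua /cvg_cplx[h1 h2]; apply/cvg_cplx; split.
  rewrite (_ : (fun n => _) = fun n => u n * complex.Re (v n)); last first.
    by apply/funext => n; rewrite cReM /= mul0r subr0.
  by rewrite cReM /= mul0r subr0; exact: cvgM.
rewrite (_ : (fun n => _) = fun n => u n * complex.Im (v n)); last first.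
  by apply/funext => n; rewrite cImM /= mul0r addr0.
by rewrite cImM /= mul0r addr0; exact: cvgM.
Qed.

Let aux (a b c d : R) : a != 0 -> b != 0 -> c != 0 -> d != 0 ->
  d * (b / a) * (c * d * b)^-1 = (c * a)^-1.
Proof. by move=> a0 b0 c0 d0; field; rewrite a0 b0 c0 d0. Qed.

(** The dilations of s by T and by T e^h have the same limit sigma, and they
    are images of each other under a dilation by e^h up to the factor e^h V
    (T e^h) / V (T), which tends to e^((rho0 + 1) h). *)
Lemma limit_homogeneous (h : R) phi : test_function phi ->
  pairing sigma (fun t => phi (t / expR h)) = (expR ((rho0 + 1) * h))%:C * pairing sigma phi.
Proof.
move=> hphi; have hphih := test_function_scale (expR_gt0 h) hphi.
have noo : (n%:R : R) @[n --> \oo] --> +oo by exact: cvgr_idn.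
have xoo : (n%:R + h : R) @[n --> \oo] --> +oo.
  apply/cvgryPge => A; have /cvgryPge/(_ (A - h)) := noo; apply: filterS => n; lra.
have [f [_ [[fI _ _] [_ cf _]]]] := subsequence_limit xoo.
have foo : ((f n)%:R : R) @[n --> \oo] --> +oo by exact: (cvg_comp _ _ (increasing_seq_cvg fI) noo).
have [g [_ [[gI _ _] [_ cg _]]]] := subsequence_limit foo.
have l1 := cg _ hphih.
have l2 := cvg_increasing_subseq gI (cf _ hphi).
pose x n : R := (f (g n))%:R.
have xxoo : x n @[n --> \oo] --> +oo by exact: (cvg_comp _ _ (increasing_seq_cvg gI) foo).
pose r n := expR h * (V (expR (x n + h)) / V (expR (x n))).
have rl : r n @[n --> \oo] --> expR h * expR (rho0 * h).
  have l : V (expR (x n + h)) / V (expR (x n)) @[n --> \oo] --> expR (rho0 * h).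
    exact: (cvg_comp _ (fun x => V (expR (x + h)) / V (expR x)) xxoo (@prox_V_ratio_cvg R rho rho0 hrho h)).
  by apply: cvgM; [exact: cvg_cst|exact: l].
have -> : expR ((rho0 + 1) * h) = expR h * expR (rho0 * h) by rewrite -expRD; congr expR; ring.
apply: (cvg_cplx_unique l1).
have E : (fun n => pairing (azarin_scale rho1 s (expR (f (g n))%:R)) (fun t => phi (t / expR h))) =
    (fun n => (r n)%:C * pairing (azarin_scale rho1 s (expR ((f (g n))%:R + h))) phi).
  apply/funext => n; rewrite -/(x n).
  apply: (etrans (pairing_scale rho1 (expR_gt0 (x n)) hsR hphih)).
  apply/esym; apply: (etrans (congr1 (fun z => (r n)%:C * z)
    (pairing_scale rho1 (expR_gt0 (x n + h)) hsR hphi))); apply/esym; cbv beta.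
  have -> : (fun t => phi (t / expR (x n) / expR h)) = (fun t => phi (t / expR (x n + h))).
    by apply/funext => t; rewrite -mulrA -invfM -expRD.
  rewrite mulrA; congr (_ * _); rewrite !prox_V_add1.
  have v1 : V (expR (x n)) != 0 by rewrite gt_eqF// (prox_V_gt0 rho rho0).
  have v2 : V (expR (x n + h)) != 0 by rewrite gt_eqF// (prox_V_gt0 rho rho0).
  have e1 : expR (x n) != 0 by rewrite gt_eqF ?expR_gt0.
  have e2 : expR h != 0 by rewrite gt_eqF ?expR_gt0.
  have e3 : r n * (expR (x n + h) * V (expR (x n + h)))^-1 = (expR (x n) * V (expR (x n)))^-1.
    have -> : expR (x n + h) * V (expR (x n + h)) = expR (x n) * expR h * V (expR (x n + h)).
      by rewrite -expRD.
    exact: aux.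
  by apply: cplxP; rewrite !cplxE /= ?e3; ring.
rewrite E; exact: (cvg_cplxR rl l2).
Qed.

End limits.

(** * Homogeneous measures *)

Section haar.
Context {R : realType}.
Local Notation T := (measurableTypeR R).
Local Notation leb := (@lebesgue_measure R).

Lemma compact_support_integrable (F : R -> R) (A B : R) : continuous F ->
  (forall x, ~ `[A, B]%classic x -> F x = 0) -> leb.-integrable setT (EFin \o (F : T -> R)).
Proof.
move=> cF supp.
have mI : measurable (`[A, B]%classic : set T) by exact: measurable_itv.
have i1 : leb.-integrable (`[A, B]%classic : set T) (EFin \o (F : T -> R)).
  apply: continuous_compact_integrable; first exact: segment_compact.
  exact: continuous_subspaceT.
have := (integrable_mkcond _ mI).1 i1.
congr (_.-integrable _ _); apply/funext => x; rewrite patchE.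
by case: (boolP (x \in _)) => //; rewrite notin_setE => /supp /= ->.
Qed.

Lemma test_expR_integrable (phi : R -> R) (g : R -> R) : test_function phi -> continuous g ->
  leb.-integrable setT (EFin \o (fun x : T => phi (expR x) * g x)).
Proof.
move=> [c [a [b [a0 supp]]]] cg.
have e (x : R) : {for x, continuous (fun x => phi (expR x))}.
  by apply: (@continuous_comp _ _ _ expR phi); [exact: continuous_expR|exact: c].
apply: (@compact_support_integrable (fun x => phi (expR x) * g x) (ln a) (ln `|b|)).
  by move=> x; apply: cvgM; [exact: e|exact: cg].
move=> x hx; rewrite supp ?mul0r//; apply: contra_not hx; rewrite /= !in_itv/= => /andP[h1 h2].
have b0 : 0 < `|b| by apply: lt_le_trans (expR_gt0 x) (le_trans h2 (ler_norm b)).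
rewrite -ler_expR -(ler_expR x) !lnK ?posrE// h1 /=.
exact: le_trans h2 (ler_norm b).
Qed.

Lemma test_function_div (psi : R -> R) : test_function psi ->
  exists2 phi, test_function phi & psi = (fun u => u * phi u).
Proof.
move=> [c [a [b [a0 supp]]]].
have m0 u : Num.max u a != 0 by rewrite gt_eqF// lt_max a0 orbT.
exists (fun u => psi u / Num.max u a); last first.
  apply/funext => u; have [ua|ua] := leP a u.
    by rewrite mulrC divfK// gt_eqF//; exact: lt_le_trans ua.
  by rewrite supp ?mul0r ?mulr0// /= in_itv/= leNgt ua.
split; last by exists a, b; split => // x /supp ->; rewrite mul0r.
have cm : continuous (fun u : R => Num.max u a).
  by move=> x; apply: (@continuous_max _ _ id (cst a)); [exact: cvg_id|exact: cvg_cst].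
by move=> x; apply: cvgM; [exact: c|apply: cvgV; [exact: m0|exact: cm]].
Qed.

Lemma cintegral_realM (f : T -> R) (z : R[i]) : leb.-integrable setT (EFin \o f) ->
  cintegral leb setT (fun x => (f x)%:C * z) = (\int[leb]_x f x)%:C * z.
Proof.
move=> i; have mf : measurable_fun setT f by move/integrableP : i => [/measurable_EFinP].
have Z (c : R) : \int[leb]_x (c * f x) = c * \int[leb]_x f x.
  exact: (RintegralZ_measurable leb c measurableT mf).
apply: cplxP; rewrite !cplxE /= mul0r ?subr0 ?addr0 mulrC -Z; apply: eq_Rintegral => x _;
  by rewrite !cplxE /=; ring.
Qed.

(** The integral of psi against r^(a - 1) dr. *)
Definition log_moment (a : R) (psi : R -> R) : R := \int[leb]_x (psi (expR x) * expR (a * x)).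

Lemma continuous_expRM (a : R) : continuous (fun x : R => expR (a * x)).
Proof.
move=> x; apply: (@continuous_comp _ _ _ ( *%R a) expR); last exact: continuous_expR.
exact: mulrl_continuous.
Qed.

Lemma log_moment_integrable (a : R) (psi : R -> R) : test_function psi ->
  leb.-integrable setT (EFin \o (fun x : T => psi (expR x) * expR (a * x))).
Proof. by move=> h; apply: test_expR_integrable => //; exact: continuous_expRM. Qed.

Lemma power_density_pairing (a : R) (c : R[i]) (psi : R -> R) : test_function psi ->
  cintegral leb `]0, +oo[ (fun r => (psi r)%:C * (c * (r `^ a)%:C)) = (log_moment (a + 1) psi)%:C * c.
Proof.
move=> hpsi; have im := log_moment_integrable (a + 1) hpsi.
have E : (fun x : T => (expR x * psi (expR x))%:C * (c * (expR x `^ a)%:C)) =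
    (fun x : T => (psi (expR x) * expR ((a + 1) * x))%:C * c).
  apply/funext => x; rewrite -expRM.
  have -> : expR ((a + 1) * x) = expR x * expR (x * a) by rewrite -expRD; congr expR; ring.
  by apply: cplxP; rewrite !cplxE /=; ring.
rewrite /log_moment -cintegral_realM// -E; apply: cintegral_expR; rewrite E.
have Z (u : R) : leb.-integrable setT (EFin \o (fun x : T => u * (psi (expR x) * expR ((a + 1) * x)))).
  exact: integrableZR.
split.
  move: (Z (complex.Re c)); congr (_.-integrable _ _); apply/funext => x; congr EFin.
  by rewrite !cplxE /=; ring.
move: (Z (complex.Im c)); congr (_.-integrable _ _); apply/funext => x; congr EFin.
by rewrite !cplxE /=; ring.
Qed.

Lemma power_density_exists (a : R) (c : R[i]) : exists nu, has_density nu (fun t => c * (t `^ a)%:C).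
Proof.
apply: density_exists => u v u0.
have H (z : R) : leb.-integrable `[u, v] (EFin \o (fun t : T => z * t `^ a)).
  apply: (local_integrable_of_expR (h := fun t => z * t `^ a)) => // phi hphi.
  have := integrableZR z measurableT (log_moment_integrable (a + 1) hphi).
  congr (_.-integrable _ _); apply/funext => x; congr EFin; rewrite -expRM.
  have -> : expR ((a + 1) * x) = expR x * expR (x * a) by rewrite -expRD; congr expR; ring.
  by ring.
split.
  move: (H (complex.Re c)); congr (_.-integrable _ _); apply/funext => x; congr EFin.
  by rewrite !cplxE /=; ring.
move: (H (complex.Im c)); congr (_.-integrable _ _); apply/funext => x; congr EFin.
by rewrite !cplxE /=; ring.
Qed.

Lemma log_moment_plateau (a : R) : 0 < log_moment a (plateau 1 3 1).
Proof.
pose kappa := plateau (1 : R) 3 1.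
have hk : test_function kappa by exact: plateau_test.
have k0 x : 0 <= kappa x by have /andP[] := plateau_itv (1 : R) 3 1 x.
have k1 x : 2 <= x <= 3 -> kappa x = 1.
  move=> /andP[x2 x3]; rewrite /kappa /plateau !divr1.
  have h1 : 1 <= Num.min (x - 1) (3 + 1 - x) by rewrite le_min; apply/andP; split; lra.
  by rewrite (min_idPl h1); apply/max_idPr; exact: ler01.
pose A : R := ln 2; pose B : R := ln 3.
have eA : expR A = 2 by rewrite lnK ?posrE.
have eB : expR B = 3 by rewrite lnK ?posrE.
have AB : A < B by rewrite -ltr_expR eA eB; lra.
have A0 : 0 < A by rewrite -ltr_expR eA expR0; lra.
pose d := expR (- (`|a| * B)).
have d0 : 0 < d by exact: expR_gt0.
have low x : A <= x <= B -> d <= kappa (expR x) * expR (a * x).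
  move=> /andP[x1 x2]; rewrite k1; last first.
    by rewrite -eA -eB !ler_expR x1 x2.
  rewrite mul1r ler_expR.
  have h1 : `|a| * x <= `|a| * B by rewrite ler_wpM2l.
  have x0 : 0 <= x by lra.
  have h2 : - (`|a| * x) <= a * x.
    by rewrite -mulNr ler_wpM2r// lerNl -normrN ler_norm.
  lra.
have mI : measurable (`[A, B]%classic : set T) by exact: measurable_itv.
have ii := log_moment_integrable a hk.
have i1 : leb.-integrable (`[A, B]%classic : set T) (EFin \o (fun x : T => kappa (expR x) * expR (a * x))).
  exact: (integrableS measurableT mI (@subsetT _ _) ii).
have fI : (leb `[A, B]%classic < +oo)%E by rewrite lebesgue_measure_itv/= lte_fin AB ltry.
have ic : leb.-integrable (`[A, B]%classic : set T) (EFin \o (cst d : T -> R)).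
  apply: measurable_bounded_integrable; [exact: mI|exact: fI|exact: measurable_cst|].
  by exists `|d|; split => [|u Cu x _ /=]; [exact: num_real|exact: ltW].
have vol : fine (leb `[A, B]%classic) = B - A by rewrite lebesgue_measure_itv/= lte_fin AB.
apply: (@lt_le_trans _ _ (d * (B - A))); first by rewrite mulr_gt0// subr_gt0.
apply: (@le_trans _ _ (\int[leb]_(x in `[A, B]) (kappa (expR x) * expR (a * x)))).
  rewrite -vol -(Rintegral_cst leb mI d).
  by apply: (le_Rintegral mI ic i1) => x; rewrite /= in_itv/= => /low.
rewrite /log_moment [leLHS]Rintegral_mkcond.
have i2 : leb.-integrable setT (EFin \o ((fun x : T => kappa (expR x) * expR (a * x)) \_ `[A, B])).
  have := (integrable_mkcond _ mI).1 i1; congr (_.-integrable _ _).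
  by apply/funext => x; rewrite /= !patchE; case: ifP.
apply: (le_Rintegral measurableT i2 ii) => x _; rewrite patchE.
by case: ifP => // _; apply: mulr_ge0; [exact: k0|exact: expR_ge0].
Qed.

(** Uniqueness of Haar measure in multiplicative form: the double integral
    of psi and a fixed kappa against sigma can be evaluated by homogeneity
    in either variable, so that the pairing with sigma is proportional to
    the log moment. *)
Lemma homogeneous_pairing (sigma : cmeasure R) (a : R) : parts_radon sigma ->
  (forall h phi, test_function phi ->
    pairing sigma (fun t => phi (t / expR h)) = (expR (a * h))%:C * pairing sigma phi) ->
  exists c : R[i], forall psi, test_function psi -> pairing sigma psi = (log_moment a psi)%:C * c.
Proof.
move=> hsig hom.
pose kappa := plateau (1 : R) 3 1.
have hk : test_function kappa by exact: plateau_test.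
have J0 : 0 < log_moment a kappa := log_moment_plateau a.
have inv1 : ((log_moment a kappa)^-1)%:C * (log_moment a kappa)%:C = 1 :> R[i].
  by apply: cplxP; rewrite !cplxE /= ?(mulVf (lt0r_neq0 J0)); ring.
exists (((log_moment a kappa)^-1)%:C * pairing sigma kappa) => psi hpsi.
have [phi hphi psiE] := test_function_div hpsi.
have hphi1 := test_function_id hphi; rewrite -psiE in hphi1.
have [p1 p2 p3 p4] := hsig.
pose I (m : {measure set T -> \bar R}) (y : R) := \int[m]_(t in `]0%R, +oo[) `|psi (t / expR y)|.
pose w y := I (re_pos sigma) y + I (re_neg sigma) y + I (im_pos sigma) y + I (im_neg sigma) y.
have I0 m y : 0 <= I m y by apply: Rintegral_ge0.
have Ic m : positive_radon m -> continuous (I m).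
  by move=> hm; exact: (dilation_continuous hm (test_function_norm hpsi)).
have wc : continuous w.
  by move=> y; apply: cvgD; [apply: cvgD; [apply: cvgD|]|]; exact: Ic.
have iw1 : leb.-integrable setT (EFin \o (fun y : T => `|complex.Re ((kappa (expR y))%:C : R[i])| * w y)).
  exact: (test_expR_integrable (test_function_norm hk) wc).
have iw2 : leb.-integrable setT (EFin \o (fun y : T => `|complex.Im ((kappa (expR y))%:C : R[i])| * w y)).
  rewrite (_ : _ \o _ = cst 0%E); first exact: integrable0.
  by apply/funext => y /=; rewrite normr0 mul0r.
have mk : cmeasurable_fun `]0, +oo[ (fun t : T => (kappa t)%:C).
  split; last exact: measurable_cst.
  by apply: measurable_funTS; exact: test_function_measurable.
have bnd m : positive_radon m -> (forall y, I m y <= w y) ->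
    forall y, (\int[m]_t `|(t / expR y * phi (t / expR y))%:E| <= (w y)%:E)%E.
  move=> hm h y; have e : (fun t => t / expR y * phi (t / expR y)) = (fun t => psi (t / expR y)).
    by rewrite psiE.
  have := test_integral_norm hm (test_function_scale (expR_gt0 y) hpsi).
  rewrite psiE => ->; rewrite lee_fin; have := h y; rewrite /I psiE; apply.
have l1 y : I (re_pos sigma) y <= w y.
  have := I0 (re_neg sigma) y; have := I0 (im_pos sigma) y; have := I0 (im_neg sigma) y; rewrite /w; lra.
have l2 y : I (re_neg sigma) y <= w y.
  have := I0 (re_pos sigma) y; have := I0 (im_pos sigma) y; have := I0 (im_neg sigma) y; rewrite /w; lra.
have l3 y : I (im_pos sigma) y <= w y.
  have := I0 (re_neg sigma) y; have := I0 (re_pos sigma) y; have := I0 (im_neg sigma) y; rewrite /w; lra.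
have l4 y : I (im_neg sigma) y <= w y.
  have := I0 (re_neg sigma) y; have := I0 (im_pos sigma) y; have := I0 (re_pos sigma) y; rewrite /w; lra.
have [_ _ PQ] := dual_convolution hsig mk hphi iw1 iw2 (bnd _ p1 l1) (bnd _ p2 l2) (bnd _ p3 l3) (bnd _ p4 l4).
have EP : cintegral leb setT (fun x : T => (expR x * phi (expR x))%:C *
    convolution_Psi (fun t : T => (kappa t)%:C) sigma (expR x)) = (log_moment a psi)%:C * pairing sigma kappa.
  rewrite /log_moment -(cintegral_realM _ (log_moment_integrable a hpsi)); apply: eq_cintegral => x _.
  rewrite [convolution_Psi _ _ _](hom x kappa hk) mulrA; congr (_ * _).
  by rewrite psiE; apply: cplxP; rewrite !cplxE /=; ring.
have EQ : cintegral leb setT (fun y : T => (kappa (expR y))%:C *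
    pairing sigma (fun t => t / expR y * phi (t / expR y))) = (log_moment a kappa)%:C * pairing sigma psi.
  rewrite /log_moment -(cintegral_realM _ (log_moment_integrable a hk)); apply: eq_cintegral => y _.
  have := hom y psi hpsi; rewrite {1}psiE => ->; rewrite mulrA; congr (_ * _).
  by apply: cplxP; rewrite !cplxE /=; ring.
have H : (log_moment a psi)%:C * pairing sigma kappa = (log_moment a kappa)%:C * pairing sigma psi.
  exact: etrans (esym EP) (etrans PQ EQ).
rewrite mulrCA H mulrA.
by rewrite inv1 mul1r.
Qed.

End haar.

(** * The Tauberian theorem *)

Section tauberian.
Context {R : realType}.
Local Notation T := (measurableTypeR R).
Local Notation leb := (@lebesgue_measure R).
Variables (rho : R -> R) (rho0 : R).
Hypothesis hrho : proximate_order rho rho0.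
Variables (mu : cmeasure R) (K : R -> R[i]) (s sigma : cmeasure R).
Hypotheses (hmu : class_M rho mu) (hK : cmeasurable_fun `]0, +oo[ K)
  (hKint : cintegrable leb `]0, +oo[
     (fun t => (t `^ (rho0 - 1) * prox_gamma rho rho0 t)%:C * K t))
  (hKne0 : forall lambda : R,
     cintegral leb `]0, +oo[ (fun t => K t * cpow t ((rho0 - 1) -i* lambda)) != 0)
  (hs : has_density s (convolution_Psi K mu))
  (hsig : Fr_is_singleton (fun r => rho r + 1) s sigma).
Local Notation w := (gamma_weight rho rho0).

Definition log_kernel (y : T) : R[i] := (expR (rho0 * y))%:C * K (expR y).
Definition kernel_mass : R[i] := cintegral leb `]0, +oo[ (fun t => K t * (t `^ (rho0 - 1))%:C).

Let g (y : T) := `|complex.Re (K (expR y))| * w y + `|complex.Im (K (expR y))| * w y.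
Let ig : leb.-integrable setT (EFin \o g).
Proof.
have [i1 i2] := weighted_kernel_integrable hrho hKint.
exact: (integrableDR measurableT i1 i2).
Qed.

Let mlog : cmeas log_kernel.
Proof.
have [m1 m2] := hK.
apply: cmeasM; last by split; [exact: (measurable_comp_expR m1)|exact: (measurable_comp_expR m2)].
by apply: cmeasR; apply: continuous_measurable_fun; exact: continuous_expRM.
Qed.

Let log_kernel_le y : nrm1 (log_kernel y) <= g y.
Proof.
rewrite /log_kernel nrm1_RM ger0_norm ?expR_ge0// /g -mulrDl mulrC.
by rewrite ler_wpM2l ?nrm1_ge0// gamma_weight_ge.
Qed.

Lemma log_kernel_integrable : cintegrable leb setT log_kernel.
Proof. by apply: (cintegrable_dom measurableT mlog ig) => y _; exact: log_kernel_le. Qed.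

Lemma khat_log_kernel lambda : khat log_kernel lambda =
  cintegral leb `]0, +oo[ (fun t => K t * cpow t ((rho0 - 1) -i* lambda)).
Proof.
pose h (t : R) := K t * cpow t ((rho0 - 1) -i* lambda).
have E : (fun x : T => (expR x * 1)%:C * h (expR x)) = (fun x : T => log_kernel x * cexp (- lambda * x)).
  apply/funext => x; rewrite /h /log_kernel /cpow /= expRK mulr1 -/(cexp (- lambda * x)) -expRM.
  have -> : expR (rho0 * x) = expR x * expR (x * (rho0 - 1)) by rewrite -expRD; congr expR; ring.
  by rewrite rmorphM /=; ring.
have mm : cmeas (fun x : T => log_kernel x * cexp (- lambda * x)).
  apply: cmeasM; first exact: mlog.
  by apply: cmeas_cexp; apply: continuous_measurable_fun; exact: mulrl_continuous.
have bd (x : T) : nrm1 (log_kernel x * cexp (- lambda * x)) <= 2 * g x.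
  apply: le_trans (nrm1M _ _) _; rewrite mulrC; apply: ler_pM.
  - exact: nrm1_ge0.
  - exact: nrm1_ge0.
  - exact: nrm1_cexp.
  - exact: log_kernel_le.
have i : cintegrable leb setT (fun x : T => (expR x * 1)%:C * h (expR x)).
  rewrite E; apply: (cintegrable_dom measurableT mm (integrableZR 2 measurableT ig)) => x _.
  exact: bd.
transitivity (cintegral leb `]0, +oo[ (fun r => (1%:C : R[i]) * h r)); last first.
  by apply: eq_cintegral => x _; rewrite mul1r.
rewrite (cintegral_expR (phi := fun _ => 1) i); congr (cintegral _ _ _).
by rewrite E.
Qed.

Lemma kernel_massE : kernel_mass = khat log_kernel 0.
Proof.
rewrite khat_log_kernel; apply: eq_cintegral => t _; congr (_ * _).
by rewrite /cpow /= oppr0 mul0r cos0 sin0; apply: cplxP; rewrite !cplxE /=; ring.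
Qed.

Lemma kernel_mass_neq0 : kernel_mass != 0.
Proof. by rewrite kernel_massE khat_log_kernel. Qed.

Let scale_out (A z p : R) : z != 0 -> A * p = z * (A / z * p).
Proof. by move=> z0; rewrite mulrA [z * _]mulrC divfK. Qed.

(** In the variable ln r the convolution equation says that the correlation
    of k with H is constant, where H z is e^(- rho0 z) times the pairing of
    nu with the dilation by e^z of u phi (u). H is bounded and continuous,
    and subtracting a suitable constant from H makes the correlation 0.
    Wiener's theorem then shows that H is that constant. *)
Lemma limit_pairing (nu : cmeasure R) phi : parts_radon nu ->
  parts_all (tame (fun y => expR (rho0 * y))) nu ->
  (forall phi, test_function phi ->
      cintegrable leb setT (kernel_pairing K nu phi : T -> R[i]) /\
      cintegral leb setT (kernel_pairing K nu phi : T -> R[i]) = pairing sigma phi) ->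
  test_function phi ->
  pairing nu (fun u => u * phi u) = pairing sigma phi / kernel_mass.
Proof.
move=> hnu te key hphi; have hphi1 := test_function_id hphi.
have [p1 p2 p3 p4] := hnu; have [t1 t2 t3 t4] := te.
pose phi1 (u : R) := u * phi u.
pose p (z : R) := pairing nu (fun t => phi1 (t / expR z)).
pose d := pairing sigma phi / kernel_mass.
pose H (z : T) : R[i] := (expR (- rho0 * z))%:C * p z - d.
have [C1 C10 h1] := t1 _ hphi1; have [C2 C20 h2] := t2 _ hphi1.
have [C3 C30 h3] := t3 _ hphi1; have [C4 C40 h4] := t4 _ hphi1.
have pb z : nrm1 (p z) <= (C1 + C2 + C3 + C4) * expR (rho0 * z).
  rewrite !mulrDl; apply: (nrm1_pairing hnu (test_function_scale (expR_gt0 z) hphi1)).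
  - exact: h1.
  - exact: h2.
  - exact: h3.
  - exact: h4.
have Hb z : nrm1 (H z) <= C1 + C2 + C3 + C4 + nrm1 d.
  apply: le_trans (nrm1D _ _) _; rewrite nrm1N lerD2r nrm1_RM ger0_norm ?expR_ge0//.
  apply: le_trans (ler_wpM2l (expR_ge0 _) (pb z)) _.
  rewrite mulrCA -expRD (_ : - rho0 * z + rho0 * z = 0); last by ring.
  by rewrite expR0 mulr1.
have cp m : positive_radon m -> continuous (fun z : R => \int[m]_(t in `]0%R, +oo[) phi1 (t / expR z)).
  by move=> hm; exact: dilation_continuous.
have ReH (z : R) : complex.Re (H z) = expR (- rho0 * z) *
    (\int[re_pos nu]_(t in `]0%R, +oo[) phi1 (t / expR z) - \int[re_neg nu]_(t in `]0%R, +oo[) phi1 (t / expR z))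
    - complex.Re d.
  by rewrite /H /p pairingE !cplxE /=; ring.
have ImH (z : R) : complex.Im (H z) = expR (- rho0 * z) *
    (\int[im_pos nu]_(t in `]0%R, +oo[) phi1 (t / expR z) - \int[im_neg nu]_(t in `]0%R, +oo[) phi1 (t / expR z))
    - complex.Im d.
  by rewrite /H /p pairingE !cplxE /=; ring.
have cRe : continuous (fun z : R => complex.Re (H z)).
  have -> : (fun z : R => complex.Re (H z)) = _ := funext ReH.
  move=> z; apply: cvgB; last exact: cvg_cst.
  apply: cvgM; first exact: continuous_expRM.
  by apply: cvgB; [exact: (cp _ p1)|exact: (cp _ p2)].
have cIm : continuous (fun z : R => complex.Im (H z)).
  have -> : (fun z : R => complex.Im (H z)) = _ := funext ImH.
  move=> z; apply: cvgB; last exact: cvg_cst.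
  apply: cvgM; first exact: continuous_expRM.
  by apply: cvgB; [exact: (cp _ p3)|exact: (cp _ p4)].
have mH : cmeas H by split; exact: continuous_measurable_fun.
have kne m : khat log_kernel m != 0 by rewrite khat_log_kernel.
have dc : d * khat log_kernel 0 = pairing sigma phi.
  by rewrite -kernel_massE /d divfK// kernel_mass_neq0.
(* Correlating with the translate of H is testing with the dilation of phi. *)
have ptw (y x : T) : log_kernel y * H (y + x) =
   (expR (- ((rho0 + 1) * x)))%:C * kernel_pairing K nu (fun t => phi (t / expR x)) y + (- d) * log_kernel y.
  rewrite /kernel_pairing.
  have -> : (fun t => t / expR y * phi (t / expR y / expR x)) =
      (fun t => expR x * phi1 (t / expR (y + x))).
    apply/funext => t; have -> : t / expR (y + x) = t / expR y / expR x by rewrite expRD invfM mulrA.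
    exact: scale_out (lt0r_neq0 (expR_gt0 x)).
  rewrite (pairingZ nu (expR x) (test_function_scale (expR_gt0 (y + x)) hphi1)).
  rewrite -/(p (y + x)) /H mulrBr [(- d) * _]mulNr [d * _]mulrC; congr (_ - _).
  rewrite /log_kernel; set k := K _; set q := p _.
  have e : (expR (rho0 * y))%:C * (expR (- rho0 * (y + x)))%:C =
      (expR (- ((rho0 + 1) * x)))%:C * (expR x)%:C :> R[i].
    by rewrite -!rmorphM /= -!expRD; congr (_%:C); congr expR; ring.
  transitivity (((expR (rho0 * y))%:C * (expR (- rho0 * (y + x)))%:C) * (k * q)); first by ring.
  by rewrite e; ring.
have S0 (x : R) : (expR (- ((rho0 + 1) * x)))%:C * pairing sigma (fun t => phi (t / expR x)) = pairing sigma phi.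
  rewrite (limit_homogeneous hrho hmu hK hKint hs hsig x hphi) mulrA -rmorphM /= -expRD addNr expR0.
  exact: mul1r.
have e0 : (fun t => phi1 (t / expR 0)) = (fun u => u * phi u).
  by apply/funext => t; rewrite expR0 divr1.
have orth (x : R) : cintegral leb setT (fun y : T => log_kernel y * H (y + x)) = 0.
  have [ik ek] := key _ (test_function_scale (expR_gt0 x) hphi).
  have ->: (fun y : T => log_kernel y * H (y + x)) = _ := funext (ptw ^~ x).
  have il := log_kernel_integrable.
  rewrite (cintegralD measurableT (cintegrableZ _ measurableT ik) (cintegrableZ _ measurableT il)).
  rewrite (cintegralZ _ measurableT ik) (cintegralZ _ measurableT il) ek (S0 x).
  have -> : cintegral leb setT log_kernel = khat log_kernel 0.
    apply: eq_cintegral => y _; rewrite oppr0 mul0r.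
    by rewrite cexp0 mulr1.
  by rewrite mulNr dc subrr.
have := wiener_Linfty log_kernel_integrable mH Hb orth kne cRe cIm 0.
rewrite /H mulr0 expR0 /p e0 => /eqP; rewrite subr_eq0 => /eqP h.
by apply: etrans _ h; rewrite mul1r.
Qed.

(** Every test function psi is u phi (u) for a test function phi, and the
    pairing of phi with sigma is known. *)
Lemma limit_power (nu : cmeasure R) (c : R[i]) psi : parts_radon nu ->
  parts_all (tame (fun y => expR (rho0 * y))) nu ->
  (forall phi, test_function phi ->
      cintegrable leb setT (kernel_pairing K nu phi : T -> R[i]) /\
      cintegral leb setT (kernel_pairing K nu phi : T -> R[i]) = pairing sigma phi) ->
  (forall phi, test_function phi -> pairing sigma phi = (log_moment (rho0 + 1) phi)%:C * c) ->
  test_function psi ->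
  pairing nu psi = (log_moment rho0 psi)%:C * (c / kernel_mass).
Proof.
move=> hnu te key hc hpsi; have [phi hphi ->] := test_function_div hpsi.
apply: (etrans (limit_pairing hnu te key hphi)).
rewrite (hc phi hphi) mulrA; congr (_%:C * _ / _).
apply: eq_Rintegral => x _; rewrite mulrDl mul1r expRD; ring.
Qed.

(** All subsequential limits have the same pairings, so the limit set has at
    most one member; the dilations by e^n have a convergent subsequence, so
    it has one. *)
Lemma azarin_limit_power (c : R[i]) :
  (forall phi, test_function phi -> pairing sigma phi = (log_moment (rho0 + 1) phi)%:C * c) ->
  Fr_is_density rho mu (fun t => c / kernel_mass * (t `^ (rho0 - 1))%:C).
Proof.
move=> hc; have [nu0 hnu0] := power_density_exists (rho0 - 1) (c / kernel_mass).
have nu0R : parts_radon nu0 by have [[]] := hnu0.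
have pn psi : test_function psi -> pairing nu0 psi = (log_moment rho0 psi)%:C * (c / kernel_mass).
  move=> h; rewrite (has_density_pairing hnu0 h) (power_density_pairing _ _ h).
  by rewrite subrK.
exists nu0 => //; split.
  split; first by have [] := hnu0.
  have noo : (n%:R : R) @[n --> \oo] --> +oo by exact: cvgr_idn.
  have [f [nu [[fI hnu te] [cmu _ key]]]] := subsequence_limit hrho hmu hK hKint hs hsig noo.
  exists (fun n => expR (f n)%:R); split.
    by apply: expR_seq_cvgy; exact: (cvg_comp _ _ (increasing_seq_cvg fI) noo).
  move=> phi hphi; have := cmu phi hphi.
  by rewrite (limit_power hnu te key hc hphi) -(pn phi hphi).
move=> nu' [[rnu' _] [t_ [too hw]]].
apply: pairing_inj => // phi hphi.
pose x_ n := ln (t_ n).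
have xoo : x_ n @[n --> \oo] --> +oo.
  apply/cvgryPge => A; have /cvgryPge/(_ (expR A)) := too; apply: filterS => n hn.
  by rewrite /x_ -ler_expR lnK// posrE (lt_le_trans (expR_gt0 A) hn).
have [f [nu [[fI hnu te] [cmu _ key]]]] := subsequence_limit hrho hmu hK hKint hs hsig xoo.
rewrite (pn phi hphi) -(limit_power hnu te key hc hphi).
have l1 := cmu phi hphi.
have l2 : (pairing (azarin_scale rho mu (t_ (f n))) phi : R[i]^o) @[n --> \oo] --> (pairing nu' phi : R[i]^o).
  exact: (cvg_increasing_subseq fI (hw phi hphi)).
apply: (cvg_cplx_unique l2); apply: cvg_trans l1; apply: near_eq_cvg.
have tf : t_ (f n) @[n --> \oo] --> +oo by exact: (cvg_comp _ _ (increasing_seq_cvg fI) too).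
have /cvgryPge/(_ 1) := tf; apply: filterS => n hn.
by rewrite /x_ lnK// posrE (lt_le_trans ltr01 hn).
Qed.

End tauberian.

Theorem theorem5p8 (R : realType) (rho : R -> R) (rho0 : R)
  (hrho : proximate_order rho rho0)
  (mu : cmeasure R) (hmu : class_M rho mu)
  (K : R -> R[i]) (hK : cmeasurable_fun `]0, +oo[ K)
  (hKint : cintegrable lebesgue_measure `]0, +oo[
     (fun t => (t `^ (rho0 - 1) * prox_gamma rho rho0 t)%:C * K t))
  (hKne0 : forall lambda : R,
     cintegral lebesgue_measure `]0, +oo[
       (fun t => K t * cpow t ((rho0 - 1) -i* lambda)) != 0)
  (s : cmeasure R) (hs : has_density s (convolution_Psi K mu))
  (hsreg : regular_measure (fun r => rho r + 1) s) :
  let c1 := cintegral lebesgue_measure `]0, +oo[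
              (fun t => K t * (t `^ (rho0 - 1))%:C) in
  regular_measure rho mu /\
  forall c : R[i],
    Fr_is_density (fun r => rho r + 1) s (fun t => c * (t `^ rho0)%:C) ->
    Fr_is_density rho mu (fun t => c / c1 * (t `^ (rho0 - 1))%:C).
Proof.
move=> c1; split.
  have [_ _ [sigma hsig]] := hsreg.
  have sigR : parts_radon sigma by have [[[]]] := hsig.
  have [c hc] := homogeneous_pairing sigR (limit_homogeneous hrho hmu hK hKint hs hsig).
  have [nu _ hnu] := azarin_limit_power hrho hmu hK hKint hKne0 hs hsig hc.
  have [rmu [C hC]] := hmu; split => //; last by exists nu.
  by exists C => r r1; apply: hC; exact: lt_le_trans ltr01 r1.
move=> c [sigma dsig hsig].
apply: (azarin_limit_power hrho hmu hK hKint hKne0 hs hsig) => phi hphi.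
by rewrite (has_density_pairing dsig hphi) (power_density_pairing _ _ hphi).
Qed.
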